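(* Let $F$ be a finite field of characteristic $2$ with $q=|F|$ elements. Then the number of isomorphism classes of $4$-dimensional nilpotent associative algebras over $F$ is $5q+17$.
   Context: Algebras are associative algebras over $F$, not assumed unital; an algebra is nilpotent if all products of $n$ elements vanish for some $n$. *)

(* Defs.v *)
From HB Require Import structures.
From mathcomp Require Import all_boot all_order all_algebra all_field.

Set Implicit Arguments.
Unset Strict Implicit.
Unset Printing Implicit Defensive.

Import GRing.Theory.
Local Open Scope ring_scope.

(* The algebra structures of MathComp are unital, hence this record. *)
Record assocAlg (F : fieldType) := AssocAlg {
  acarrier :> vectType F;
  amul : {bilinear acarrier -> acarrier -> acarrier};
  amulA : associative amul }.

(* Without a unit only nonempty products make sense; [foldl amul x s] is the
   product of the (size s).+1 elements x :: s, in this order. *)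
Definition nilpotent_alg (F : fieldType) (A : assocAlg F) : Prop :=
  exists n : nat, forall (x : A) (s : n.-tuple A),
    foldl (amul A) x s = 0.

Definition iso_alg (F : fieldType) (A B : assocAlg F) : Prop :=
  exists f : {linear A -> B},
    bijective f /\ {morph f : x y / amul A x y >-> amul B x y}.

(* The algebras satisfying P fall into exactly n isomorphism classes:
   there is a complete irredundant family of n representatives. *)
Definition num_iso_classes (F : fieldType) (P : assocAlg F -> Prop) (n : nat)
  : Prop :=
  exists A : 'I_n -> assocAlg F,
    [/\ forall i, P (A i),
        forall i j, iso_alg (A i) (A j) -> i = j
      & forall B, P B -> exists i, iso_alg B (A i)].

(* Main.v *)
Require Import Defs.
From Stdlib Require Import Classical_Prop Ring Field.
From HB Require Import structures.
From mathcomp Require Import all_boot all_order all_algebra all_field.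
From mathcomp Require Import zify.

(* Let q = |F|. If A^3 = 0, put V = A / A^2 and k = dim A^2: composing the product
   with the linear forms on A^2 gives a k-dimensional space of bilinear forms on
   V, i.e. a space of square matrices of size m = 4 - k, and two algebras are
   isomorphic iff these spaces are congruent. For k = 0, 1, 2 there are 1,
   2q + 7 and 3q + 4 congruence classes, and k = 3 is impossible.
   If A^3 <> 0 then x^3 <> 0 for some x, and A is the algebra with basis
   x, .., x^4 or has a basis x, x^2, x^3, y with x y = 0, y x = d x^3 and
   y^2 = b x^3, where one may scale d and b to 0 or 1: 5 classes.

   In characteristic 2 every element of F is a square and c |-> c^2 + c has an
   additive image of index 2; g denotes an element outside the image.
   A nonzero 2 x 2 matrix is congruent to E11, to the identity I, to
   J = [0 1; 1 0] or to D(t) = [1 1; 0 t].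
   For k = 1 the forms are 0 + E11, 0 + I, 0 + J, 0 + D(t), 1 + I, 1 + D(t) and
   [0 0 1; 0 b 1; 1 0 c] with (b, c) = (0, 0), (1, 0), (1, g).
   For k = 2 the pencils are spanned by
   - J and E11; E11 and E22; [1 g; g 0] and T, if all forms are symmetric;
   - otherwise J and D(0); J and D(g); E11 and [0 s+1; s 0]; E11 and [0 1; 0 1];
     T and [t r; r+1 0], where r = 0, or r = g (t+1)^2 / t and t <> 0, 1,
   with T = [0 1; 1 1]. Within each branch the classes are told apart by
   properties invariant under congruence, such as containing a singular or an
   alternating form. *)

Section Development.
Set Implicit Arguments.
Unset Strict Implicit.
Unset Printing Implicit Defensive.
Import GRing.Theory.

(** * Counting equivalence classes *)

(** Characteristic 2 shapes the normal forms. Squares cannot be completed: replacing a basis vector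
    by its sum with c times another one moves a parameter by an expression in c whose linear term
    survives, and after rescaling this is c^2 + c. Such a parameter leaves two classes, 0 and g. For
    the pencils of T and [t r; r+1 0] the rescaling factor is (t+1)^2 / t, which is the origin of
    that constant and the reason why only r = 0 remains for t = 0, 1. In return symmetric forms are
    simple: u |-> M(u, u) is then the square of a linear form. The parameter t of D(t) persists
    because the determinant of a binary form and the square of the difference of its off-diagonal
    entries are both multiplied by (det P)^2, so that their quotient is invariant. The count is a
    decision tree of invariant properties. A parameter is handled in the same way, by a property
    that holds for exactly one of its values. *)

Definition classes (T : Type) (P : T -> Prop) (R : T -> T -> Prop) (n : nat) :=
  exists A : 'I_n -> T,
    [/\ forall i, P (A i),
        forall i j, R (A i) (A j) -> i = j
      & forall x, P x -> exists i, R x (A i)].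

Section Classes.
Variables (T : Type) (R : T -> T -> Prop).
Implicit Types (P Q : T -> Prop).

Lemma classes_param P (I : finType) (f : I -> T) :
    (forall i, P (f i)) -> (forall i j, R (f i) (f j) -> i = j) ->
    (forall x, P x -> exists i, R x (f i)) ->
  classes P R #|I|.
Proof.
move=> Pf fI fS; exists (f \o enum_val); split=> [i|i j /fI|x /fS[i xi]] //=.
  exact: enum_val_inj.
by exists (enum_rank i); rewrite /= enum_rankK.
Qed.

Lemma classes1 P x0 : P x0 -> (forall x, P x -> R x x0) -> classes P R 1.
Proof.
move=> Px0 xR; exists (fun=> x0); split=> // [i j _|x Px]; first by rewrite !ord1.
by exists ord0; apply: xR.
Qed.

Lemma classes_ext P P' n :
  (forall x, P x <-> P' x) -> classes P R n -> classes P' R n.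
Proof.
move=> PP' [A [PA AI AS]]; exists A; split=> // [i|x Px]; first exact/PP'.
by apply: AS; apply/PP'.
Qed.

(** Excluded middle decides Q, and its invariance keeps representatives of the two halves
    inequivalent. Iterated, this turns a tree of invariants into a sum of class counts. *)
Lemma classes_split Q P n1 n2 :
    (forall x y, R x y -> R y x) ->
    (forall x y, P x -> P y -> R x y -> Q x -> Q y) ->
    classes (fun x => P x /\ Q x) R n1 ->
    classes (fun x => P x /\ ~ Q x) R n2 ->
  classes P R (n1 + n2).
Proof.
move=> symR QR [A [PA AI AS]] [B [PB BI BS]].
exists (fun i => match split i with inl j => A j | inr j => B j end).
split=> [i|i j|x Px].
- by case: splitP => j _; [case: (PA j)|case: (PB j)].
- case: splitP => i' Ei; case: splitP => j' Ej.
  + by move/AI=> ij; apply: ord_inj; rewrite Ei Ej ij.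
  + have [[PA' QA] [PB' QB]] := (PA i', PB j').
    by move=> /(QR _ _ PA' PB')/(_ QA)/QB.
  + have [[PA' QA] [PB' QB]] := (PA j', PB i').
    by move=> /symR/(QR _ _ PA' PB')/(_ QA)/QB.
  + by move/BI=> ij; apply: ord_inj; rewrite Ei Ej ij.
- have [Qx|nQx] := classic (Q x).
    have [i xi] := AS x (conj Px Qx); exists (unsplit (inl i)).
    by rewrite unsplitK.
  have [i xi] := BS x (conj Px nQx); exists (unsplit (inr i)).
  by rewrite unsplitK.
Qed.

(** The map f is injective on classes and essentially surjective, so representatives are carried
    over by composing with f. *)
Lemma classes_transfer (T' : Type) (R' : T' -> T' -> Prop) (P : T -> Prop)
    (P' : T' -> Prop) (f : T -> T') n :
    (forall x y, R' x y -> R' y x) ->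
    (forall x y z, R' x y -> R' y z -> R' x z) ->
    (forall x, P x -> P' (f x)) ->
    (forall x y, P x -> P y -> (R' (f x) (f y) <-> R x y)) ->
    (forall y, P' y -> exists2 x, P x & R' y (f x)) ->
  classes P R n -> classes P' R' n.
Proof.
move=> symR' trR' Pf Rf fS [A [PA AI AS]]; exists (f \o A).
split=> [i|i j|y /fS[x Px yx]] /=.
- exact/Pf/PA.
- by move=> /(Rf _ _ (PA i) (PA j))/AI.
- have [i xi] := AS x Px; exists i; apply: trR' yx _.
  exact/(Rf _ _ Px (PA i)).
Qed.
End Classes.

(** * Algebras with A^3 = 0 as spaces of bilinear forms *)

Section Iso.
Local Open Scope ring_scope.
Variable F : fieldType.
Implicit Types (A B C : assocAlg F).

Lemma inj_linear_bij (U V : vectType F) (f : {linear U -> V}) :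
  \dim {:U}%VS = \dim {:V}%VS -> injective f -> bijective f.
Proof.
move=> dUV f_inj; pose g := linfun f.
have gk : lker g == 0%VS.
  apply/lker0P => x y; rewrite !lfunE; exact: f_inj.
have gim : limg g = fullv.
  apply/eqP; rewrite eqEdim subvf /= -dUV -(limg_ker_dim g fullv).
  by move/eqP: gk => ->; rewrite capv0 dimv0.
exists (g^-1)%VF => x.
  by have := lker0_lfunK gk x; rewrite lfunE.
have /memv_imgP[y _ ->] : x \in limg g by rewrite gim memvf.
by rewrite lker0_lfunK // lfunE.
Qed.

Lemma iso_alg_refl A : iso_alg A A.
Proof. by exists [the {linear A -> A} of idfun]; split=> //; exists idfun. Qed.

Lemma iso_alg_sym A B : iso_alg A B -> iso_alg B A.
Proof.
case=> f [[g fK gK] fM].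
have g_lin : linear g.
  by move=> a x y; apply: (can_inj fK); rewrite linearP !gK.
pose G := GRing.isLinear.Build F B A *:%R g g_lin.
pose G' : {linear B -> A} := HB.pack g G.
exists G'; split; first by exists f.
by move=> x y; apply: (can_inj fK); rewrite fM /= !gK.
Qed.

Lemma iso_alg_trans A B C : iso_alg A B -> iso_alg B C -> iso_alg A C.
Proof.
case=> f [f_bij fM] [g [g_bij gM]].
exists [the {linear A -> C} of g \o f]; split; first exact: bij_comp.
by move=> x y /=; rewrite fM gM.
Qed.

Lemma iso_algI A B (f : {linear A -> B}) :
    \dim {:A}%VS = \dim {:B}%VS -> (forall x, f x = 0 -> x = 0) ->
    {morph f : x y / amul A x y >-> amul B x y} ->
  iso_alg A B.
Proof.
move=> dAB f0 fM; exists f; split=> //.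
by apply: inj_linear_bij => //; apply/raddf_inj.
Qed.

(** The product U A. Multiplying on the right only, iteration from the full space gives A^2, A^3,
    and so on, matching the left-bracketed products in [nilpotent_alg]. *)
Definition mulv A (U : {vspace A}) : {vspace A} :=
  <<[seq amul A x y | x <- vbasis U, y <- vbasis fullv]>>%VS.

Definition sqalg A : {vspace A} := mulv fullv.

Section Mul.
Variable A : assocAlg F.
Implicit Types (x y z : A) (a : F).

Lemma amulDl x y z : amul A (x + y) z = amul A x z + amul A y z.
Proof. exact: linearDl. Qed.
Lemma amulDr x y z : amul A z (x + y) = amul A z x + amul A z y.
Proof. exact: linearDr. Qed.
Lemma amulZl a x y : amul A (a *: x) y = a *: amul A x y.
Proof. by rewrite linearZl_LR. Qed.
Lemma amulZr a x y : amul A x (a *: y) = a *: amul A x y.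
Proof. by rewrite linearZr_LR. Qed.
Lemma amul0l x : amul A 0 x = 0. Proof. exact: linear0l. Qed.
Lemma amul0r x : amul A x 0 = 0. Proof. exact: linear0r. Qed.

Lemma amul_sumZ (I J : finType) (a : I -> F) (b : J -> F) (e : I -> A)
    (f : J -> A) :
  amul A (\sum_i a i *: e i) (\sum_j b j *: f j) =
  \sum_i \sum_j (a i * b j) *: amul A (e i) (f j).
Proof.
rewrite linear_sumlz; apply: eq_bigr => i _; rewrite amulZl linear_sumr.
by rewrite scaler_sumr; apply: eq_bigr => j _; rewrite amulZr scalerA.
Qed.

Lemma mem_mulv (U : {vspace A}) x y : x \in U -> amul A x y \in mulv U.
Proof.
move=> xU; rewrite (coord_vbasis xU) (coord_vbasis (memvf y)) amul_sumZ.
apply: memv_suml => i _; apply: memv_suml => j _; apply/memvZ/memv_span.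
by apply/allpairsP; exists ((vbasis U)`_i, (vbasis fullv)`_j);
  rewrite !mem_nth ?size_tuple.
Qed.

Lemma mulv_subv (U V : {vspace A}) :
  (forall x y, x \in U -> amul A x y \in V) -> (mulv U <= V)%VS.
Proof.
move=> UV; apply/span_subvP => _ /allpairsP[[x y] [xU _ ->]].
exact/UV/vbasis_mem.
Qed.

Lemma mulvS (U V : {vspace A}) : (U <= V)%VS -> (mulv U <= mulv V)%VS.
Proof. by move=> /subvP UV; apply: mulv_subv => x y /UV; apply: mem_mulv. Qed.

Lemma mem_sqalg x y : amul A x y \in sqalg A.
Proof. exact/mem_mulv/memvf. Qed.

(** Since x (u v) = (x u) v, the space A A^2 lies in A^2 A; so the one-sided [mulv] also controls
    left multiplication. *)
Lemma mul_mem_sqalg x y : y \in sqalg A -> amul A x y \in mulv (sqalg A).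
Proof.
have /subvP sub : (sqalg A <= linfun (amul A x) @^-1: mulv (sqalg A))%VS.
  apply: mulv_subv => u v _; rewrite -memv_preim lfunE /= amulA.
  by rewrite mem_mulv ?mem_sqalg.
by move=> /sub; rewrite -memv_preim lfunE.
Qed.

Lemma sqalg0 (V : vectType F) (f : {linear A -> V}) x :
  (forall y z, f (amul A y z) = 0) -> x \in sqalg A -> f x = 0.
Proof.
move=> f0 xA; have : (sqalg A <= lker (linfun f))%VS.
  by apply: mulv_subv => y z _; rewrite memv_ker lfunE /= f0.
by move/subvP/(_ x xA); rewrite memv_ker lfunE => /eqP.
Qed.
End Mul.

Lemma sqalg_limg A B (f : {linear A -> B}) : bijective f ->
    {morph f : x y / amul A x y >-> amul B x y} ->
  (sqalg B <= linfun f @: sqalg A)%VS.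
Proof.
case=> g fK gK fM; apply: mulv_subv => x y _.
by rewrite -[x]gK -[y]gK -fM -[f _]lfunE memv_img ?mem_sqalg.
Qed.

Lemma mem_sqalg_iso A B (f : {linear A -> B}) x : bijective f ->
    {morph f : x y / amul A x y >-> amul B x y} ->
  f x \in sqalg B -> x \in sqalg A.
Proof.
move=> f_bij fM /(subvP (sqalg_limg f_bij fM)) /memv_imgP[y yA].
by rewrite lfunE => /(bij_inj f_bij)->.
Qed.

Lemma iso_alg_dim_sqalg A B : iso_alg A B -> \dim (sqalg A) = \dim (sqalg B).
Proof.
suff le_sq C D : iso_alg C D -> (\dim (sqalg D) <= \dim (sqalg C))%N.
  by move=> AB; apply/eqP; rewrite eqn_leq !le_sq //; apply: iso_alg_sym.
case=> f [f_bij fM]; apply: (leq_trans (dimvS (sqalg_limg f_bij fM))).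
by rewrite -(limg_ker_dim (linfun f) (sqalg C)) leq_addl.
Qed.

End Iso.

Definition nil3 (F : fieldType) (A : assocAlg F) :=
  forall x y z : A, amul A (amul A x y) z = 0%R.

(** * Bilinear forms, congruence, and the algebra attached to a tuple of forms *)

Section Forms.
Local Open Scope ring_scope.
Variable F : fieldType.

Definition bf m (M : 'M[F]_m) (u v : 'rV_m) : F := (u *m M *m v^T) 0 0.

Lemma bfDl m (M : 'M[F]_m) u v w : bf M (u + v) w = bf M u w + bf M v w.
Proof. by rewrite /bf !mulmxDl mxE. Qed.
Lemma bfDr m (M : 'M[F]_m) u v w : bf M w (u + v) = bf M w u + bf M w v.
Proof. by rewrite /bf linearD mulmxDr mxE. Qed.
Lemma bfZl m (M : 'M[F]_m) a u v : bf M (a *: u) v = a * bf M u v.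
Proof. by rewrite /bf -!scalemxAl mxE. Qed.
Lemma bfZr m (M : 'M[F]_m) a u v : bf M u (a *: v) = a * bf M u v.
Proof. by rewrite /bf linearZ -scalemxAr mxE. Qed.
Lemma bfZm m (M : 'M[F]_m) a u v : bf (a *: M) u v = a * bf M u v.
Proof. by rewrite /bf -scalemxAr -scalemxAl mxE. Qed.
Lemma bf0m m u v : bf (0 : 'M[F]_m) u v = 0.
Proof. by rewrite /bf mulmx0 mul0mx mxE. Qed.
Lemma bf_suml m I r (P : pred I) (M : I -> 'M[F]_m) u v :
  bf (\sum_(i <- r | P i) M i) u v = \sum_(i <- r | P i) bf (M i) u v.
Proof. by rewrite /bf mulmx_sumr mulmx_suml summxE. Qed.
Lemma bf_congr m (P M : 'M[F]_m) u v :
  bf (P *m M *m P^T) u v = bf M (u *m P) (v *m P).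
Proof. by rewrite /bf trmx_mul !mulmxA. Qed.
Lemma bf_delta m (M : 'M[F]_m) i j :
  bf M (delta_mx 0 i) (delta_mx 0 j) = M i j.
Proof. by rewrite /bf -rowE trmx_delta -colE !mxE. Qed.
Lemma bf_inj m (M N : 'M[F]_m) : (forall u v, bf M u v = bf N u v) -> M = N.
Proof. by move=> eMN; apply/matrixP => i j; rewrite -!bf_delta eMN. Qed.

Definition congr_forms m (W W' : {vspace 'M[F]_m}) :=
  exists2 P : 'M_m, P \in unitmx & forall M, (P *m M *m P^T \in W') = (M \in W).

Lemma congrmxK m (P M : 'M[F]_m) : P \in unitmx ->
  invmx P *m (P *m M *m P^T) *m (invmx P)^T = M.
Proof.
move=> Pu; rewrite !mulmxA mulVmx // mul1mx -mulmxA -trmx_mul mulVmx //.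
by rewrite trmx1 mulmx1.
Qed.

Lemma congrmxKV m (P M : 'M[F]_m) : P \in unitmx ->
  P *m (invmx P *m M *m (invmx P)^T) *m P^T = M.
Proof.
move=> Pu; rewrite !mulmxA mulmxV // mul1mx -mulmxA -trmx_mul mulmxV //.
by rewrite trmx1 mulmx1.
Qed.

Lemma congr_forms_sym m (W W' : {vspace 'M[F]_m}) :
  congr_forms W W' -> congr_forms W' W.
Proof.
case=> P Pu PW; exists (invmx P) => [|M]; first by rewrite unitmx_inv.
by rewrite -PW congrmxKV.
Qed.

Section CongrMap.
Variables (m : nat) (P : 'M[F]_m).
Hypothesis Pu : P \in unitmx.
Let f := linfun (mulmxr P^T \o mulmx P : 'M[F]_m -> 'M[F]_m).

Let fE N : f N = P *m N *m P^T. Proof. by rewrite lfunE. Qed.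

Let fk : lker f == 0%VS.
Proof.
apply/lker0P => x y; rewrite !fE => /(congr1 (fun N =>
  invmx P *m N *m (invmx P)^T)).
by rewrite !congrmxK.
Qed.

Let dim_f (W : {vspace 'M_m}) : \dim (f @: W) = \dim W.
Proof. by apply: limg_dim_eq; move/eqP: fk => ->; rewrite capv0. Qed.

Lemma congr_forms_leq (W W' : {vspace 'M[F]_m}) :
  (forall M, M \in W -> P *m M *m P^T \in W') -> (\dim W <= \dim W')%N.
Proof.
move=> PW; rewrite -dim_f; apply/dimvS/subvP => _ /memv_imgP[N NW ->].
by rewrite fE PW.
Qed.

(** M |-> P M P^T is injective, so the image of W has the dimension of W', and an inclusion is an
    equality. *)
Lemma congr_formsI (W W' : {vspace 'M[F]_m}) : \dim W = \dim W' ->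
    (forall M, M \in W -> P *m M *m P^T \in W') ->
  congr_forms W W'.
Proof.
move=> dW PW; exists P => // M.
have fW : (f @: W)%VS = W'.
  apply/eqP; rewrite eqEdim dim_f dW leqnn andbT.
  by apply/subvP => _ /memv_imgP[N NW ->]; rewrite fE PW.
rewrite -fW -fE; apply/idP/idP => [/memv_imgP[N NW /(lker0P fk)-> //]|].
exact: memv_img.
Qed.
End CongrMap.

Lemma congr_forms_dim m (W W' : {vspace 'M[F]_m}) :
  congr_forms W W' -> \dim W = \dim W'.
Proof.
move=> WW'; have [[P Pu PW] [Q Qu QW]] := (WW', congr_forms_sym WW').
apply/eqP; rewrite eqn_leq (congr_forms_leq Pu) => [|M]; last by rewrite PW.
by rewrite (congr_forms_leq Qu) // => M; rewrite QW.
Qed.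

Section FormsAlg.
Variables (m k : nat) (B : k.-tuple 'M[F]_m).
Let V := ('rV[F]_m * 'rV[F]_k)%type.

(** The product ignores the second summand and takes its values there. Hence all products of three
    elements vanish and associativity reads 0 = 0. *)
Definition forms_mul (x y : V) : V := (0, \row_j bf B`_j x.1 y.1).

Lemma forms_mul_bilinear : bilinear_for
  (GRing.Scale.Law.clone _ _ *:%R _) (GRing.Scale.Law.clone _ _ *:%R _)
  forms_mul.
Proof.
split=> [u|u] a x y; congr (_, _); rewrite /= ?scaler0 ?addr0 //;
  by apply/rowP => j; rewrite !mxE ?bfDl ?bfZl ?bfDr ?bfZr.
Qed.

HB.instance Definition _ := bilinear_isBilinear.Build F V V V _ _ forms_mul
  forms_mul_bilinear.

Lemma forms_mulA : associative forms_mul.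
Proof.
move=> x y z; congr (_, _); apply/rowP => j.
by rewrite !mxE /= /bf !mul0mx trmx0 mulmx0.
Qed.

Definition forms_alg : assocAlg F := AssocAlg forms_mulA.

Lemma forms_alg_nil3 : nil3 forms_alg.
Proof.
move=> x y z; congr (_, _); apply/rowP => j.
by rewrite !mxE /= /bf !mul0mx mxE.
Qed.

Lemma dim_forms_alg : \dim {:forms_alg}%VS = (m + k)%N.
Proof. by rewrite dimvf /dim /= /dim /= !mul1n. Qed.
End FormsAlg.
End Forms.

(** * Isomorphism of algebras with A^3 = 0 versus congruence of spaces of forms *)

Section FormsTransfer.
Local Open Scope ring_scope.
Variable F : fieldType.

Lemma free_span_coef (V : vectType F) k (X : k.-tuple V) (c : 'I_k -> F) :
  free X -> \sum_i c i *: X`_i = 0 -> forall i, c i = 0.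
Proof. by move/freeP; apply. Qed.

Section Square.
Variables (m k : nat) (B : k.-tuple 'M[F]_m).
Hypothesis Bfree : free B.

Definition forms_inr (t : 'rV[F]_k) : forms_alg B := (0, t).

Lemma forms_inr_is_linear : linear forms_inr.
Proof. by move=> a x y; congr (_, _); rewrite /= scaler0 addr0. Qed.
HB.instance Definition _ := GRing.isLinear.Build F _ _ _ forms_inr
  forms_inr_is_linear.

(** Freeness of B says that the matrix C, with the entries of B_j in row j, has rank k. So its
    columns span F^k, and the column of index (i, i') is the product of the basis vectors e_i and
    e_i'. *)
Lemma mem_sq_forms_alg t : forms_inr t \in sqalg (forms_alg B).
Proof.
pose C := \matrix_(j < k) mxvec B`_j; pose U := sqalg (forms_alg B).
have Cfree : row_free C.
  rewrite -kermx_eq0; apply/rowV0P => c /sub_kermxP cC.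
  apply/rowP => j; rewrite mxE; apply: (free_span_coef Bfree (c := c 0)).
  apply: (can_inj mxvecK); rewrite linear_sum linear0 -[RHS]cC mulmx_sum_row.
  by apply: eq_bigr => i _; rewrite rowK linearZ.
have /submxP[D ->] : (t <= C^T)%MS.
  by apply: submx_full; rewrite /row_full mxrank_tr.
rewrite mulmx_sum_row linear_sum; apply: memv_suml => l _; rewrite linearZ.
apply: memvZ; case/mxvec_indexP: l => i i' /=.
have -> : forms_inr (row (mxvec_index i i') C^T) =
    amul (forms_alg B) (delta_mx 0 i, 0) (delta_mx 0 i', 0).
  congr (_, _); apply/rowP => j.
  by rewrite !mxE /= bf_delta mxvecE.
exact: (@mem_sqalg _ (forms_alg B)).
Qed.

Lemma sq_forms_algP (x : forms_alg B) : x \in sqalg (forms_alg B) -> x.1 = 0.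
Proof.
have fst_lin : linear (fst : forms_alg B -> 'rV_m) by [].
pose f : {linear forms_alg B -> 'rV_m} := HB.pack fst
  (GRing.isLinear.Build F _ _ _ fst fst_lin).
by apply: (@sqalg0 _ _ _ f) => y z.
Qed.

Lemma dim_sq_forms_alg : \dim (sqalg (forms_alg B)) = k.
Proof.
pose f := linfun forms_inr.
have -> : sqalg (forms_alg B) = limg f.
  apply/vspaceP => x; apply/idP/memv_imgP => [/sq_forms_algP x0|[t _ ->]].
    exists x.2; first exact: memvf.
    by rewrite lfunE /= /forms_inr; case: x x0 => x t /= ->.
  by rewrite lfunE mem_sq_forms_alg.
rewrite limg_dim_eq; first by rewrite dimvf /dim /= mul1n.
suff /eqP-> : lker f == 0%VS by rewrite capv0.
by apply/lker0P => x y; rewrite !lfunE => -[].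
Qed.
End Square.

(** An isomorphism f respects squares, so it induces an invertible P on the quotients by the
    squares. Linear forms on the square are pulled back along f, which is why the spaces of forms
    move in the opposite direction. *)
Lemma iso_forms_congr m k k' (B : k.-tuple 'M[F]_m) (B' : k'.-tuple 'M[F]_m) :
    free B -> free B' -> iso_alg (forms_alg B) (forms_alg B') ->
  congr_forms <<B'>> <<B>>.
Proof.
move=> Bf B'f BB'; have [f [f_bij fM]] := BB'.
have := iso_alg_dim_sqalg BB'; rewrite !dim_sq_forms_alg // => ekk'.
have [g fK gK] := f_bij.
pose h (u : 'rV[F]_m) : 'rV_m := (f (u, 0)).1.
have h_lin : linear h.
  move=> a u v; rewrite /h.
  have -> : (a *: u + v, 0) = a *: (u, 0) + (v, 0) :> forms_alg B.
    by congr (_, _); rewrite /= scaler0 addr0.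
  by rewrite linearP.
pose hl : {linear 'rV_m -> 'rV_m} := HB.pack h
  (GRing.isLinear.Build F _ _ _ h h_lin).
pose P := lin1_mx hl.
have hE u : u *m P = h u by rewrite mul_rV_lin1.
have Pu : P \in unitmx.
  rewrite -row_free_unit -kermx_eq0; apply/rowV0P => u /sub_kermxP; rewrite hE /h => hu.
  suff /(mem_sqalg_iso f_bij fM)/sq_forms_algP : f (u, 0) \in sqalg (forms_alg B') by [].
  by move: hu; case: (f _) => a b /= ->; apply: mem_sq_forms_alg.
apply: (congr_formsI Pu).
  by rewrite (eqP Bf) (eqP B'f) !size_tuple.
(* The column c is the linear form on the square of the second algebra whose composite with the
   product is M; [lam] is its pullback along f. *)
move=> M MB'; pose c := \col_j coord B' j M.
pose lam (t : 'rV[F]_k) : F := ((f (forms_inr B t)).2 *m c) 0 0.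
have lam_lin a s t : lam (a *: s + t) = a * lam s + lam t.
  by rewrite /lam linearP linearP /= mulmxDl -scalemxAl !mxE.
have lam_sum I r (a : I -> F) (e : I -> 'rV_k) :
    lam (\sum_(i <- r) a i *: e i) = \sum_(i <- r) a i * lam (e i).
  elim: r => [|x r IHr]; last by rewrite !big_cons lam_lin IHr.
  by rewrite !big_nil /lam !linear0 /= mul0mx mxE.
have -> : P *m M *m P^T = \sum_j lam (delta_mx 0 j) *: B`_j.
  apply: bf_inj => u v; rewrite bf_congr bf_suml !hE.
  have <- : lam (\row_j bf B`_j u v) = bf M (h u) (h v).
    have e : forms_inr B (\row_j bf B`_j u v) = amul (forms_alg B) (u, 0) (v, 0).
      by [].
    rewrite /lam e fM /= -/(h u) -/(h v) [in RHS](coord_span MB') bf_suml mxE.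
    by apply: eq_bigr => j _; rewrite !mxE bfZm mulrC.
  rewrite [X in lam X]row_sum_delta lam_sum; apply: eq_bigr => j _.
  by rewrite mxE bfZm mulrC.
apply: memv_suml => j _; apply/memvZ/memv_span/mem_nth.
by rewrite size_tuple.
Qed.

(** P acts on the first summand. On the second acts the transpose of Q, the matrix of M |-> P M P^T
    with respect to B and B'; it is invertible because B is free. *)
Lemma congr_forms_iso m k k' (B : k.-tuple 'M[F]_m) (B' : k'.-tuple 'M[F]_m) :
    free B -> free B' -> congr_forms <<B>> <<B'>> ->
  iso_alg (forms_alg B') (forms_alg B).
Proof.
move=> Bf B'f BB'; have [P Pu PB] := BB'; have ekk' : k = k'.
  have := congr_forms_dim BB'.
  by rewrite (eqP Bf) (eqP B'f) !size_tuple.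
subst k'; pose Q := \matrix_(j < k, l < k) coord B' l (P *m B`_j *m P^T).
have QE (j : 'I_k) : P *m B`_j *m P^T = \sum_l Q j l *: B'`_l.
  rewrite [LHS](coord_span (X := B')); first by apply: eq_bigr => l _; rewrite mxE.
  by rewrite PB memv_span ?mem_nth ?size_tuple.
have Qu : Q \in unitmx.
  rewrite -row_free_unit -kermx_eq0; apply/rowV0P => c /sub_kermxP cQ.
  apply/rowP => j; rewrite mxE; apply: (free_span_coef Bf (c := c 0)).
  rewrite -[LHS](congrmxK _ Pu) mulmx_sumr mulmx_suml.
  rewrite (eq_bigr (fun j => \sum_l (c 0 j * Q j l) *: B'`_l)); last first.
    move=> l _; rewrite -scalemxAr -scalemxAl QE scaler_sumr.
    by apply: eq_bigr => i _; rewrite scalerA.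
  rewrite exchange_big /= big1 ?mulmx0 ?mul0mx // => l _.
  rewrite -scaler_suml; move/rowP/(_ l): cQ; rewrite !mxE => ->.
  by rewrite scale0r.
pose f (x : forms_alg B') : forms_alg B := (x.1 *m P, x.2 *m Q^T).
have f_lin : linear f.
  by move=> a x y; congr (_, _); rewrite /= mulmxDl -scalemxAl.
pose fl : {linear forms_alg B' -> forms_alg B} := HB.pack f
  (GRing.isLinear.Build F _ _ _ f f_lin).
apply: (@iso_algI _ _ _ fl) => [||x y]; first by rewrite !dim_forms_alg.
  move=> [u t] [/= uP tQ]; congr (_, _).
    by rewrite -[u](mulmxK Pu) uP mul0mx.
  have QTu : Q^T \in unitmx by rewrite unitmx_tr.
  by rewrite -[t](mulmxK QTu) tQ mul0mx.
congr (_, _); rewrite /= ?mul0mx //; apply/rowP => j; rewrite !mxE.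
rewrite -bf_congr QE bf_suml; apply: eq_bigr => l _.
by rewrite !mxE bfZm mulrC.
Qed.
(** A complement C of S = A^2 models the quotient, and the coordinates of the products of its basis
    vectors are the forms. The map (u, t) |-> u + t is multiplicative because S annihilates A on
    both sides. *)
Lemma nil3_forms (A : assocAlg F) m k :
    \dim {:A}%VS = (m + k)%N -> nil3 A -> \dim (sqalg A) = k ->
  exists2 B : k.-tuple 'M[F]_m, free B & iso_alg A (forms_alg B).
Proof.
move=> dA nA dS; pose S := sqalg A; pose C := (S^C)%VS.
have dC : \dim C = m by rewrite dimv_compl dimvf -[dim A]dimvf dA dS addnK.
subst k m; pose X := vbasis C; pose Y := vbasis S.
have nS x y : x \in S -> amul A x y = 0 /\ amul A y x = 0.
  move=> xS; split.
    pose g : {linear A -> A} := applyr (amul A) y.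
    by apply: (@sqalg0 _ _ _ g) => // z t; rewrite /= nA.
  by apply: (@sqalg0 _ _ _ (amul A y)) => // z t; rewrite /= amulA nA.
pose M (l : 'I_(\dim S)) : 'M[F]_(\dim C) :=
  \matrix_(i, j) coord Y l (amul A X`_i X`_j).
pose B := [tuple M l | l < \dim S].
have BE (l : 'I_(\dim S)) : B`_l = M l.
  by rewrite -tnth_nth tnth_mktuple.
have YS (l : 'I_(\dim S)) : Y`_l \in S by rewrite vbasis_mem ?mem_nth ?size_tuple.
pose f (x : forms_alg B) : A :=
  \sum_i x.1 0 i *: X`_i + \sum_l x.2 0 l *: Y`_l.
have f_lin : linear f.
  move=> a x y; rewrite /f scalerDr addrACA !scaler_sumr -!big_split /=.
  by congr (_ + _); apply: eq_bigr => i _; rewrite !mxE scalerDl scalerA.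
pose fl : {linear forms_alg B -> A} := HB.pack f
  (GRing.isLinear.Build F _ _ _ f f_lin).
have sumY (x : 'rV_(\dim S)) : \sum_l x 0 l *: Y`_l \in S.
  by apply: memv_suml => l _; apply/memvZ/YS.
have fM : {morph fl : x y / amul (forms_alg B) x y >-> amul A x y}.
  move=> x y; rewrite /= /f.
  have S0 := nS _ _ (sumY _).
  rewrite amulDl amulDr (S0 y.2 _).2 addr0 (S0 x.2 _).1 addr0 amul_sumZ /=.
  rewrite big1 ?add0r => [|i _]; last by rewrite mxE scale0r.
  rewrite (eq_bigr (fun l : 'I_(\dim S) => \sum_i \sum_j
     ((x.1 0 i * y.1 0 j) * coord Y l (amul A X`_i X`_j)) *: Y`_l)); last first.
    move=> l _; rewrite mxE BE /bf mxE.
    rewrite (eq_bigr (fun j => \sum_i x.1 0 i * y.1 0 j * coord Y l (amul A X`_i X`_j))).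
      rewrite exchange_big /= scaler_suml; apply: eq_bigr => i _.
      by rewrite scaler_suml.
    move=> j _; rewrite !mxE mulr_suml; apply: eq_bigr => i _.
    by rewrite !mxE mulrAC.
  rewrite exchange_big; apply: eq_bigr => i _; rewrite exchange_big.
  apply: eq_bigr => j _ /=; rewrite [in RHS](coord_vbasis (mem_sqalg X`_i X`_j)).
  by rewrite scaler_sumr; apply: eq_bigr => l _; rewrite scalerA.
have f0 x : fl x = 0 -> x = 0.
  rewrite /= /f => /eqP; rewrite addr_eq0 => /eqP eXY.
  have XC : \sum_i x.1 0 i *: X`_i \in C.
    by apply: memv_suml => i _; apply/memvZ; rewrite vbasis_mem ?mem_nth ?size_tuple.
  have X0 : \sum_i x.1 0 i *: X`_i = 0.
    apply/eqP; rewrite -memv0 -(capv_compl S) memv_cap XC andbT eXY.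
    by rewrite memvN.
  have Y0 : \sum_i x.2 0 i *: Y`_i = 0.
    by apply/eqP; rewrite -oppr_eq0 -eXY X0.
  case: x X0 Y0 {eXY XC} => u t /= X0 Y0; congr (_, _); apply/rowP => i; rewrite mxE.
    exact: (free_span_coef (basis_free (vbasisP C)) X0).
  exact: (free_span_coef (basis_free (vbasisP S)) Y0).
have dAB : \dim {:forms_alg B}%VS = \dim {:A}%VS by rewrite dim_forms_alg dA.
have coordY (c : 'I_(\dim S) -> F) l : coord Y l (\sum_i c i *: Y`_i) = c l.
  by rewrite coord_sum_free // (basis_free (vbasisP S)).
exists B.
  apply/freeP => c Bc l.
  (* A linear relation among the forms is a linear form on A that vanishes on all products, hence on
     A^2; its value at the l-th basis vector of A^2 is the coefficient c l. *)
  pose g : A -> F^o := fun a => \sum_l c l * coord Y l a.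
  have g_lin : linear g.
    move=> a x y; rewrite /g scaler_sumr -big_split /=; apply: eq_bigr => i _.
    by rewrite linearP mulrDr mulrCA.
  pose gl : {linear A -> F^o} := HB.pack g (GRing.isLinear.Build F _ _ _ g g_lin).
  have : gl Y`_l = 0.
    apply: sqalg0 (YS l) => x y.
    have [h _ hK] : bijective fl.
      by apply: inj_linear_bij => //; apply/raddf_inj.
    rewrite -[x]hK -[y]hK -fM /= /f big1 ?add0r => [|i _]; last by rewrite mxE scale0r.
    rewrite /g (eq_bigr (fun i => bf (c i *: B`_i) (h x).1 (h y).1)); last first.
      by move=> i _; rewrite coordY mxE bfZm.
    by rewrite -bf_suml Bc bf0m.
  rewrite /= /g (bigD1 l) //= coord_free ?(basis_free (vbasisP S)) // eqxx mulr1.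
  rewrite big1 ?addr0 // => i il.
  by rewrite coord_free ?(basis_free (vbasisP S)) // eq_sym (negPf il) mulr0.
by apply: iso_alg_sym; apply: (@iso_algI _ _ _ fl).
Qed.

Lemma classes_forms (m k n : nat) :
    classes (fun W : {vspace 'M[F]_m} => \dim W = k) (@congr_forms F m) n ->
  classes (fun A : assocAlg F =>
      [/\ \dim {:A}%VS = (m + k)%N, nil3 A & \dim (sqalg A) = k])
    (@iso_alg F) n.
Proof.
apply: (classes_transfer (f := fun W => forms_alg (vbasis W))).
- exact: iso_alg_sym.
- exact: iso_alg_trans.
- move=> W <-; split; first exact: dim_forms_alg.
    exact: forms_alg_nil3.
  by rewrite dim_sq_forms_alg // (basis_free (vbasisP W)).
- move=> W W' dW dW'; have bf (U : {vspace 'M[F]_m}) := basis_free (vbasisP U).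
  have spanE (U : {vspace 'M[F]_m}) := span_basis (vbasisP U).
  split=> [/(iso_forms_congr (bf W) (bf W'))|WW'].
    by rewrite !spanE; apply: congr_forms_sym.
  apply/iso_alg_sym; apply: congr_forms_iso; rewrite ?bf //.
  by rewrite !spanE.
- move=> A [dA nA dS]; have [B Bf AB] := nil3_forms dA nA dS.
  exists <<B>>%VS; first by rewrite (eqP Bf) size_tuple.
  apply: iso_alg_trans AB _.
  apply: congr_forms_iso => //; first exact: basis_free (vbasisP _).
  exists 1%:M; first exact: unitmx1.
  by move=> M; rewrite mul1mx trmx1 mulmx1 (span_basis (vbasisP _)).
Qed.
End FormsTransfer.

(** * Finite fields of characteristic two *)

Section CharTwo.
Local Open Scope ring_scope.
Variable F : finFieldType.
Hypothesis charF2 : 2%N \in [pchar F].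

(* The [ring] and [field] tactics of the standard library, with the field with
   two elements as coefficients, so that they decide identities up to 2 = 0. *)
Let Fcar : Type := F.
Let Fadd (x y : Fcar) : Fcar := (x : F) + y.
Let Fmul (x y : Fcar) : Fcar := (x : F) * y.
Let Fsub (x y : Fcar) : Fcar := (x : F) - y.
Let Fopp (x : Fcar) : Fcar := - (x : F).
Let Finv (x : Fcar) : Fcar := (x : F)^-1.
Let Fdiv (x y: Fcar) : Fcar := (x : F) / y.
Let Fexp (x : Fcar) (n : nat) : Fcar := (x : F) ^+ n.
Let Fzero : Fcar := 0 : F.
Let Fone : Fcar := 1 : F.

Let charF2_field :
  Field_theory.field_theory Fzero Fone Fadd Fmul Fsub Fopp Fdiv Finv (@eq Fcar).
Proof.
split; [split|..]; rewrite /Fcar /Fadd /Fmul /Fsub /Fopp /Finv /Fdiv //.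
- exact: add0r.
- exact: addrC.
- exact: addrA.
- exact: mul1r.
- exact: mulrC.
- exact: mulrA.
- exact: mulrDl.
- exact: subrr.
- by apply/eqP; exact: oner_neq0.
- by move=> p /eqP p0; exact: mulVf.
Qed.

Let charF2_morph :
  Ring_theory.ring_morph Fzero Fone Fadd Fmul Fsub Fopp (@eq Fcar)
    false true xorb andb xorb id Bool.eqb (fun b : bool => (b%:R : F)).
Proof.
have h11 : 1 + 1 = 0 :> F by rewrite -mulr2n -(pcharf0 charF2).
split; rewrite /Fcar /Fadd /Fsub /Fmul /Fopp //.
- by case; case => //=; rewrite ?mulr1n ?addr0 ?add0r ?h11.
- by case; case => //=; rewrite ?subr0 ?subrr ?sub0r // oppr_pchar2.
- by case; case => //=; rewrite ?mulr0 ?mulr1.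
- by case => //=; rewrite ?oppr0 ?oppr_pchar2.
- by case; case.
Qed.

Let charF2_power :
  Ring_theory.power_theory Fone Fmul (@eq Fcar) nat_of_bin Fexp.
Proof.
split=> x [|n]; first exact: expr0.
rewrite /Fexp; elim: n => [n IHn|n IHn|] /=; last exact: expr1.
- by rewrite NatTrec.doubleE exprS -addnn exprD IHn.
- by rewrite NatTrec.doubleE -addnn exprD IHn.
Qed.

Ltac cstF t :=
  match t with
  | Fzero => constr:(false)
  | Fone => constr:(true)
  | _ => constr:(InitialRing.NotConstant)
  end.
Ltac cstN t :=
  match t with
  | O => constr:(BinNums.N0)
  | S ?n => let m := cstN n in eval vm_compute in (BinNat.N.succ m)
  | _ => constr:(InitialRing.NotConstant)
  end.
Add Field fieldF : charF2_field
  (morphism charF2_morph, constants [cstF], power_tac charF2_power [cstN]).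

(** The reflexive tactics recognise operations syntactically, while the goals mention them through
    various structures; everything is folded into the constants of the declared field. *)
Ltac reifyF :=
  apply: (@addIr F 0);
  repeat match goal with
  | |- context [@GRing.add ?S ?x (@GRing.opp ?S' ?y)] =>
      change (@GRing.add S x (@GRing.opp S' y)) with (Fsub x y)
  | |- context [@GRing.add ?S ?x ?y] => change (@GRing.add S x y) with (Fadd x y)
  | |- context [@GRing.mul ?S ?x (@GRing.inv ?S' ?y)] =>
      change (@GRing.mul S x (@GRing.inv S' y)) with (Fdiv x y)
  | |- context [@GRing.mul ?S ?x ?y] => change (@GRing.mul S x y) with (Fmul x y)
  | |- context [@GRing.inv ?S ?x] => change (@GRing.inv S x) with (Finv x)
  | |- context [@GRing.opp ?S ?x] => change (@GRing.opp S x) with (Fopp x)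
  | |- context [@GRing.exp ?S ?x ?n] => change (@GRing.exp S x n) with (Fexp x n)
  | |- context [@GRing.zero ?S] => change (@GRing.zero S) with Fzero
  | |- context [@GRing.one ?S] => change (@GRing.one S) with Fone
  end;
  match goal with |- @eq _ ?x ?y => change (@eq Fcar x y) end.
Ltac ringF := reifyF; ring.
Ltac fieldF := reifyF; field; repeat split; try (apply/eqP; assumption).
Lemma addFF (x : F) : x + x = 0. Proof. by ringF. Qed.

Lemma addF_eq0 (x y : F) : (x + y == 0) = (x == y).
Proof. by rewrite addr_eq0 oppr_pchar2. Qed.

Lemma sqrtF (a : F) : exists b : F, b ^+ 2 = a.
Proof.
have sq_inj : injective (fun x : F => x ^+ 2).
  move=> x y /eqP; rewrite -addF_eq0.
  have -> : x ^+ 2 + y ^+ 2 = (x + y) ^+ 2 by ringF.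
  by rewrite expf_eq0 /= addF_eq0 => /eqP.
by exists (invF sq_inj a); rewrite (f_invF sq_inj).
Qed.

(** The Artin-Schreier map, additive with kernel {0, 1}. *)
Definition wp (x : F) : F := x ^+ 2 + x.

Definition is_wp (a : F) := a \in codom wp.

Lemma wpP a : reflect (exists x, a = wp x) (is_wp a).
Proof. by apply: (iffP codomP) => -[x ->]; exists x. Qed.

Lemma wpD x y : wp (x + y) = wp x + wp y.
Proof. by rewrite /wp; ringF. Qed.

Lemma is_wpD a b : is_wp a -> is_wp b -> is_wp (a + b).
Proof. by move=> /wpP[x ->] /wpP[y ->]; apply/wpP; exists (x + y); rewrite wpD. Qed.

Lemma wp_eq0 x : wp x = 0 -> x = 0 \/ x = 1.
Proof.
have -> : wp x = x * (x + 1) by rewrite /wp; ringF.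
by move/eqP; rewrite mulf_eq0 addF_eq0 => /orP[]/eqP ->; [left|right].
Qed.

(** Two preimages of the same value differ by 0 or 1, so [h], which adds a bit to a chosen preimage,
    maps the image times [bool] onto F. *)
Lemma card_wp : (#|F| <= 2 * #|[set a | is_wp a]|)%N.
Proof.
pose h (ab : F * bool) := odflt 0 [pick x | wp x == ab.1] + ab.2%:R.
rewrite -[#|F|]cardsT -card_bool mulnC -[#|{: bool}|]cardsT -cardsX.
apply: leq_trans (leq_imset_card h _); apply/subset_leq_card/subsetP => x _.
pose y := odflt 0 [pick y | wp y == wp x].
have yx : wp (x + y) = 0.
  rewrite wpD /y; case: pickP => [z /eqP ->|/(_ x)]; first exact: addFF.
  by rewrite eqxx.
have wpx : is_wp (wp x) by apply/wpP; exists x.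
apply/imsetP; case: (wp_eq0 yx) => xy.
  exists (wp x, false); first by rewrite !inE /= wpx.
  by rewrite /h /= -/y addr0; apply/eqP; rewrite -addF_eq0 xy.
exists (wp x, true); first by rewrite !inE /= wpx.
by rewrite /h /= -/y mulr1n -xy; ringF.
Qed.

(** The values at 0 and 1 coincide, so the map is not injective and, F being finite, not
    surjective. *)
Lemma ex_not_wp : exists a, ~~ is_wp a.
Proof.
case: (pickP (fun a => ~~ is_wp a)) => [a|all_wp]; first by exists a.
have wp_surj a : exists x, wp x == a.
  by have /negbFE/wpP[x ->] := all_wp a; exists x.
have gK : cancel (fun a => xchoose (wp_surj a)) wp.
  by move=> a; apply/eqP/(xchooseP (wp_surj a)).
have /(can_inj (canF_sym gK))/eqP : wp 1 = wp 0 by rewrite /wp; ringF.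
by rewrite oner_eq0.
Qed.

(* The image of wp is additive of index 2. *)
Lemma wp_index2 a b : ~~ is_wp a -> ~~ is_wp b -> is_wp (a + b).
Proof.
move=> na nb; pose I := [set c | is_wp c].
have dis : [disjoint I & +%R a @: I].
  rewrite -setI_eq0; apply/eqP/setP => x; rewrite !inE; apply/negP.
  case/andP=> xI /imsetP[y]; rewrite inE => yI xE; case/negP: na.
  by have -> : a = x + y; [rewrite xE; ringF | apply: is_wpD].
have IT : I :|: +%R a @: I = setT.
  apply/eqP; rewrite eqEcard subsetT cardsT cardsU (disjoint_setI0 dis) cards0 subn0.
  by rewrite card_imset ?addnn -?mul2n ?card_wp //; apply: addrI.
have : b \in I :|: +%R a @: I by rewrite IT inE.
rewrite !inE (negPf nb) /= => /imsetP[y]; rewrite inE => yI ->.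
by have -> : a + (a + y) = y by ringF.
Qed.

(** * Vectors and matrices of size 2 in coordinates *)

Section Explicit2.
Implicit Types (a b c d x y z t : F).

Lemma ord2P (i : 'I_2) : i = 0 \/ i = 1.
Proof. by case: i => [[|[|//]] lti]; [left|right]; apply: ord_inj. Qed.

Definition vec2 x y : 'rV[F]_2 := \row_j (if j == 0 then x else y).

Definition mx2 a b c d : 'M[F]_2 :=
  \matrix_(i, j) if i == 0 then if j == 0 then a else b
                 else if j == 0 then c else d.

Lemma vec2P (u : 'rV[F]_2) : u = vec2 (u 0 0) (u 0 1).
Proof.
by apply/rowP => j; rewrite mxE; case: (ord2P j) => ->.
Qed.

Lemma mx2P (M : 'M[F]_2) : M = mx2 (M 0 0) (M 0 1) (M 1 0) (M 1 1).
Proof.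
apply/matrixP => i j; rewrite mxE.
by case: (ord2P i) => ->; case: (ord2P j) => ->.
Qed.

Lemma vec2_eq0 x y : (vec2 x y == 0) = (x == 0) && (y == 0).
Proof.
apply/eqP/andP => [/rowP e|[/eqP-> /eqP->]].
  by have:= e 0; have := e 1; rewrite !mxE /= => -> ->.
by apply/rowP => j; rewrite !mxE if_same.
Qed.

Lemma mx2D a b c d a' b' c' d' :
  mx2 a b c d + mx2 a' b' c' d' = mx2 (a + a') (b + b') (c + c') (d + d').
Proof. by apply/matrixP => i j; rewrite !mxE; do ?case: ifP. Qed.

Lemma mx2Z x a b c d : x *: mx2 a b c d = mx2 (x * a) (x * b) (x * c) (x * d).
Proof. by apply/matrixP => i j; rewrite !mxE; do ?case: ifP. Qed.

Lemma mx2_inj a b c d a' b' c' d' : mx2 a b c d = mx2 a' b' c' d' ->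
  [/\ a = a', b = b', c = c' & d = d'].
Proof.
move/matrixP=> e; have := (e 0 0, e 0 1, (e 1 0, e 1 1)).
by rewrite !mxE /= => -[[-> ->] [-> ->]].
Qed.

Lemma mx20 : 0 = mx2 0 0 0 0.
Proof. by apply/matrixP => i j; rewrite !mxE; do ?case: ifP. Qed.

Lemma bf_mx2 a b c d x y z t :
  bf (mx2 a b c d) (vec2 x y) (vec2 z t) =
  x * a * z + x * b * t + y * c * z + y * d * t.
Proof.
rewrite /bf !mxE !big_ord_recl big_ord0 !mxE !big_ord_recl !big_ord0 !mxE /=.
by ringF.
Qed.

Lemma mx2_congr x y z t (M : 'M[F]_2) :
  mx2 x y z t *m M *m (mx2 x y z t)^T =
  mx2 (bf M (vec2 x y) (vec2 x y)) (bf M (vec2 x y) (vec2 z t))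
      (bf M (vec2 z t) (vec2 x y)) (bf M (vec2 z t) (vec2 z t)).
Proof.
apply/matrixP => i j; rewrite -bf_delta bf_congr mxE.
have row2 (k : 'I_2) : delta_mx 0 k *m mx2 x y z t =
    if k == 0 then vec2 x y else vec2 z t.
  rewrite -rowE; apply/rowP => l; rewrite !mxE.
  by case: (k == 0); rewrite !mxE.
by rewrite !row2; do ?case: ifP.
Qed.

Lemma unit_mx2 x y z t : x * t + y * z != 0 -> mx2 x y z t \in unitmx.
Proof.
move=> nz; pose e := (x * t + y * z)^-1.
suff /mulmx1_unit[] : mx2 x y z t *m mx2 (t * e) (y * e) (z * e) (x * e) = 1%:M by [].
apply/matrixP => i j; rewrite !mxE !big_ord_recl big_ord0 !mxE /= /e.
by case: (ord2P i) => ->; case: (ord2P j) => -> /=; rewrite ?mulr1n ?mulr0n; fieldF.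
Qed.

End Explicit2.

(** * Congruence invariants of spaces of forms, and two-dimensional spaces *)

Section Invariants.
Variable m : nat.
Implicit Types (M N S : 'M[F]_m) (W : {vspace 'M[F]_m}) (u v x y : 'rV[F]_m).

Definition sym_form M := forall u v, bf M u v = bf M v u.
Definition alt_form M := forall u, bf M u u = 0.
Definition singular M := exists2 y, y != 0 & forall x, bf M x y = 0.

Definition all_sym W := forall M, M \in W -> sym_form M.
Definition has_alt W := exists M, [/\ M \in W, M != 0 & alt_form M].
Definition has_sing W := exists M, [/\ M \in W, M != 0 & singular M].
Definition has_symsing W :=
  exists M, [/\ M \in W, M != 0, sym_form M & singular M].
Definition has_iso W := exists2 x, x != 0 & forall M, M \in W -> bf M x x = 0.
Definition has_iso_sker W := exists M y,
  [/\ [/\ M \in W, M != 0 & sym_form M], y != 0, forall x, bf M x y = 0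
    & forall N, N \in W -> bf N y y = 0].
(** In the pencil of E11 and [0 s+1; s 0] the vector y = e2 satisfies M(x, y) : M(y, x) = (s+1) : s.
    The equation is written without division so as to cover all s. *)
Definition has_skew_ratio s W := exists2 y, y != 0 &
  forall M x, M \in W -> s * bf M x y = (s + 1) * bf M y x.
(** In the pencil of T and [t r; r+1 0] the symmetric members S are the multiples of T, and e = e1
    spans the line on which T(e, e) = 0. For a nonsymmetric N and an f independent of e this reads t
    as N(e, e) S(f, f) divided by (N(e, f) + N(f, e)) S(e, f). *)
Definition has_iso_ratio t W := exists2 e, e != 0 &
  forall N S f, N \in W -> S \in W -> sym_form S -> bf S e e = 0 /\
    bf N e e * bf S f f = t * (bf N e f + bf N f e) * bf S e f.

(** Vectors are moved by the inverse of P and forms by P, so that values agree. Any property phrased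
    through values, membership and nonvanishing is then transported by rewriting. *)
Lemma congr_forms_transport W W' : congr_forms W W' ->
  exists (phi : 'rV[F]_m -> 'rV[F]_m) (kap : 'M[F]_m -> 'M[F]_m),
    [/\ [/\ forall u', exists u, u' = phi u & forall u, (phi u == 0) = (u == 0)],
        forall M', M' \in W' -> exists2 M, M \in W & M' = kap M,
        forall M, M \in W -> kap M \in W',
        forall M, (kap M == 0) = (M == 0)
      & forall M u v, bf (kap M) (phi u) (phi v) = bf M u v].
Proof.
case=> P Pu PW; exists (mulmx^~ (invmx P)), (fun M => P *m M *m P^T).
split=> [|M' MW'|M|M|M u v].
- split=> u; first by exists (u *m P); rewrite mulmxK.
  apply/eqP/eqP => [e|->]; last by rewrite mul0mx.
  by rewrite -[u](mulmxKV Pu) e mul0mx.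
- by exists (invmx P *m M' *m (invmx P)^T); rewrite -?PW congrmxKV.
- by rewrite PW.
- apply/eqP/eqP => [e|->]; last by rewrite mulmx0 mul0mx.
  by rewrite -[M](congrmxK _ Pu) e mulmx0 mul0mx.
- by rewrite bf_congr !mulmxKV.
Qed.

Ltac transport WW' phi kap phiS phi0 kapS kapW kap0 bfE :=
  have [phi [kap [[phiS phi0] kapS kapW kap0 bfE]]] := congr_forms_transport WW'.

Lemma all_sym_congr W W' : congr_forms W W' -> all_sym W -> all_sym W'.
Proof.
move=> WW'; transport WW' phi kap phiS phi0 kapS kapW kap0 bfE.
move=> sW _ /kapS[M MW ->] u v; have [[u' ->] [v' ->]] := (phiS u, phiS v).
by rewrite !bfE sW.
Qed.

Lemma has_alt_congr W W' : congr_forms W W' -> has_alt W -> has_alt W'.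
Proof.
move=> WW'; transport WW' phi kap phiS phi0 kapS kapW kap0 bfE.
case=> M [MW M0 Ma]; exists (kap M); rewrite kap0; split; rewrite ?kapW // => u.
by have [u' ->] := phiS u; rewrite bfE.
Qed.

Lemma has_sing_congr W W' : congr_forms W W' -> has_sing W -> has_sing W'.
Proof.
move=> WW'; transport WW' phi kap phiS phi0 kapS kapW kap0 bfE.
case=> M [MW M0 [y y0 My]]; exists (kap M); rewrite kap0; split; rewrite ?kapW //.
exists (phi y); rewrite ?phi0 // => u.
by have [u' ->] := phiS u; rewrite bfE.
Qed.

Lemma has_symsing_congr W W' :
  congr_forms W W' -> has_symsing W -> has_symsing W'.
Proof.
move=> WW'; transport WW' phi kap phiS phi0 kapS kapW kap0 bfE.
case=> M [MW M0 Ms [y y0 My]]; exists (kap M); rewrite kap0.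
split; rewrite ?kapW //.
  by move=> u v; have [[u' ->] [v' ->]] := (phiS u, phiS v); rewrite !bfE.
exists (phi y); rewrite ?phi0 // => u.
by have [u' ->] := phiS u; rewrite bfE.
Qed.

Lemma has_iso_congr W W' : congr_forms W W' -> has_iso W -> has_iso W'.
Proof.
move=> WW'; transport WW' phi kap phiS phi0 kapS kapW kap0 bfE.
case=> y y0 My; exists (phi y); rewrite ?phi0 // => _ /kapS[M MW ->].
by rewrite bfE My.
Qed.

Lemma has_iso_sker_congr W W' :
  congr_forms W W' -> has_iso_sker W -> has_iso_sker W'.
Proof.
move=> WW'; transport WW' phi kap phiS phi0 kapS kapW kap0 bfE.
case=> M [y [[MW M0 Ms] y0 My Ny]]; exists (kap M), (phi y); rewrite phi0 kap0.
split=> // [|x|_ /kapS[N NW ->]].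
- split; rewrite ?kapW // => u v.
  by have [[u' ->] [v' ->]] := (phiS u, phiS v); rewrite !bfE.
- by have [x' ->] := phiS x; rewrite bfE.
- by rewrite bfE Ny.
Qed.

Lemma has_skew_ratio_congr s W W' :
  congr_forms W W' -> has_skew_ratio s W -> has_skew_ratio s W'.
Proof.
move=> WW'; transport WW' phi kap phiS phi0 kapS kapW kap0 bfE.
case=> y y0 My; exists (phi y); rewrite ?phi0 // => _ x /kapS[M MW ->].
by have [x' ->] := phiS x; rewrite !bfE My.
Qed.

Lemma has_iso_ratio_congr t W W' :
  congr_forms W W' -> has_iso_ratio t W -> has_iso_ratio t W'.
Proof.
move=> WW'; transport WW' phi kap phiS phi0 kapS kapW kap0 bfE.
case=> e e0 He; exists (phi e); rewrite ?phi0 // => N' S' f.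
move=> /kapS[N NW ->] /kapS[S SW ->] Ss.
have [f' ->] := phiS f; rewrite !bfE; apply: He => // u v.
by rewrite -bfE Ss bfE.
Qed.

Lemma congr_forms_trans W W' W'' :
  congr_forms W W' -> congr_forms W' W'' -> congr_forms W W''.
Proof.
case=> P Pu PW [Q Qu QW]; exists (Q *m P); first by rewrite unitmx_mul Qu.
by move=> M; rewrite -PW -QW trmx_mul !mulmxA.
Qed.

Lemma congr_forms_img P W : P \in unitmx -> exists2 W', congr_forms W W' &
  forall M, M \in W -> P *m M *m P^T \in W'.
Proof.
move=> Pu; pose f := linfun (mulmxr P^T \o mulmx P : 'M[F]_m -> 'M[F]_m).
have fE N : f N = P *m N *m P^T by rewrite lfunE.
have fW M : M \in W -> P *m M *m P^T \in (f @: W)%VS.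
  by move=> MW; rewrite -fE memv_img.
exists (f @: W)%VS => //; apply: (congr_formsI Pu) => //.
have := limg_ker_dim f W.
suff -> : (W :&: lker f = 0)%VS by rewrite dimv0.
apply/eqP; rewrite -subv0; apply/subvP => M; rewrite memv_cap memv0 => /andP[_].
rewrite memv_ker fE => /eqP e.
by rewrite -[M](congrmxK _ Pu) e mulmx0 mul0mx.
Qed.

Definition pairv S N : {vspace 'M[F]_m} := (<[S]> + <[N]>)%VS.

Lemma memv_pair S N M : reflect (exists a b, M = a *: S + b *: N) (M \in pairv S N).
Proof.
apply: (iffP memv_addP) => [[_ /vlineP[a ->] [_ /vlineP[b ->] ->]]|[a [b ->]]].
  by exists a, b.
by exists (a *: S); rewrite ?memvZ ?memv_line //; exists (b *: N);
  rewrite ?memvZ ?memv_line.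
Qed.

Lemma memv_pairl S N : S \in pairv S N.
Proof. by apply/memv_pair; exists 1, 0; rewrite scale1r scale0r addr0. Qed.

Lemma memv_pairr S N : N \in pairv S N.
Proof. by apply/memv_pair; exists 0, 1; rewrite scale1r scale0r add0r. Qed.

Definition indep S N := forall a b, a *: S + b *: N = 0 -> a = 0 /\ b = 0.

Lemma indep_neq0 S N : indep S N -> S != 0 /\ N != 0.
Proof.
move=> SN; split; apply/eqP => e0.
  have /SN[/eqP] : 1 *: S + 0 *: N = 0 by rewrite e0 scaler0 scale0r addr0.
  by rewrite oner_eq0.
have /SN[_ /eqP] : 0 *: S + 1 *: N = 0 by rewrite e0 scaler0 scale0r addr0.
by rewrite oner_eq0.
Qed.

Lemma dim_pairv S N : indep S N -> \dim (pairv S N) = 2%N.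
Proof.
move=> SN; have [S0 N0] := indep_neq0 SN.
rewrite /pairv dimv_disjoint_sum ?dim_vline ?S0 ?N0 //.
apply/eqP; rewrite -subv0; apply/subvP => M; rewrite memv_cap memv0.
case/andP=> /vlineP[a ->] /vlineP[b /eqP]; rewrite -subr_eq0 -scaleNr.
by move/eqP/SN => [-> _]; rewrite scale0r.
Qed.

Lemma pairvP W : \dim W = 2%N -> exists S N, indep S N /\ W = pairv S N.
Proof.
move=> dW; have := etrans (size_tuple (vbasis W)) dW; have := vbasisP W.
case: (tval _) => [|S [|N [|//]]] // /andP[/eqP spanW].
rewrite free_cons span_seq1 seq1_free => /andP[SN N0] _.
exists S, N; split; last by rewrite /pairv -spanW span_cons span_seq1.
move=> a b e; have a0 : a = 0.
  apply: contraNeq SN => a0; apply/vlineP; exists (- b / a).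
  apply: (scalerI a0); rewrite scalerA mulrCA divff // mulr1 scaleNr.
  by apply/eqP; rewrite -addr_eq0 e.
split=> //; move/eqP: e; rewrite a0 scale0r add0r scaler_eq0 (negPf N0) orbF.
by move/eqP.
Qed.

Lemma indep_pairv W S N :
  \dim W = 2%N -> S \in W -> N \in W -> indep S N -> W = pairv S N.
Proof.
move=> dW SW NW SN; apply/esym/eqP; rewrite eqEdim dim_pairv // dW leqnn andbT.
by apply/subvP => _ /memv_pair[a [b ->]]; rewrite memvD ?memvZ.
Qed.

Lemma pairv_congr P W W' S N : P \in unitmx -> \dim W = 2%N -> \dim W' = 2%N ->
    S \in W -> N \in W -> indep S N ->
    P *m S *m P^T \in W' -> P *m N *m P^T \in W' ->
  congr_forms W W'.
Proof.
move=> Pu dW dW' SW NW SN PS PN; apply: (congr_formsI Pu); first by rewrite dW.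
rewrite (indep_pairv dW SW NW SN) => _ /memv_pair[a [b ->]].
by rewrite mulmxDr mulmxDl -!scalemxAr -!scalemxAl memvD ?memvZ.
Qed.

Lemma ex_kernel2 W (phi : 'M[F]_m -> F) : \dim W = 2%N ->
    (forall a b M N, phi (a *: M + b *: N) = a * phi M + b * phi N) ->
  exists M, [/\ M \in W, M != 0 & phi M = 0].
Proof.
move=> /pairvP[S [N [SN ->]]] phiE.
have [N0|nN0] := eqVneq (phi N) 0.
  by exists N; rewrite memv_pairr (indep_neq0 SN).2.
exists (phi N *: S + phi S *: N); split.
- by apply/memv_pair; exists (phi N), (phi S).
- by apply: contraNneq nN0 => /SN[->].
- by rewrite phiE; ringF.
Qed.
End Invariants.

(** * Pencils of binary bilinear forms *)

Section Pencils.
Implicit Types (a b c d e p q r s t y z : F) (M N S : 'M[F]_2).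
Implicit Types W : {vspace 'M[F]_2}.

Lemma sym_mx2 a b c d : sym_form (mx2 a b c d) <-> b = c.
Proof.
split=> [/(_ (vec2 1 0) (vec2 0 1))|-> u v].
  by rewrite !bf_mx2 !(mul0r, mulr0, mul1r, mulr1, addr0, add0r).
by rewrite (vec2P u) (vec2P v) !bf_mx2; ringF.
Qed.

Lemma alt_mx2 a b c d : alt_form (mx2 a b c d) <-> [/\ a = 0, d = 0 & b = c].
Proof.
split=> [alt|[-> -> ->] u]; last by rewrite (vec2P u) bf_mx2; ringF.
have := (alt (vec2 1 0), alt (vec2 0 1), alt (vec2 1 1)).
rewrite !bf_mx2 !(mul0r, mulr0, mul1r, mulr1, addr0, add0r) => -[[-> ->]].
by rewrite add0r addr0 => /eqP; rewrite addF_eq0 => /eqP.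
Qed.

Lemma ker_mx2 a b c d y z : (forall x, bf (mx2 a b c d) x (vec2 y z) = 0) <->
  a * y + b * z = 0 /\ c * y + d * z = 0.
Proof.
split=> [ker|[e1 e2] x].
  have := (ker (vec2 1 0), ker (vec2 0 1)).
  by rewrite !bf_mx2 !(mul0r, mulr0, mul1r, mulr1, addr0, add0r) => -[-> ->].
rewrite (vec2P x) bf_mx2; set x0 := x 0 0; set x1 := x 0 1.
transitivity (x0 * (a * y + b * z) + x1 * (c * y + d * z)); first by ringF.
by rewrite e1 e2; ringF.
Qed.

Lemma sing_mx2 a b c d : singular (mx2 a b c d) <-> a * d = b * c.
Proof.
split=> [[y]|e].
  rewrite (vec2P y); move: (y 0 0) (y 0 1) => {y}y z; rewrite vec2_eq0 => yz0.
  case/ker_mx2=> e1 e2; apply/eqP; rewrite -addF_eq0; move: yz0.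
  apply: contraR => nz; apply/andP; split; apply/eqP/(mulfI nz); rewrite mulr0.
    transitivity (d * (a * y + b * z) + b * (c * y + d * z)); first by ringF.
    by rewrite e1 e2; ringF.
  transitivity (c * (a * y + b * z) + a * (c * y + d * z)); first by ringF.
  by rewrite e1 e2; ringF.
have [ab0|ab] := boolP ((b == 0) && (a == 0)).
  have [cd0|cd] := boolP ((d == 0) && (c == 0)).
    exists (vec2 1 0); first by rewrite vec2_eq0 oner_eq0.
    case/andP: ab0 => /eqP-> /eqP->; case/andP: cd0 => /eqP-> /eqP->.
    by apply/ker_mx2; split; ringF.
  exists (vec2 d c); first by rewrite vec2_eq0.
  by apply/ker_mx2; split; [rewrite e|]; ringF.
exists (vec2 b a); first by rewrite vec2_eq0.
by apply/ker_mx2; split; [|rewrite mulrC -e]; ringF.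
Qed.

Definition congr_mx m (M N : 'M[F]_m) :=
  exists2 P : 'M_m, P \in unitmx & P *m M *m P^T = N.

Lemma congr_mx_trans m (M N K : 'M[F]_m) :
  congr_mx M N -> congr_mx N K -> congr_mx M K.
Proof.
case=> P Pu <- [Q Qu <-]; exists (Q *m P); first by rewrite unitmx_mul Qu.
by rewrite trmx_mul !mulmxA.
Qed.

Lemma mx2_congrI p q r s a b c d a' b' c' d' :
    a' = p * p * a + p * q * b + q * p * c + q * q * d ->
    b' = p * r * a + p * s * b + q * r * c + q * s * d ->
    c' = r * p * a + r * q * b + s * p * c + s * q * d ->
    d' = r * r * a + r * s * b + s * r * c + s * s * d ->
  mx2 p q r s *m mx2 a b c d *m (mx2 p q r s)^T = mx2 a' b' c' d'.
Proof.
by move=> -> -> -> ->; rewrite mx2_congr !bf_mx2; congr mx2; ringF.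
Qed.

Lemma congr_mx2I p q r s a b c d a' b' c' d' : p * s + q * r != 0 ->
    a' = p * p * a + p * q * b + q * p * c + q * q * d ->
    b' = p * r * a + p * s * b + q * r * c + q * s * d ->
    c' = r * p * a + r * q * b + s * p * c + s * q * d ->
    d' = r * r * a + r * s * b + s * r * c + s * s * d ->
  congr_mx (mx2 a b c d) (mx2 a' b' c' d').
Proof.
by move=> nz *; exists (mx2 p q r s); [exact: unit_mx2|exact: mx2_congrI].
Qed.

Lemma sqrtF_neq0 a : a != 0 -> exists2 b, b != 0 & a = b ^+ 2.
Proof.
have [b <-] := sqrtF a => nz; exists b => //.
by apply: contraNneq nz => ->; rewrite expr0n.
Qed.

(** Normal form of a nonsymmetric binary form. Here t is the determinant divided by the square of
    the sum of the off-diagonal entries, a congruence invariant. *)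
Definition mxD t := mx2 1 1 0 t.

Lemma mx2_normal_lead a b c d : a != 0 ->
  [\/ congr_mx (mx2 a b c d) (mx2 1 0 0 0),
      congr_mx (mx2 a b c d) (mx2 1 0 0 1)
    | exists t, congr_mx (mx2 a b c d) (mxD t)].
Proof.
move=> /sqrtF_neq0[e e0 ->].
(* The leading entry e^2 is normalised by scaling e1, and adding c / e^2 times e1 to e2 turns the
   lower left entry into c + c = 0. *)
have [b' [d' {}step]] : exists b' d', congr_mx (mx2 (e ^+ 2) b c d) (mx2 1 b' 0 d').
  exists (e^-1 * (b + c)), (c ^+ 2 / e ^+ 2 + b * c / e ^+ 2 + c ^+ 2 / e ^+ 2 + d).
  apply: (@congr_mx2I e^-1 0 (c / e ^+ 2) 1); try fieldF.
  by rewrite mulr1 mul0r addr0 invr_eq0.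
have [b0|b0] := eqVneq b' 0; last first.
  constructor 3; exists (d' / b' ^+ 2); apply: congr_mx_trans step _.
  apply: (@congr_mx2I 1 0 0 b'^-1); try fieldF.
  by rewrite mul1r mul0r addr0 invr_eq0.
rewrite b0 in step; have [d0|/sqrtF_neq0[f f0 df]] := eqVneq d' 0.
  by rewrite d0 in step; constructor 1.
rewrite df in step; constructor 2; apply: congr_mx_trans step _.
apply: (@congr_mx2I 1 0 0 f^-1); try fieldF.
by rewrite mul1r mul0r addr0 invr_eq0.
Qed.

(** If e1, e2 or e1 + e2 has a nonzero value M(u, u), it can be taken as first basis vector.
    Otherwise a = d = 0 and b = c, so M is a multiple of J. *)
Lemma mx2_normal M :
  [\/ M = 0 \/ congr_mx M (mx2 0 1 1 0), congr_mx M (mx2 1 0 0 0),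
      congr_mx M (mx2 1 0 0 1) | exists t, congr_mx M (mxD t)].
Proof.
rewrite (mx2P M); move: (M 0 0) (M 0 1) (M 1 0) (M 1 1) => a b c d.
have lead a' b' c' d' : a' != 0 -> congr_mx (mx2 a b c d) (mx2 a' b' c' d') ->
  [\/ mx2 a b c d = 0 \/ congr_mx (mx2 a b c d) (mx2 0 1 1 0),
      congr_mx (mx2 a b c d) (mx2 1 0 0 0),
      congr_mx (mx2 a b c d) (mx2 1 0 0 1)
    | exists t, congr_mx (mx2 a b c d) (mxD t)].
  move=> /(mx2_normal_lead b' c' d') + Mc.
  case=> [/(congr_mx_trans Mc)|/(congr_mx_trans Mc)|[t /(congr_mx_trans Mc)]] ?.
  - by constructor 2.
  - by constructor 3.
  - by constructor 4; exists t.
have [a0|a0] := eqVneq a 0; last first.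
  by apply: (lead a b c d a0); apply: (@congr_mx2I 1 0 0 1); try ringF;
    rewrite mulr1 mulr0 addr0 oner_eq0.
have [d0|d0] := eqVneq d 0; last first.
  by apply: (lead d c b a d0); apply: (@congr_mx2I 0 1 1 0); try ringF;
    rewrite mulr1 mulr0 add0r oner_eq0.
have [bc|bc] := eqVneq b c; last first.
  apply: (lead (b + c) b c 0); first by rewrite addF_eq0.
  rewrite a0 d0.
  apply: (@congr_mx2I 1 1 0 1); try ringF.
  by rewrite mulr1 mulr0 addr0 oner_eq0.
constructor 1; rewrite a0 d0 -bc; have [->|b0] := eqVneq b 0.
  by left; rewrite -mx20.
right; apply: (@congr_mx2I b^-1 0 0 1); try fieldF.
by rewrite mulr1 mulr0 addr0 invr_eq0.
Qed.

Definition mxJ := mx2 0 1 1 0.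
Definition mxE1 := mx2 1 0 0 0.
Definition mxE2 := mx2 0 0 0 1.

Lemma memv2 W a b S N : S \in W -> N \in W -> a *: S + b *: N \in W.
Proof. by move=> SW NW; rewrite memvD ?memvZ. Qed.

Lemma ex_indep W S : \dim W = 2%N -> S != 0 -> exists2 N, N \in W & indep S N.
Proof.
move=> dW S0; have /subvPn[N NW nNS] : ~~ (W <= <[S]>)%VS.
  by apply/negP => /dimvS; rewrite dW dim_vline S0.
exists N => // a b e; have b0 : b = 0.
  apply: contraNeq nNS => b0; apply/vlineP; exists (- a / b).
  apply: (scalerI b0); rewrite scalerA mulrCA divff // mulr1 scaleNr.
  by apply/eqP; rewrite -addr_eq0 addrC e.
split=> //; move/eqP: e; rewrite b0 scale0r addr0 scaler_eq0 (negPf S0) orbF.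
by move/eqP.
Qed.

Lemma has_altJ W : has_alt W -> mxJ \in W.
Proof.
case=> M [MW M0]; rewrite (mx2P M) => /alt_mx2[a0 d0 bc].
have b0 : M 0 1 != 0.
  by apply: contraNneq M0 => b0; rewrite (mx2P M) a0 d0 -bc b0 -mx20.
have -> : mxJ = (M 0 1)^-1 *: M.
  by rewrite {2}(mx2P M) a0 d0 -bc mx2Z mulr0 mulVf.
exact: memvZ.
Qed.

Lemma not_all_sym W : ~ all_sym W -> exists b c a d, b != c /\ mx2 a b c d \in W.
Proof.
move=> ns; apply: NNPP => none; apply: ns => M MW; rewrite (mx2P M); apply/sym_mx2.
apply/eqP/negPn/negP => bc; apply: none.
by exists (M 0 1), (M 1 0), (M 0 0), (M 1 1); rewrite -mx2P.
Qed.

Lemma all_sym_mx2 W M : all_sym W -> M \in W -> exists a b d, M = mx2 a b b d.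
Proof.
move=> sW MW; exists (M 0 0), (M 0 1), (M 1 1); rewrite [LHS]mx2P; congr mx2.
by move: (sW M MW); rewrite {1}(mx2P M) => /sym_mx2.
Qed.

Lemma sym_rank1 a b d : mx2 a b b d != 0 -> a * d = b * b ->
  congr_mx (mx2 a b b d) mxE1.
Proof.
move=> M0 ad; have [a0|a0] := eqVneq a 0.
  have b0 : b = 0.
    by apply/eqP; rewrite -[_ == _]orbb -mulf_eq0 -ad a0 mul0r.
  have d0 : d != 0 by apply: contraNneq M0 => d0; rewrite a0 b0 d0 -mx20.
  have [e e0 ->] := sqrtF_neq0 d0; rewrite a0 b0.
  apply: (@congr_mx2I 0 e^-1 1 0); try fieldF.
  by rewrite mulr0 add0r mulr1 invr_eq0.
have -> : d = b ^+ 2 / a by apply: (mulfI a0); rewrite ad; fieldF.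
have [e e0 ae] := sqrtF_neq0 a0; rewrite ae.
apply: (@congr_mx2I e^-1 0 (b / a) 1); rewrite ?ae; try fieldF.
by rewrite mulr1 mul0r addr0 invr_eq0.
Qed.

Lemma congr_mx_sym (M N : 'M[F]_2) : congr_mx M N -> sym_form M -> sym_form N.
Proof. by case=> P _ <- sM u v; rewrite !bf_congr sM. Qed.

Lemma mx2_congrJ p q r s :
  mx2 p q r s *m mxJ *m (mx2 p q r s)^T = (p * s + q * r) *: mxJ.
Proof. by rewrite mx2Z; apply: mx2_congrI; ringF. Qed.

Lemma congrJ (P : 'M[F]_2) : exists e, P *m mxJ *m P^T = e *: mxJ.
Proof.
by rewrite (mx2P P); exists (P 0 0 * P 1 1 + P 0 1 * P 1 0); rewrite mx2_congrJ.
Qed.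

(** * Normal forms of pencils of symmetric forms *)

Lemma pencil_J_E1 W : \dim W = 2%N -> all_sym W -> has_alt W ->
  congr_forms W (pairv mxJ mxE1).
Proof.
move=> dW sW /has_altJ JW.
have J0 : mxJ != 0 by rewrite /mxJ mx20; apply/eqP => /mx2_inj[_ /eqP]; rewrite oner_eq0.
have [S SW JS] := ex_indep dW J0.
have [a [b [d SE]]] := all_sym_mx2 sW SW; rewrite {}SE in SW JS.
(* Adding a multiple of J changes the off-diagonal entry freely; with e^2 = a d the matrix becomes
   singular, hence congruent to E11, and a congruence only rescales J. *)
have [e ead] := sqrtF (a * d).
have S'E : 1 *: mx2 a b b d + (e + b) *: mxJ = mx2 a e e d.
  by rewrite !mx2Z mx2D; congr mx2; ringF.
have JS' : indep mxJ (mx2 a e e d).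
  move=> x y; rewrite -S'E scalerDr !scalerA mulr1 addrCA -scalerDl addrC => /JS[h1 h2].
  by move: h1; rewrite h2 mul0r addr0.
have S'W : mx2 a e e d \in W by rewrite -S'E memv2.
have [|P Pu PS] := sym_rank1 (indep_neq0 JS').2; first by rewrite -ead.
have dJE : \dim (pairv mxJ mxE1) = 2%N.
  apply: dim_pairv => x y; rewrite !mx2Z mx2D mx20 => /mx2_inj[].
  by rewrite !mulr0 !mulr1 add0r addr0 => -> ->.
apply: (pairv_congr Pu dW dJE JW S'W JS'); last by rewrite PS memv_pairr.
by have [c ->] := congrJ P; rewrite memvZ // memv_pairl.
Qed.

Lemma dim_pair_mx2 a b c d a' b' c' d' :
    (forall x y : F, x * a + y * a' = 0 -> x * b + y * b' = 0 ->
       x * c + y * c' = 0 -> x * d + y * d' = 0 -> x = 0 /\ y = 0) ->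
  \dim (pairv (mx2 a b c d) (mx2 a' b' c' d')) = 2%N.
Proof.
move=> ind; apply: dim_pairv => x y; rewrite !mx2Z mx2D mx20 => /mx2_inj[].
exact: ind.
Qed.

Lemma mem_pair_mx2 a b c d a' b' c' d' e1 e2 e3 e4 (x y : F) :
    e1 = x * a + y * a' -> e2 = x * b + y * b' ->
    e3 = x * c + y * c' -> e4 = x * d + y * d' ->
  mx2 e1 e2 e3 e4 \in pairv (mx2 a b c d) (mx2 a' b' c' d').
Proof.
by move=> -> -> -> ->; apply/memv_pair; exists x, y; rewrite !mx2Z mx2D.
Qed.

Lemma indep_mx2 a b c d a' b' c' d' :
    (forall x y : F, x * a + y * a' = 0 -> x * b + y * b' = 0 ->
       x * c + y * c' = 0 -> x * d + y * d' = 0 -> x = 0 /\ y = 0) ->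
  indep (mx2 a b c d) (mx2 a' b' c' d').
Proof.
by move=> ind x y; rewrite !mx2Z mx2D mx20 => /mx2_inj[]; apply: ind.
Qed.

Lemma dim_E1_E2 : \dim (pairv mxE1 mxE2) = 2%N.
Proof.
by apply: dim_pair_mx2 => x y; rewrite !(mulr0, mulr1, add0r, addr0) => -> _ _ ->.
Qed.

Lemma congr_E1 W : has_symsing W -> exists2 W', congr_forms W W' & mxE1 \in W'.
Proof.
case=> M [MW M0 sM singM].
have [a [b [d ME]]] : exists a b d, M = mx2 a b b d.
  exists (M 0 0), (M 0 1), (M 1 1); rewrite [LHS]mx2P.
  by move: sM; rewrite {1}(mx2P M) => /sym_mx2 <-.
rewrite {}ME in MW M0 singM *; move/sing_mx2: singM => ad.
have [P Pu PM] := sym_rank1 M0 ad; have [W' WW' PW] := congr_forms_img W Pu.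
by exists W' => //; rewrite -PM PW.
Qed.

Lemma pencil_E1_E2 W : \dim W = 2%N -> all_sym W -> ~ has_alt W -> has_sing W ->
  congr_forms W (pairv mxE1 mxE2).
Proof.
move=> dW sW naW [M [MW M0 singM]].
have [|W' WW' E1W'] := @congr_E1 W; first by exists M; split=> //; apply: sW.
have dW' : \dim W' = 2%N by rewrite -(congr_forms_dim WW').
have sW' := all_sym_congr WW' sW.
have naW' : ~ has_alt W' by move/(has_alt_congr (congr_forms_sym WW')).
apply: (congr_forms_trans WW').
have E10 : mxE1 != 0.
  by rewrite /mxE1 mx20; apply/eqP => /mx2_inj[/eqP]; rewrite oner_eq0.
have [T TW E1T] := ex_indep dW' E10.
have [a [r [t TE]]] := all_sym_mx2 sW' TW; rewrite {}TE in TW E1T.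
have t0 : t != 0.
  apply/eqP => t0; apply: naW'; exists (a *: mxE1 + 1 *: mx2 a r r t).
  split; first exact: memv2.
    apply/eqP => /E1T[_ /eqP]; by rewrite oner_eq0.
  by rewrite !mx2Z mx2D t0; apply/alt_mx2; split; ringF.
(* Replacing e1 by e1 + (r / t) e2 clears the off-diagonal entry r and leaves E11 as it is. *)
have Pu : mx2 1 (r / t) 0 1 \in unitmx.
  by apply: unit_mx2; rewrite mulr1 mulr0 addr0 oner_eq0.
apply: (pairv_congr Pu dW' dim_E1_E2 E1W' TW E1T).
  rewrite (@mx2_congrI _ _ _ _ _ _ _ _ 1 0 0 0); try ringF.
  exact: memv_pairl.
rewrite (@mx2_congrI _ _ _ _ _ _ _ _ (a + r ^+ 2 / t) 0 0 t); try fieldF.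
by apply: (@mem_pair_mx2 _ _ _ _ _ _ _ _ _ _ _ _ (a + r ^+ 2 / t) t); ringF.
Qed.

Definition mxT := mx2 0 1 1 1.

Lemma dim_g_T g : \dim (pairv (mx2 1 g g 0) mxT) = 2%N.
Proof.
apply: dim_pair_mx2 => x y; rewrite !(mulr0, mulr1, add0r, addr0).
by move=> -> _ _ ->.
Qed.

Lemma pencil_g_T g W : ~~ is_wp g -> \dim W = 2%N -> all_sym W -> ~ has_alt W ->
  ~ has_sing W -> congr_forms W (pairv (mx2 1 g g 0) mxT).
Proof.
move=> ng dW sW naW nsW.
have ex_entry i : exists M, [/\ M \in W, M != 0 & M i i = 0].
  by apply: (@ex_kernel2 _ _ (fun M => M i i)) => // x y M N; rewrite !mxE.
have [_ [/[dup]/(all_sym_mx2 sW)[a [b [d ->]]] MW M0]] := ex_entry 1.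
rewrite mxE /= => d0; rewrite {}d0 in MW M0.
have [_ [/[dup]/(all_sym_mx2 sW)[a' [b' [d' ->]]] NW N0]] := ex_entry 0.
rewrite mxE /= => a'0; rewrite {}a'0 in NW N0.
have a0 : a != 0.
  by apply/eqP => a0; apply: naW; exists (mx2 a b b 0); split=> //; apply/alt_mx2.
have d'0 : d' != 0.
  by apply/eqP => d0; apply: naW; exists (mx2 0 b' b' d'); split=> //; apply/alt_mx2.
have b'0 : b' != 0.
  apply/eqP => b0; apply: nsW; exists (mx2 0 b' b' d'); split=> //.
  by apply/sing_mx2; rewrite b0; ringF.
have MN : indep (mx2 a b b 0) (mx2 0 b' b' d').
  apply: indep_mx2 => x y; rewrite !mulr0 addr0 add0r.
  move=> /eqP; rewrite mulf_eq0 (negPf a0) orbF => /eqP -> _ _.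
  by move=> /eqP; rewrite mulf_eq0 (negPf d'0) orbF => /eqP ->.
(* The quotient [al] decides about singular members. If it equals c^2 + c, the combination with
   coefficient y = c^2 a d' / b'^2 is singular: y a d' and (b + y b')^2 are both (c a d' / b')^2. *)
pose al := b * b' / (a * d').
have nal : ~~ is_wp al.
  apply/negP => /wpP[c alE]; apply: nsW.
  exists (1 *: mx2 a b b 0 + (c ^+ 2 * a * d' / b' ^+ 2) *: mx2 0 b' b' d').
  split; first exact: memv2.
    by apply/eqP => /MN[/eqP]; rewrite oner_eq0.
  rewrite !mx2Z mx2D; apply/sing_mx2.
  have bE : b = a * d' / b' * (c ^+ 2 + c) by rewrite -/(wp c) -alE /al; fieldF.
  rewrite bE; fieldF.
(* Thus [al] = c^2 + c + g. Scaling e1 by d' / b' and adding c times the result to e2 moves the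
   parameter to g. *)
have /wpP[c cE] := wp_index2 nal ng.
have b'd : d' / b' != 0 by rewrite mulf_neq0 ?invr_eq0.
have Pu : mx2 (d' / b') 0 (c * d' / b') 1 \in unitmx.
  by apply: unit_mx2; rewrite mulr1 mul0r addr0.
have bE : b = a * d' / b' * (c ^+ 2 + c + g).
  have <- : al = c ^+ 2 + c + g by rewrite -/(wp c) -cE; ringF.
  by rewrite /al; fieldF.
apply: (pairv_congr Pu dW (dim_g_T g) MW NW MN).
  rewrite (@mx2_congrI _ _ _ _ _ _ _ _ (a * (d' / b') ^+ 2)
    (a * (d' / b') ^+ 2 * (g + c ^+ 2)) (a * (d' / b') ^+ 2 * (g + c ^+ 2))
    (a * (d' / b') ^+ 2 * c ^+ 2)) ?bE; try fieldF.
  by apply: (@mem_pair_mx2 _ _ _ _ _ _ _ _ _ _ _ _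
    (a * (d' / b') ^+ 2) (a * (d' / b') ^+ 2 * c ^+ 2)); ringF.
rewrite (@mx2_congrI _ _ _ _ _ _ _ _ 0 d' d' d'); try fieldF.
by apply: (@mem_pair_mx2 _ _ _ _ _ _ _ _ _ _ _ _ 0 d'); ringF.
Qed.

Lemma mxJ_neq0 : mxJ != 0.
Proof. by rewrite /mxJ mx20; apply/eqP => /mx2_inj[_ /eqP]; rewrite oner_eq0. Qed.

Lemma mxE1_neq0 : mxE1 != 0.
Proof. by rewrite /mxE1 mx20; apply/eqP => /mx2_inj[/eqP]; rewrite oner_eq0. Qed.

(** * Normal forms of pencils containing a nonsymmetric form *)

Lemma sym_mxD t : ~ sym_form (mxD t).
Proof. by move/sym_mx2/eqP; rewrite oner_eq0. Qed.

Lemma congr_mx_nonsym N : ~ sym_form N -> exists t, congr_mx N (mxD t).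
Proof.
move=> ns; have cs K : congr_mx N K -> sym_form K -> False.
  case=> P Pu <- sK; apply: ns => u v; have := sK (u *m invmx P) (v *m invmx P).
  by rewrite !bf_congr !mulmxKV.
case: (mx2_normal N) => [[N0|/cs[]]|/cs[]|/cs[]|//]; last 3 first.
- exact/sym_mx2.
- exact/sym_mx2.
- exact/sym_mx2.
by case: ns; rewrite N0 => u v; rewrite !bf0m.
Qed.

Lemma dim_J_D t : \dim (pairv mxJ (mxD t)) = 2%N.
Proof.
apply: dim_pair_mx2 => x y; rewrite !(mulr0, mulr1, add0r, addr0).
by move=> -> + _ _; rewrite addr0 => ->.
Qed.

Lemma indep_J_D t : indep mxJ (mxD t).
Proof.
apply: indep_mx2 => x y; rewrite !(mulr0, mulr1, add0r, addr0).
by move=> -> + _ _; rewrite addr0 => ->.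
Qed.

Lemma pencil_J_D W : \dim W = 2%N -> ~ all_sym W -> has_alt W ->
  exists t, congr_forms W (pairv mxJ (mxD t)).
Proof.
move=> dW /not_all_sym[b [c [a [d [bc NW]]]]] /has_altJ JW.
have [|t [P Pu PN]] := @congr_mx_nonsym (mx2 a b c d).
  by move/sym_mx2/eqP; rewrite (negPf bc).
exists t.
apply: (pairv_congr Pu dW (dim_J_D t) JW NW).
- apply: indep_mx2 => x y; rewrite !(mulr0, mulr1, add0r, addr0) => _ e1 e2 _.
  have y0 : y = 0.
    have : y * (b + c) = 0.
      by transitivity ((x + y * b) + (x + y * c)); [ringF | rewrite e1 e2 addr0].
    by move/eqP; rewrite mulf_eq0 addF_eq0 (negPf bc) orbF => /eqP.
  by split=> //; move: e1; rewrite y0 mul0r addr0.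
- by have [e ->] := congrJ P; rewrite memvZ // memv_pairl.
- by rewrite PN memv_pairr.
Qed.

Lemma congr_J_D t c :
  congr_forms (pairv mxJ (mxD t)) (pairv mxJ (mxD (t + wp c))).
Proof.
(* Replacing e2 by e2 + c e1 changes D(t) into [1 1+c; c t+c^2+c], and the multiple c J takes c back
   from both off-diagonal entries. *)
have Pu : mx2 1 0 c 1 \in unitmx.
  by apply: unit_mx2; rewrite mulr1 mul0r addr0 oner_eq0.
apply: (pairv_congr Pu (dim_J_D t) (dim_J_D _) (memv_pairl _ _) (memv_pairr _ _)).
- exact: indep_J_D.
- by have [e ->] := congrJ (mx2 1 0 c 1); rewrite memvZ // memv_pairl.
- rewrite (@mx2_congrI _ _ _ _ _ _ _ _ 1 (1 + c) c (t + wp c)); try (rewrite /wp; ringF).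
  by apply: (@mem_pair_mx2 _ _ _ _ _ _ _ _ _ _ _ _ c 1); ringF.
Qed.

(** J vanishes on every (x, x), so a common isotropic vector (y, z) is a zero of y^2 + y z + t z^2;
    it has z <> 0, and c = y / z solves c^2 + c = t. *)
Lemma has_iso_J_D t : has_iso (pairv mxJ (mxD t)) <-> is_wp t.
Proof.
split=> [[x x0 isox]|/wpP[c ->]]; last first.
  exists (vec2 c 1); first by rewrite vec2_eq0 oner_eq0 andbF.
  move=> _ /memv_pair[a [b ->]]; rewrite !mx2Z mx2D bf_mx2 /wp; ringF.
have := isox _ (memv_pairr _ _); move: x0; rewrite (vec2P x) bf_mx2 vec2_eq0.
move: (x 0 0) (x 0 1) => {isox} y z yz0 e; apply/wpP; exists (y / z).
have z0 : z != 0.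
  apply: contraNneq yz0 => z0; move: e; rewrite z0 eqxx andbT.
  by rewrite !(mulr0, mulr1, mul0r, addr0) => /eqP; rewrite mulf_eq0 orbb.
apply/eqP; rewrite -addF_eq0; apply/eqP.
transitivity ((y * 1 * y + y * 1 * z + z * 0 * y + z * t * z) / z ^+ 2).
  by rewrite /wp; fieldF.
by rewrite e mul0r.
Qed.

Lemma pencil_J_D0 W : \dim W = 2%N -> ~ all_sym W -> has_alt W -> has_iso W ->
  congr_forms W (pairv mxJ (mxD 0)).
Proof.
move=> dW nsW aW isoW; have [t Wt] := pencil_J_D dW nsW aW.
have /has_iso_J_D/wpP[c tc] := has_iso_congr Wt isoW.
have -> : 0 = t + wp c by rewrite tc addFF.
exact: congr_forms_trans Wt (congr_J_D t c).
Qed.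

Lemma pencil_J_Dg g W : ~~ is_wp g -> \dim W = 2%N -> ~ all_sym W -> has_alt W ->
  ~ has_iso W -> congr_forms W (pairv mxJ (mxD g)).
Proof.
move=> ng dW nsW aW nisoW; have [t Wt] := pencil_J_D dW nsW aW.
have nt : ~~ is_wp t.
  by apply/negP => /has_iso_J_D/(has_iso_congr (congr_forms_sym Wt)).
have /wpP[c tc] := wp_index2 nt ng.
have -> : g = t + wp c by rewrite -tc; ringF.
exact: congr_forms_trans Wt (congr_J_D t c).
Qed.

(** A nonsymmetric form is scaled so that its off-diagonal entries differ by 1; [mxP] below follows
    the same rule. *)
Definition mxN s := mx2 0 (s + 1) s 0.
Definition mxC := mx2 0 1 0 1.

Lemma dim_E1_N s : \dim (pairv mxE1 (mxN s)) = 2%N.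
Proof.
apply: dim_pair_mx2 => x y; rewrite !(mulr0, mulr1, add0r, addr0) => -> e1 e2 _.
split=> //; rewrite -[y]mulr1 -(addrK s 1) [1 + s]addrC mulrBr e1 e2.
exact: subr0.
Qed.

Lemma dim_E1_C : \dim (pairv mxE1 mxC) = 2%N.
Proof.
by apply: dim_pair_mx2 => x y; rewrite !(mulr0, mulr1, add0r, addr0) => -> _ _ ->.
Qed.

Lemma pencil_symsing W : \dim W = 2%N -> ~ all_sym W -> has_symsing W ->
  exists r s t, r != s /\ exists2 W', congr_forms W W' &
    W' = pairv mxE1 (mx2 0 r s t).
Proof.
move=> dW nsW ssW; have [W' WW' E1W'] := congr_E1 ssW.
have /not_all_sym[r [s [a [t [rs NW]]]]] : ~ all_sym W'.
  by move/(all_sym_congr (congr_forms_sym WW')).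
exists r, s, t; split=> //; exists W' => //; apply: indep_pairv => //.
- by rewrite -(congr_forms_dim WW').
- have -> : mx2 0 r s t = a *: mxE1 + 1 *: mx2 a r s t.
    by rewrite !mx2Z mx2D; congr mx2; ringF.
  exact: memv2.
- apply: indep_mx2 => x y; rewrite !(mulr0, mulr1, add0r, addr0) => -> e1 e2 _.
  have : y * (r + s) = 0 by rewrite mulrDr e1 e2 addr0.
  by move/eqP; rewrite mulf_eq0 addF_eq0 (negPf rs) orbF => /eqP.
Qed.

Lemma pencil_E1_N W : \dim W = 2%N -> ~ all_sym W -> has_symsing W ->
  has_iso_sker W -> exists s, congr_forms W (pairv mxE1 (mxN s)).
Proof.
move=> dW nsW ssW iskW.
have [r [s [t [rs [W' WW' W'E]]]]] := pencil_symsing dW nsW ssW.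
have dW' : \dim W' = 2%N by rewrite -(congr_forms_dim WW').
(* As r <> s, the symmetric members are multiples of E11, whose kernel is spanned by e2; the common
   isotropy of e2 says t = 0. *)
have t0 : t = 0.
  have [M [y [[MW M0 sM] y0 My Ny]]] := has_iso_sker_congr WW' iskW.
  move: MW y0 M0 sM My Ny; rewrite W'E => /memv_pair[a [b ->]].
  rewrite !mx2Z mx2D (vec2P y); move: (y 0 0) (y 0 1) => {}y z; rewrite vec2_eq0.
  move=> yz0 M0 /sym_mx2; rewrite !(mulr0, mulr1, add0r, addr0) in M0 * => brs.
  have b0 : b = 0.
    have : b * (r + s) = 0 by rewrite mulrDr brs addFF.
    by move/eqP; rewrite mulf_eq0 addF_eq0 (negPf rs) orbF => /eqP.
  rewrite b0 !mul0r in M0 *; case/ker_mx2=> ay _ /(_ _ (memv_pairr _ _)).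
  have a0 : a != 0 by apply: contraNneq M0 => ->; rewrite -mx20.
  have y0 : y = 0 by apply: (mulfI a0); rewrite mulr0 -ay; ringF.
  move: yz0; rewrite y0 eqxx /= bf_mx2 !(mulr0, mul0r, add0r) => z0 /eqP.
  by rewrite !mulf_eq0 (negPf z0) orbF => /eqP.
have rs0 : r + s != 0 by rewrite addF_eq0.
exists (s / (r + s)); apply: (congr_forms_trans WW'); rewrite W'E t0.
suff -> : pairv mxE1 (mxN (s / (r + s))) = pairv mxE1 (mx2 0 r s 0).
  by exists 1%:M; [exact: unitmx1 | move=> M; rewrite mul1mx trmx1 mulmx1].
apply: indep_pairv; first exact: dim_E1_N.
- exact: memv_pairl.
- by apply: (@mem_pair_mx2 _ _ _ _ _ _ _ _ _ _ _ _ 0 (r + s)); fieldF.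
- apply: indep_mx2 => x y; rewrite !(mulr0, mulr1, add0r, addr0) => -> e1 e2 _.
  have : y * (r + s) = 0 by rewrite mulrDr e1 e2 addr0.
  by move/eqP; rewrite mulf_eq0 (negPf rs0) orbF => /eqP.
Qed.

Lemma pencil_E1_C W : \dim W = 2%N -> ~ all_sym W -> has_symsing W ->
  ~ has_iso_sker W -> congr_forms W (pairv mxE1 mxC).
Proof.
move=> dW nsW ssW iskW.
have [r [s [t [rs [W' WW' W'E]]]]] := pencil_symsing dW nsW ssW.
have dW' : \dim W' = 2%N by rewrite -(congr_forms_dim WW').
apply: (congr_forms_trans WW').
have rs0 : r + s != 0 by rewrite addF_eq0.
have t0 : t != 0.
  apply/eqP => t0; apply: iskW; apply: (has_iso_sker_congr (congr_forms_sym WW')).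
  exists mxE1, (vec2 0 1); rewrite W'E memv_pairl mxE1_neq0 vec2_eq0 oner_eq0 andbF.
  split=> //; first by split=> //; apply/sym_mx2.
    by apply/ker_mx2; split; ringF.
  by move=> _ /memv_pair[a [b ->]]; rewrite t0 !mx2Z mx2D bf_mx2; ringF.
(* The new first vector (t e1 + s e2) / (r + s) makes the lower left entry s t + t s = 0, up to the
   factor 1 / (r + s), and the upper right entry t. Modulo E11 this is t times [mxC]. *)
have Pu : mx2 (t / (r + s)) (s / (r + s)) 0 1 \in unitmx.
  by apply: unit_mx2; rewrite mulr1 mulr0 addr0 mulf_neq0 ?invr_eq0.
rewrite W'E; apply: (pairv_congr Pu _ dim_E1_C (memv_pairl _ _) (memv_pairr _ _)).
- by rewrite -W'E.
- apply: indep_mx2 => x y; rewrite !(mulr0, mulr1, add0r, addr0) => -> _ _ /eqP.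
  by rewrite mulf_eq0 (negPf t0) orbF => /eqP.
- rewrite (@mx2_congrI _ _ _ _ _ _ _ _ ((t / (r + s)) ^+ 2) 0 0 0); try fieldF.
  by apply: (@mem_pair_mx2 _ _ _ _ _ _ _ _ _ _ _ _ ((t / (r + s)) ^+ 2) 0); ringF.
- rewrite (@mx2_congrI _ _ _ _ _ _ _ _
    (t * s / (r + s) + t * s ^+ 2 / (r + s) ^+ 2) t 0 t); try fieldF.
  by apply: (@mem_pair_mx2 _ _ _ _ _ _ _ _ _ _ _ _
    (t * s / (r + s) + t * s ^+ 2 / (r + s) ^+ 2) t); ringF.
Qed.

Definition mxP t r := mx2 t r (r + 1) 0.

Lemma congr_I_T : congr_mx (mx2 1 0 0 1) mxT.
Proof.
apply: (@congr_mx2I 1 1 1 0); try ringF.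
by rewrite mulr0 mulr1 add0r oner_eq0.
Qed.

Lemma indep_T_P t r : indep mxT (mxP t r).
Proof.
apply: indep_mx2 => x y; rewrite !(mulr0, mulr1, add0r, addr0) => _ e1 e2 ->.
by split=> //; transitivity ((x + y * r) + (x + y * (r + 1)));
  [ringF | rewrite e1 e2 addr0].
Qed.

Lemma dim_T_P t r : \dim (pairv mxT (mxP t r)) = 2%N.
Proof. exact/dim_pairv/indep_T_P. Qed.

(** The linear form M01 + M10 vanishes on some nonzero S in W. S is symmetric, neither alternating
    nor singular, so it is congruent to I and to T. The choice of T gives a diagonal (0, 1), so that
    a multiple of T clears the lower right entry of a second generator. *)
Lemma pencil_T_P W : \dim W = 2%N -> ~ all_sym W -> ~ has_alt W -> ~ has_symsing W ->
  exists t r, congr_forms W (pairv mxT (mxP t r)).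
Proof.
move=> dW nsW naW nssW.
have [S [SW S0]] : exists S, [/\ S \in W, S != 0 & S 0 1 + S 1 0 = 0].
  apply: (@ex_kernel2 _ _ (fun M : 'M_2 => M 0 1 + M 1 0) dW) => a b M N.
  by rewrite !mxE !mulrDr addrACA.
move=> /eqP; rewrite addF_eq0 => /eqP S01.
have sS : sym_form S by rewrite (mx2P S); apply/sym_mx2.
have img N : congr_mx S N -> exists2 W', congr_forms W W' & N \in W'.
  case=> P Pu <-; have [W' WW' PW] := congr_forms_img W Pu.
  by exists W' => //; apply: PW.
have cT : congr_mx S mxT.
  case: (mx2_normal S) => [[]|||].
  - by move/eqP; rewrite (negPf S0).
  - move=> /img[W' WW' JW']; case: naW; apply: (has_alt_congr (congr_forms_sym WW')).
    by exists mxJ; split; rewrite ?mxJ_neq0 //; apply/alt_mx2.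
  - move=> /img[W' WW' E1W']; case: nssW.
    apply: (has_symsing_congr (congr_forms_sym WW')).
    exists mxE1; split; rewrite ?mxE1_neq0 //; first exact/sym_mx2.
    by apply/sing_mx2; ringF.
  - by move/congr_mx_trans; apply; apply: congr_I_T.
  - by case=> t /congr_mx_sym/(_ sS)/sym_mxD.
have [W' WW' TW'] := img _ cT.
have /not_all_sym[b [c [a [d [bc NW]]]]] : ~ all_sym W'.
  by move/(all_sym_congr (congr_forms_sym WW')).
have bc0 : b + c != 0 by rewrite addF_eq0.
exists (a / (b + c)), ((b + d) / (b + c)); apply: (congr_forms_trans WW').
suff <- : W' = pairv mxT (mxP (a / (b + c)) ((b + d) / (b + c))).
  by exists 1%:M; [exact: unitmx1 | move=> M; rewrite mul1mx trmx1 mulmx1].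
apply: indep_pairv; rewrite -?(congr_forms_dim WW') //; last exact: indep_T_P.
have -> : mxP (a / (b + c)) ((b + d) / (b + c)) =
    (d / (b + c)) *: mxT + (b + c)^-1 *: mx2 a b c d.
  by rewrite !mx2Z mx2D; congr mx2; fieldF.
exact: memv2.
Qed.

(** Replacing e2 by e2 + u e1 fixes T, and adding (t u^2 + u) T restores the zero entry. For t <> 0,
    1 and u = (t+1) x / t the shift of r is (t+1)^2 / t times x^2 + x, so only the class of r t /
    (t+1)^2 modulo the image of [wp] matters; for t = 0 or t = 1 every shift occurs. *)
Lemma congr_T_P t r u : congr_forms (pairv mxT (mxP t r))
  (pairv mxT (mxP t (r + t * u ^+ 2 + (t + 1) * u))).
Proof.
have Pu : mx2 1 0 u 1 \in unitmx.
  by apply: unit_mx2; rewrite mulr1 mul0r addr0 oner_eq0.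
apply: (pairv_congr Pu (dim_T_P _ _) (dim_T_P _ _) (memv_pairl _ _) (memv_pairr _ _)).
- exact: indep_T_P.
- rewrite (@mx2_congrI _ _ _ _ _ _ _ _ 0 1 1 1); try ringF.
  exact: memv_pairl.
- rewrite (@mx2_congrI _ _ _ _ _ _ _ _
    t (r + t * u) (r + 1 + t * u) (t * u ^+ 2 + u)); try ringF.
  by apply: (@mem_pair_mx2 _ _ _ _ _ _ _ _ _ _ _ _ (t * u ^+ 2 + u) 1); ringF.
Qed.

Lemma is_wp0 : is_wp 0.
Proof. by apply/wpP; exists 0; rewrite /wp; ringF. Qed.

(* For t = 1 the quotients are 0, by the convention x / 0 = 0. *)
Lemma congr_T_P_wp t r r' : is_wp (r * t / (t + 1) ^+ 2 + r' * t / (t + 1) ^+ 2) ->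
  congr_forms (pairv mxT (mxP t r)) (pairv mxT (mxP t r')).
Proof.
move=> wpr; suff [u ->] : exists u, r' = r + t * u ^+ 2 + (t + 1) * u.
  exact: congr_T_P.
have [->|t0] := eqVneq t 0; first by exists (r + r'); ringF.
have [->|t1] := eqVneq t 1.
  have [u ue] := sqrtF (r + r'); exists u; rewrite ue; ringF.
case/wpP: wpr => x xe; exists ((t + 1) * x / t).
have t10 : t + 1 != 0 by rewrite addF_eq0.
transitivity (r + (t + 1) ^+ 2 / t * wp x); first by rewrite -xe; fieldF.
by rewrite /wp; fieldF.
Qed.

(** T itself is nonsingular, and a T + [t r; r+1 0] is singular iff (a + r)^2 + (a + r) = t a. For t
    <> 1, writing a + r = (t+1) x turns this into x^2 + x = r t / (t+1)^2. *)
Lemma has_sing_T_P t r :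
  has_sing (pairv mxT (mxP t r)) <-> is_wp (r * t / (t + 1) ^+ 2).
Proof.
split=> [[_ [/memv_pair[a [b ->]]]]|wpr].
  rewrite !mx2Z mx2D mx20 => M0 /sing_mx2 e.
  have [->|t1] := eqVneq t 1; first by rewrite addFF expr0n invr0 mulr0 is_wp0.
  have t10 : t + 1 != 0 by rewrite addF_eq0.
  have b0 : b != 0.
    apply/eqP => b0; have a0 : a = 0.
      apply/eqP; rewrite -[_ == _]orbb -mulf_eq0; apply/eqP.
      by move: e; rewrite b0 => e; transitivity ((a * 0 + 0 * t) * (a * 1 + 0 * 0));
        [rewrite e|]; ringF.
    by move/eqP: M0; apply; rewrite a0 b0; congr mx2; ringF.
  apply/wpP; exists ((a / b + r) / (t + 1)); apply/eqP; rewrite -addF_eq0; apply/eqP.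
  transitivity (((a * 0 + b * t) * (a * 1 + b * 0) +
    (a * 1 + b * r) * (a * 1 + b * (r + 1))) / (b ^+ 2 * (t + 1) ^+ 2)).
    by rewrite /wp; fieldF.
  by rewrite e addFF mul0r.
suff [a ae] : exists a, t * a = (a + r) * (a + (r + 1)).
  exists (a *: mxT + 1 *: mxP t r); split; first by apply/memv_pair; exists a, 1.
    by apply/eqP => /indep_T_P[_ /eqP]; rewrite oner_eq0.
  rewrite !mx2Z mx2D; apply/sing_mx2.
  by transitivity (t * a); [|rewrite ae]; ringF.
have [->|t0] := eqVneq t 0; first by exists r; ringF.
have [->|t1] := eqVneq t 1.
  have [u ue] := sqrtF (r ^+ 2 + r); exists u.
  by transitivity (u ^+ 2 + (r ^+ 2 + r) + u); [rewrite ue|]; ringF.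
have t10 : t + 1 != 0 by rewrite addF_eq0.
case/wpP: wpr => x xe; exists ((t + 1) * x + r).
have re : r = (t + 1) ^+ 2 / t * (x ^+ 2 + x) by rewrite -/(wp x) -xe; fieldF.
by rewrite re; fieldF.
Qed.

Lemma pencil_T_P0 W : \dim W = 2%N -> ~ all_sym W -> ~ has_alt W -> ~ has_symsing W ->
  has_sing W -> exists t, congr_forms W (pairv mxT (mxP t 0)).
Proof.
move=> dW nsW naW nssW sW; have [t [r WW']] := pencil_T_P dW nsW naW nssW.
exists t; apply: (congr_forms_trans WW'); apply: congr_T_P_wp.
by rewrite !mul0r addr0; apply/has_sing_T_P; apply: has_sing_congr sW.
Qed.

Lemma pencil_T_Pg g W : ~~ is_wp g -> \dim W = 2%N -> ~ all_sym W -> ~ has_alt W ->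
    ~ has_symsing W -> ~ has_sing W ->
  exists t, [/\ t != 0, t != 1 &
    congr_forms W (pairv mxT (mxP t (g * (t + 1) ^+ 2 / t)))].
Proof.
move=> ng dW nsW naW nssW nsiW; have [t [r WW']] := pencil_T_P dW nsW naW nssW.
have nr : ~~ is_wp (r * t / (t + 1) ^+ 2).
  by apply/negP => /has_sing_T_P/(has_sing_congr (congr_forms_sym WW')).
(* For t = 0 and t = 1 the quotient is 0, which lies in the image of [wp]; the latter uses the
   convention x / 0 = 0. *)
have t0 : t != 0 by apply: contraNneq nr => ->; rewrite mulr0 mul0r is_wp0.
have t1 : t != 1.
  by apply: contraNneq nr => ->; rewrite addFF expr0n invr0 mulr0 is_wp0.
have t10 : t + 1 != 0 by rewrite addF_eq0.
exists t; split=> //; apply: (congr_forms_trans WW'); apply: congr_T_P_wp.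
apply: wp_index2 => //.
by have -> : g * (t + 1) ^+ 2 / t * t / (t + 1) ^+ 2 = g by fieldF.
Qed.

Lemma has_iso_ratio_T_P t t' r :
  has_iso_ratio t (pairv mxT (mxP t' r)) <-> t = t'.
Proof.
split=> [[e e0 iso]|<-]; last first.
  exists (vec2 1 0); first by rewrite vec2_eq0 oner_eq0.
  move=> _ _ f /memv_pair[a [b ->]] /memv_pair[c [d ->]].
  rewrite !mx2Z !mx2D => /sym_mx2 cd; have d0 : d = 0.
    by transitivity ((c * 1 + d * r) + (c * 1 + d * (r + 1))); [|rewrite cd]; ringF.
  by rewrite d0 (vec2P f) !bf_mx2; split; ringF.
(* Test with S = T, N the other generator and f = e2: T(e, e) = z^2 = 0 puts e on the line of e1,
   and the second equation becomes y^2 t' = t y^2. *)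
have sT : sym_form mxT by apply/sym_mx2.
have := iso _ _ (vec2 0 1) (memv_pairr _ _) (memv_pairl _ _) sT.
move: e0; rewrite (vec2P e) vec2_eq0; move: (e 0 0) (e 0 1) => y z yz0.
rewrite !bf_mx2 => -[zz]; have z0 : z = 0.
  apply/eqP; rewrite -[_ == _]orbb -mulf_eq0; apply/eqP; rewrite -[RHS]zz; ringF.
move: yz0; rewrite z0 eqxx andbT => y0 eq; apply: (mulfI (mulf_neq0 y0 y0)).
apply/esym; transitivity (y * t' * y * 1); first by ringF.
rewrite !(mul0r, mulr0, add0r, addr0, mulr1, mul1r) in eq *.
by rewrite eq; ringF.
Qed.

(** * Invariants of the representative pencils, and their count *)

Lemma has_alt_pair a b c d a' b' c' d' :
    has_alt (pairv (mx2 a b c d) (mx2 a' b' c' d')) ->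
  exists x y : F, [/\ x * a + y * a' = 0, x * b + y * b' = 1,
    x * c + y * c' = 1 & x * d + y * d' = 0].
Proof.
move/has_altJ/memv_pair=> [x [y]]; rewrite !mx2Z mx2D => /mx2_inj[? ? ? ?].
by exists x, y.
Qed.

Lemma all_sym_pair a b d a' b' d' : all_sym (pairv (mx2 a b b d) (mx2 a' b' b' d')).
Proof. by move=> _ /memv_pair[x [y ->]]; rewrite !mx2Z mx2D; apply/sym_mx2. Qed.

Lemma not_all_symr S a b c d : b != c -> ~ all_sym (pairv S (mx2 a b c d)).
Proof. by move=> bc /(_ _ (memv_pairr _ _))/sym_mx2/eqP; rewrite (negPf bc). Qed.

Lemma has_altl N : has_alt (pairv mxJ N).
Proof. by exists mxJ; rewrite memv_pairl mxJ_neq0; split=> //; apply/alt_mx2. Qed.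

Lemma has_symsingl N : has_symsing (pairv mxE1 N).
Proof.
exists mxE1; rewrite memv_pairl mxE1_neq0; split=> //; first exact/sym_mx2.
by apply/sing_mx2; ringF.
Qed.

Lemma addF1_neq s : s + 1 != s.
Proof. by rewrite -addF_eq0 addrC addrA addFF add0r oner_eq0. Qed.

Lemma dim_J_E1 : \dim (pairv mxJ mxE1) = 2%N.
Proof.
by apply: dim_pair_mx2 => x y; rewrite !(mulr0, mulr1, add0r, addr0) => -> ->.
Qed.

Lemma no_alt_E1_E2 : ~ has_alt (pairv mxE1 mxE2).
Proof.
by case/has_alt_pair=> x [y [_ + _ _]];
  rewrite !mulr0 addr0 => /esym/eqP; rewrite oner_eq0.
Qed.

Lemma no_alt_g_T g : ~ has_alt (pairv (mx2 1 g g 0) mxT).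
Proof.
case/has_alt_pair=> x [y []]; rewrite !(mulr0, mulr1, add0r, addr0) => -> e _ y0.
by move/esym/eqP: e; rewrite y0 mul0r addr0 oner_eq0.
Qed.

Lemma no_sing_g_T g : ~~ is_wp g -> ~ has_sing (pairv (mx2 1 g g 0) mxT).
Proof.
move=> ng [_ [/memv_pair[x [y ->]]]]; rewrite !mx2Z mx2D => M0 /sing_mx2.
rewrite !(mulr0, mulr1, add0r, addr0) in M0 * => e.
have x0 : x != 0.
  apply: contraNneq M0 => x0; rewrite x0 !(mul0r, add0r) in e *.
  by move/esym/eqP: e; rewrite mulf_eq0 orbb => /eqP ->; rewrite -mx20.
case/negP: ng; apply/wpP; exists (y / x + g); apply/eqP; rewrite -addF_eq0.
apply/eqP; transitivity ((x * y + (x * g + y) * (x * g + y)) / x ^+ 2).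
  by rewrite /wp; fieldF.
by rewrite e addFF mul0r.
Qed.

Lemma no_alt_E1_N s : ~ has_alt (pairv mxE1 (mxN s)).
Proof.
case/has_alt_pair=> x [y [_]]; rewrite !(mulr0, mulr1, add0r, addr0) mulrDr.
move=> + ys; rewrite ys mulr1 => e _; have y0 : y = 0.
  by transitivity (1 + y + 1); [|rewrite e]; ringF.
by move/esym/eqP: ys; rewrite y0 mul0r oner_eq0.
Qed.

Lemma no_alt_E1_C : ~ has_alt (pairv mxE1 mxC).
Proof.
by case/has_alt_pair=> x [y [_ _ + _]];
  rewrite !mulr0 addr0 => /esym/eqP; rewrite oner_eq0.
Qed.

Lemma has_iso_sker_E1_N s : has_iso_sker (pairv mxE1 (mxN s)).
Proof.
exists mxE1, (vec2 0 1); rewrite memv_pairl mxE1_neq0 vec2_eq0 oner_eq0 andbF.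
split=> //; first by split=> //; apply/sym_mx2.
  by apply/ker_mx2; split; ringF.
by move=> _ /memv_pair[a [b ->]]; rewrite !mx2Z mx2D bf_mx2; ringF.
Qed.

Lemma no_iso_sker_E1_C : ~ has_iso_sker (pairv mxE1 mxC).
Proof.
case=> _ [y [[/memv_pair[a [b ->]] M0 sM] y0 ker iso]].
move: M0 sM ker (iso _ (memv_pairr _ _)); rewrite !mx2Z mx2D.
rewrite !(mulr0, mulr1, add0r, addr0) => M0 /sym_mx2 b0.
rewrite b0 in M0 *; have a0 : a != 0 by apply: contraNneq M0 => ->; rewrite -mx20.
rewrite (vec2P y) vec2_eq0 in y0 * => /ker_mx2[ay _].
have y00 : y 0 0 = 0 by apply: (mulfI a0); rewrite mulr0 -ay; ringF.
rewrite bf_mx2 y00 !(mulr0, mul0r, add0r, mulr1) => /eqP.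
by rewrite mulf_eq0 orbb => z0; rewrite y00 z0 eqxx in y0.
Qed.

Lemma has_skew_ratio_E1_N s s' : has_skew_ratio s (pairv mxE1 (mxN s')) <-> s = s'.
Proof.
split=> [[y y0 sk]|<-]; last first.
  exists (vec2 0 1); first by rewrite vec2_eq0 oner_eq0 andbF.
  move=> _ x /memv_pair[a [b ->]].
  by rewrite (vec2P x) !mx2Z !mx2D !bf_mx2; ringF.
have := sk _ (vec2 1 0) (memv_pairl _ _); have := sk _ (vec2 1 0) (memv_pairr _ _).
move: y0; rewrite (vec2P y) vec2_eq0 !bf_mx2; move: (y 0 0) (y 0 1) => {sk}y z.
rewrite !(mulr0, mulr1, mul0r, mul1r, add0r, addr0) => yz0 e1 e2.
have y0 : y = 0 by transitivity (s * y + (s + 1) * y); [ringF | rewrite e2 addFF].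
rewrite y0 eqxx /= in yz0; apply: (mulfI yz0).
transitivity (s * ((s' + 1) * z) + s * s' * z); first by ringF.
by rewrite e1; ringF.
Qed.

Lemma no_alt_T_P t r : ~ has_alt (pairv mxT (mxP t r)).
Proof.
case/has_alt_pair=> x [y []]; rewrite !(mulr0, mulr1, add0r, addr0) => _ e1 e2 x0.
rewrite x0 !add0r mulrDr mulr1 in e1 e2.
have y0 : y = 0 by transitivity (y * r + y + y * r); [ringF | rewrite e2 e1 addFF].
by move/esym/eqP: e1; rewrite y0 mul0r oner_eq0.
Qed.

Lemma no_symsing_T_P t r : ~ has_symsing (pairv mxT (mxP t r)).
Proof.
case=> _ [/memv_pair[a [b ->]]]; rewrite !mx2Z mx2D => M0 /sym_mx2 e /sing_mx2.
have b0 : b = 0.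
  by transitivity ((a * 1 + b * r) + (a * 1 + b * (r + 1))); [|rewrite e]; ringF.
rewrite b0 !(mulr0, mul0r, mulr1, addr0) in M0 * => /esym/eqP.
by rewrite mulf_eq0 orbb => /eqP a0; move: M0; rewrite a0 -mx20 eqxx.
Qed.

Lemma classes_pencils :
  classes (fun W : {vspace 'M[F]_2} => \dim W = 2%N) (@congr_forms F 2)
    (3 * #|F| + 4).
Proof.
have [g ng] := ex_not_wp; pose I := {t : F | (t != 0) && (t != 1)}.
have cardI : #|{: I}| + 2 = #|F|.
  rewrite card_sig -(cardC (pred2 (0 : F) 1)) card2 eq_sym oner_eq0 addnC.
  by congr (_ + _)%N; apply: eq_card => t; rewrite !inE negb_or.
(* The summands follow the tree below. Symmetric pencils: with an alternating member, else with or
   without a singular one. Other pencils: with an alternating member (2), with a symmetric singular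
   one (the family in s and one more), and finally T with r = 0 or with r from g, where t avoids 0
   and 1. *)
have -> : (3 * #|F| + 4 = (1 + (1 + 1)) +
    ((1 + 1) + ((#|F| + 1) + (#|F| + #|{: I}|))))%N.
  by lia.
have csym := @congr_forms_sym F 2.
apply: (classes_split (Q := @all_sym 2)) => //.
- by move=> W W' _ _; apply: all_sym_congr.
- apply: (classes_split (Q := @has_alt 2)) => //.
  + by move=> W W' _ _; apply: has_alt_congr.
  + apply: (classes1 (x0 := pairv mxJ mxE1)).
      by split; [split; [exact: dim_J_E1|exact: all_sym_pair]|exact: has_altl].
    by move=> W [[]]; apply: pencil_J_E1.
  apply: (classes_split (Q := @has_sing 2)) => //.
  + by move=> W W' _ _; apply: has_sing_congr.
  + apply: (classes1 (x0 := pairv mxE1 mxE2)).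
      split; first by split; [split; [exact: dim_E1_E2|exact: all_sym_pair]
        |exact: no_alt_E1_E2].
      exists mxE1; rewrite memv_pairl mxE1_neq0; split=> //.
      by apply/sing_mx2; ringF.
    by move=> W [[[]]]; apply: pencil_E1_E2.
  + apply: (classes1 (x0 := pairv (mx2 1 g g 0) mxT)).
      by split; [split; [split; [exact: dim_g_T|exact: all_sym_pair]
        |exact: no_alt_g_T]|exact: no_sing_g_T].
    by move=> W [[[]]]; apply: pencil_g_T.
apply: (classes_split (Q := @has_alt 2)) => //.
- by move=> W W' _ _; apply: has_alt_congr.
- have nsJD t : ~ all_sym (pairv mxJ (mxD t)) by apply: not_all_symr; apply: oner_neq0.
  apply: (classes_split (Q := @has_iso 2)) => //.
  + by move=> W W' _ _; apply: has_iso_congr.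
  + apply: (classes1 (x0 := pairv mxJ (mxD 0))).
      by rewrite dim_J_D; do !split=> //; [exact: has_altl | apply/has_iso_J_D/is_wp0].
    by move=> W [[[]]]; apply: pencil_J_D0.
  + apply: (classes1 (x0 := pairv mxJ (mxD g))).
      rewrite dim_J_D; do !split=> //; first exact: has_altl.
      by move/has_iso_J_D; apply/negP.
    by move=> W [[[]]]; apply: pencil_J_Dg.
apply: (classes_split (Q := @has_symsing 2)) => //.
- by move=> W W' _ _; apply: has_symsing_congr.
- apply: (classes_split (Q := @has_iso_sker 2)) => //.
  + by move=> W W' _ _; apply: has_iso_sker_congr.
  + apply: (classes_param (f := fun s => pairv mxE1 (mxN s))).
    * move=> s; rewrite dim_E1_N; do !split=> //.
      - by apply: not_all_symr; apply: addF1_neq.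
      - exact: no_alt_E1_N.
      - exact: has_symsingl.
      - exact: has_iso_sker_E1_N.
    * move=> s s' /has_skew_ratio_congr/(_ _).
      by move/(_ s)/(_ _)/has_skew_ratio_E1_N; apply; apply/has_skew_ratio_E1_N.
    * by move=> W [[[[dW nsW] _] ssW] skW]; apply: pencil_E1_N.
  + apply: (classes1 (x0 := pairv mxE1 mxC)).
      rewrite dim_E1_C; do !split=> //.
      - by apply: not_all_symr; apply: oner_neq0.
      - exact: no_alt_E1_C.
      - exact: has_symsingl.
      - exact: no_iso_sker_E1_C.
    by move=> W [[[[dW nsW] _] ssW] skW]; apply: pencil_E1_C.
have rep t r : (((\dim (pairv mxT (mxP t r)) = 2%N /\ ~ all_sym (pairv mxT (mxP t r))) /\
    ~ has_alt (pairv mxT (mxP t r))) /\ ~ has_symsing (pairv mxT (mxP t r))).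
  rewrite dim_T_P; do !split=> //.
  - by apply: not_all_symr; rewrite eq_sym addF1_neq.
  - exact: no_alt_T_P.
  - exact: no_symsing_T_P.
have inv t t' r r' : congr_forms (pairv mxT (mxP t r)) (pairv mxT (mxP t' r')) -> t = t'.
  move/has_iso_ratio_congr => /(_ t) tr.
  by apply/has_iso_ratio_T_P/tr/has_iso_ratio_T_P.
apply: (classes_split (Q := @has_sing 2)) => //.
- by move=> W W' _ _; apply: has_sing_congr.
- apply: (classes_param (f := fun t => pairv mxT (mxP t 0))).
  + by move=> t; split=> //; apply/has_sing_T_P; rewrite !mul0r is_wp0.
  + by move=> t t' /inv.
  + by move=> W [[[[dW nsW] naW] nssW] sW]; apply: pencil_T_P0.
- apply: (classes_param (f := fun t : I =>
    pairv mxT (mxP (val t) (g * (val t + 1) ^+ 2 / val t)))).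
  + move=> [t /= /andP[t0 t1]]; split=> // /has_sing_T_P.
    have t10 : t + 1 != 0 by rewrite addF_eq0.
    have -> : g * (t + 1) ^+ 2 / t * t / (t + 1) ^+ 2 = g by fieldF.
    exact/negP.
  + by move=> t t' /inv/val_inj.
  + move=> W [[[[dW nsW] naW] nssW] sW].
    have [t [t0 t1 WW']] := pencil_T_Pg ng dW nsW naW nssW sW.
    by exists (Sub t (introT andP (conj t0 t1))).
Qed.
End Pencils.

(** * Ternary bilinear forms *)

Section Forms3.
Implicit Types (a b c d e g h k p q r s t : F) (M K : 'M[F]_3) (N : 'M[F]_2).

Lemma ord3P (i : 'I_3) : [\/ i = 0, i = 1 | i = 2%:R].
Proof.
by case: i => [[|[|[|//]]] lti]; [constructor 1|constructor 2|constructor 3];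
  apply: ord_inj.
Qed.

Definition vec3 (x y z : F) : 'rV[F]_3 := \row_j nth 0 [:: x; y; z] j.

Definition mx3 a b c d e g h k p : 'M[F]_3 :=
  \matrix_(i, j) nth 0 (nth [::] [:: [:: a; b; c]; [:: d; e; g]; [:: h; k; p]] i) j.

Lemma vec3P (u : 'rV[F]_3) : u = vec3 (u 0 0) (u 0 1) (u 0 2%:R).
Proof. by apply/rowP => j; rewrite mxE; case: (ord3P j) => ->. Qed.

Lemma mx3P M : M = mx3 (M 0 0) (M 0 1) (M 0 2%:R) (M 1 0) (M 1 1) (M 1 2%:R)
  (M 2%:R 0) (M 2%:R 1) (M 2%:R 2%:R).
Proof.
apply/matrixP => i j; rewrite mxE.
by case: (ord3P i) => ->; case: (ord3P j) => ->.
Qed.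

Lemma vec3_eq0 (x y z : F) : (vec3 x y z == 0) = [&& x == 0, y == 0 & z == 0].
Proof.
apply/eqP/and3P => [/rowP e|[/eqP-> /eqP-> /eqP->]].
  by have:= (e 0, e 1, e 2%:R); rewrite !mxE /= => -[[-> ->] ->].
by apply/rowP => j; rewrite !mxE; case: (ord3P j) => ->.
Qed.

Lemma mx30 : 0 = mx3 0 0 0 0 0 0 0 0 0.
Proof.
apply/matrixP => i j; rewrite !mxE.
by case: (ord3P i) => ->; case: (ord3P j) => ->.
Qed.

Lemma bf_mx3 a b c d e g h k p (x y z x' y' z' : F) :
  bf (mx3 a b c d e g h k p) (vec3 x y z) (vec3 x' y' z') =
  x * (a * x' + b * y' + c * z') + y * (d * x' + e * y' + g * z') +
  z * (h * x' + k * y' + p * z').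
Proof.
rewrite /bf !mxE !big_ord_recl big_ord0 !mxE !big_ord_recl !big_ord0 !mxE /=.
by ringF.
Qed.

Lemma mx3_congr (x y z x' y' z' x'' y'' z'' : F) (M : 'M[F]_3) :
  let u := vec3 x y z in let v := vec3 x' y' z' in let w := vec3 x'' y'' z'' in
  mx3 x y z x' y' z' x'' y'' z'' *m M *m (mx3 x y z x' y' z' x'' y'' z'')^T =
  mx3 (bf M u u) (bf M u v) (bf M u w) (bf M v u) (bf M v v) (bf M v w)
      (bf M w u) (bf M w v) (bf M w w).
Proof.
move=> u v w; apply/matrixP => i j; rewrite -bf_delta bf_congr mxE.
have row3 (l : 'I_3) : delta_mx 0 l *m mx3 x y z x' y' z' x'' y'' z'' =
    nth 0 [:: u; v; w] l.
  rewrite -rowE; apply/rowP => n; rewrite !mxE.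
  by case: (ord3P l) => -> /=; rewrite mxE.
by rewrite !row3; case: (ord3P i) => ->; case: (ord3P j) => ->.
Qed.

Lemma unit_mx3 a b c d e g h k p :
    a * (e * p + g * k) + b * (d * p + g * h) + c * (d * k + e * h) != 0 ->
  mx3 a b c d e g h k p \in unitmx.
Proof.
move=> nz; set D := (X in X != 0) in nz; pose f := D^-1.
suff /mulmx1_unit[] : mx3 a b c d e g h k p *m
  mx3 ((e * p + g * k) * f) ((b * p + c * k) * f) ((b * g + c * e) * f)
      ((d * p + g * h) * f) ((a * p + c * h) * f) ((a * g + c * d) * f)
      ((d * k + e * h) * f) ((a * k + b * h) * f) ((a * e + b * d) * f) = 1%:M by [].
have fD : D * f = 1 by rewrite divff.
apply/matrixP => i j; rewrite !mxE !big_ord_recl big_ord0 !mxE.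
case: (ord3P i) => ->; case: (ord3P j) => -> /=; rewrite ?mulr1n ?mulr0n -?fD /D; ringF.
Qed.

(** A line of forms determines its generator only up to a nonzero scalar. *)
Definition scong M K := exists2 P : 'M[F]_3, P \in unitmx &
  exists2 c, c != 0 & P *m M *m P^T = c *: K.

Lemma congr_scong M K : congr_mx M K -> scong M K.
Proof.
case=> P Pu <-; exists P => //; exists 1; first exact: oner_neq0.
by rewrite scale1r.
Qed.

Lemma scong_sym M K : scong M K -> scong K M.
Proof.
case=> P Pu [c c0 e]; exists (invmx P); first by rewrite unitmx_inv.
exists c^-1; first by rewrite invr_eq0.
apply: (scalerI c0); rewrite scalerA divff // scale1r.
by rewrite scalemxAl scalemxAr -e congrmxK.
Qed.

Lemma scong_line M K : M != 0 -> K != 0 ->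
  congr_forms <[M]> <[K]> <-> scong M K.
Proof.
move=> M0 N0; split=> [[P Pu PM]|[P Pu [c c0 e]]].
  exists P => //; have /vlineP[c e] : P *m M *m P^T \in <[K]>%VS by rewrite PM memv_line.
  exists c => //; apply: contraNneq M0 => c0.
  by rewrite -[M](congrmxK _ Pu) e c0 scale0r mulmx0 mul0mx.
apply: (congr_formsI Pu); first by rewrite !dim_vline M0 N0.
move=> _ /vlineP[a ->]; rewrite -scalemxAr -scalemxAl e.
by rewrite !memvZ ?memv_line.
Qed.

Lemma classes_line n : classes (fun M => M != 0) scong n ->
  classes (fun W : {vspace 'M[F]_3} => \dim W = 1%N) (@congr_forms F 3) n.
Proof.
apply: (classes_transfer (f := fun M => <[M]>%VS)).
- exact: congr_forms_sym.
- exact: congr_forms_trans.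
- by move=> M M0; rewrite dim_vline M0.
- exact: scong_line.
- move=> W dW; have M0 : vpick W != 0 by rewrite vpick0 -dimv_eq0 dW.
  exists (vpick W) => //.
  have -> : <[vpick W]>%VS = W.
    apply/eqP; rewrite eqEdim dW dim_vline M0 andbT.
    by rewrite -memvE memv_pick.
  by exists 1%:M; [exact: unitmx1 | move=> K; rewrite mul1mx trmx1 mulmx1].
Qed.

(** * Invariants of ternary forms up to congruence and scalars *)

Definition has_rad M := exists2 u : 'rV[F]_3, u != 0 &
  forall x, bf M u x = 0 /\ bf M x u = 0.
(** Gram determinant of x, y against the square of the skew part on their plane. Both sides are
    quadratic in M, so a scalar factor is harmless, and both are multiplied by the same square when
    x, y are replaced by combinations of themselves. *)
Definition gram_ratio t M (x y : 'rV[F]_3) :=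
  bf M x x * bf M y y + bf M x y * bf M y x = t * (bf M x y + bf M y x) ^+ 2.
Definition has_nondeg_plane M := exists x y : 'rV[F]_3,
  bf M x x * bf M y y + bf M x y * bf M y x != 0.
(** These u form the radical of the alternating form M(u, z) + M(z, u). *)
Definition comm_vec M (u : 'rV[F]_3) := forall z, bf M u z = bf M z u.
Definition has_comm_aniso M := exists2 u : 'rV[F]_3, comm_vec M u & bf M u u != 0.
(** The orthogonal complement of u is the binary block of a form 1 + D(t), and t is read off
    there. *)
Definition has_comm_aniso_ratio t M := exists u : 'rV[F]_3,
  [/\ comm_vec M u, bf M u u != 0 &
    forall x y, bf M u x = 0 -> bf M u y = 0 -> gram_ratio t M x y].
Definition has_noncomm_iso M := exists2 x : 'rV[F]_3, bf M x x = 0 & ~ comm_vec M x.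

Lemma scong_transport M K : scong M K ->
  exists2 phi : 'rV[F]_3 -> 'rV[F]_3,
    (forall u', exists u, u' = phi u) /\ (forall u, (phi u == 0) = (u == 0)) &
    exists2 c, c != 0 & forall u v, bf K (phi u) (phi v) = c * bf M u v.
Proof.
case=> P Pu [c c0 e]; exists (mulmx^~ (invmx P)).
  split=> u; first by exists (u *m P); rewrite mulmxK.
  apply/eqP/eqP => [uP|->]; last by rewrite mul0mx.
  by rewrite -[u](mulmxKV Pu) uP mul0mx.
exists c^-1; first by rewrite invr_eq0.
move=> u v; apply: (mulfI c0); rewrite mulrA divff // mul1r.
by rewrite -bfZm -e bf_congr !mulmxKV.
Qed.

Lemma sym_form_scong M K : scong M K -> sym_form M -> sym_form K.
Proof.
case/scong_transport=> phi [phiS phi0] [c c0 bfE] sM u v.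
by have [[u' ->] [v' ->]] := (phiS u, phiS v); rewrite !bfE sM.
Qed.

Lemma alt_form_scong M K : scong M K -> alt_form M -> alt_form K.
Proof.
case/scong_transport=> phi [phiS phi0] [c c0 bfE] aM u.
by have [u' ->] := phiS u; rewrite !bfE aM mulr0.
Qed.

Lemma has_rad_scong M K : scong M K -> has_rad M -> has_rad K.
Proof.
case/scong_transport=> phi [phiS phi0] [c c0 bfE] [u u0 radu].
exists (phi u); rewrite ?phi0 // => x; have [x' ->] := phiS x.
by case: (radu x') => r1 r2; rewrite !bfE r1 r2 mulr0.
Qed.

Lemma singular_scong M K : scong M K -> singular M -> singular K.
Proof.
case/scong_transport=> phi [phiS phi0] [c c0 bfE] [u u0 radu].
exists (phi u); rewrite ?phi0 // => x; have [x' ->] := phiS x.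
by rewrite bfE radu mulr0.
Qed.

Lemma gram_ratio_scong t M K : scong M K ->
  (forall x y, gram_ratio t M x y) -> forall x y, gram_ratio t K x y.
Proof.
case/scong_transport=> phi [phiS phi0] [c c0 bfE] gM u v.
have [[x ->] [y ->]] := (phiS u, phiS v).
rewrite /gram_ratio !bfE; transitivity
  (c ^+ 2 * (bf M x x * bf M y y + bf M x y * bf M y x)); first by ringF.
by rewrite gM; ringF.
Qed.

Lemma has_nondeg_plane_scong M K :
  scong M K -> has_nondeg_plane M -> has_nondeg_plane K.
Proof.
case/scong_transport=> phi [phiS phi0] [c c0 bfE] [x [y xy]].
exists (phi x), (phi y); rewrite !bfE.
have -> : c * bf M x x * (c * bf M y y) + c * bf M x y * (c * bf M y x) =
  c ^+ 2 * (bf M x x * bf M y y + bf M x y * bf M y x) by ringF.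
by rewrite mulf_neq0 ?expf_neq0.
Qed.

Lemma has_comm_aniso_scong M K : scong M K -> has_comm_aniso M -> has_comm_aniso K.
Proof.
case/scong_transport=> phi [phiS phi0] [c c0 bfE] [u cu uu].
exists (phi u); last by rewrite bfE mulf_neq0.
by move=> x; have [x' ->] := phiS x; rewrite !bfE cu.
Qed.

Lemma has_comm_aniso_ratio_scong t M K :
  scong M K -> has_comm_aniso_ratio t M -> has_comm_aniso_ratio t K.
Proof.
case/scong_transport=> phi [phiS phi0] [c c0 bfE] [u [cu uu gu]].
exists (phi u); split=> [x||x' y'].
- by have [x' ->] := phiS x; rewrite !bfE cu.
- by rewrite bfE mulf_neq0.
have [[x ->] [y ->]] := (phiS x', phiS y'); rewrite !bfE.
move=> /eqP; rewrite mulf_eq0 (negPf c0) => /eqP ux.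
move=> /eqP; rewrite mulf_eq0 (negPf c0) => /eqP uy.
rewrite /gram_ratio !bfE; transitivity
  (c ^+ 2 * (bf M x x * bf M y y + bf M x y * bf M y x)); first by ringF.
by rewrite gu //; ringF.
Qed.

Lemma has_noncomm_iso_scong M K :
  scong M K -> has_noncomm_iso M -> has_noncomm_iso K.
Proof.
case/scong_transport=> phi [phiS phi0] [c c0 bfE] [x xx ncx].
exists (phi x); first by rewrite bfE xx mulr0.
move=> cx; apply: ncx => z; apply: (mulfI c0).
by rewrite -!bfE cx.
Qed.

Lemma congr_mx3I (M : 'M[F]_3) (x y z x' y' z' x'' y'' z'' : F) :
  x * (y' * z'' + z' * y'') + y * (x' * z'' + z' * x'') +
    z * (x' * y'' + y' * x'') != 0 ->
  let u := vec3 x y z in let v := vec3 x' y' z' in let w := vec3 x'' y'' z'' in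
  congr_mx M (mx3 (bf M u u) (bf M u v) (bf M u w) (bf M v u) (bf M v v) (bf M v w)
      (bf M w u) (bf M w v) (bf M w w)).
Proof.
move=> nz u v w; exists (mx3 x y z x' y' z' x'' y'' z''); first exact: unit_mx3.
by rewrite mx3_congr.
Qed.

Lemma congr_mx_lead M u : u != 0 -> exists v w, congr_mx M
  (mx3 (bf M u u) (bf M u v) (bf M u w) (bf M v u) (bf M v v) (bf M v w)
      (bf M w u) (bf M w v) (bf M w w)).
Proof.
rewrite (vec3P u) vec3_eq0; move: (u 0 0) (u 0 1) (u 0 2%:R) => {u}x y z.
have eq_neq0 (s t : F) : s = t -> t != 0 -> s != 0 by move->.
have [x0|x0] /= := eqVneq x 0; last first.
  move=> _; exists (vec3 0 1 0), (vec3 0 0 1); apply: congr_mx3I.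
  by apply: eq_neq0 x0; ringF.
have [y0|y0] /= := eqVneq y 0; last first.
  move=> _; exists (vec3 1 0 0), (vec3 0 0 1); apply: congr_mx3I.
  by apply: eq_neq0 y0; rewrite x0; ringF.
move=> z0; exists (vec3 1 0 0), (vec3 0 1 0); apply: congr_mx3I.
by apply: eq_neq0 z0; rewrite x0 y0; ringF.
Qed.

Definition dsum a (N : 'M[F]_2) := mx3 a 0 0 0 (N 0 0) (N 0 1) 0 (N 1 0) (N 1 1).

Lemma bf_dsum a (N : 'M[F]_2) (x y z x' y' z' : F) :
  bf (dsum a N) (vec3 x y z) (vec3 x' y' z') =
  a * x * x' + bf N (vec2 y z) (vec2 y' z').
Proof. by rewrite {2}(mx2P N) bf_mx2 bf_mx3; ringF. Qed.

Lemma det_unit_mx2 a b c d : mx2 a b c d \in unitmx -> a * d + b * c != 0.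
Proof.
rewrite unitmxE unitfE (expand_det_row _ 0) !big_ord_recl big_ord0 /cofactor.
rewrite !det_mx11 !mxE /= expr0 expr1.
by have -> // : a * (1 * d) + (b * (-1 * c) + 0) = a * d + b * c by ringF.
Qed.

Lemma congr_dsum a (N N' : 'M[F]_2) : congr_mx N N' ->
  congr_mx (dsum a N) (dsum a N').
Proof.
case=> P Pu <-; rewrite (mx2P P) in Pu *.
move: (P 0 0) (P 0 1) (P 1 0) (P 1 1) Pu => p q r s /det_unit_mx2 nz.
exists (mx3 1 0 0 0 p q 0 r s).
  apply: unit_mx3; move: nz; congr (_ != _); ringF.
rewrite (mx2P N); move: (N 0 0) (N 0 1) (N 1 0) (N 1 1) => x y z t.
rewrite mx2_congr mx3_congr !bf_dsum !bf_mx2 /dsum !mxE /=.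
by congr mx3; ringF.
Qed.

Lemma has_rad_dsum M : has_rad M -> exists N, congr_mx M (dsum 0 N).
Proof.
case=> u u0 radu; have [v [w]] := congr_mx_lead M u0 => Mc.
exists (mx2 (bf M v v) (bf M v w) (bf M w v) (bf M w w)).
move: Mc; rewrite (radu u).1 (radu v).1 (radu v).2 (radu w).1 (radu w).2.
by rewrite /dsum !mxE.
Qed.

Lemma has_comm_aniso_dsum M : has_comm_aniso M -> exists N, congr_mx M (dsum 1 N).
Proof.
case=> u cu /sqrtF_neq0[e e0 uu]; pose u1 := e^-1 *: u.
have cu1 z : bf M u1 z = bf M z u1 by rewrite bfZl bfZr cu.
have uu1 : bf M u1 u1 = 1 by rewrite bfZl bfZr uu; fieldF.
have u10 : u1 != 0.
  by apply/eqP => u10; move/eqP: uu1; rewrite u10 /bf !mul0mx mxE eq_sym oner_eq0.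
have [v [w]] := congr_mx_lead M u10; rewrite uu1 -!cu1.
move: (bf M u1 v) (bf M u1 w) (bf M v v) (bf M v w) (bf M w v) (bf M w w).
move=> b c x y z t Mc.
(* The new basis is u, v + b u, w + c u. As M(u, u) = 1 and u commutes with every vector, the last
   two are orthogonal to u on both sides. *)
have nz : 1 * (1 * 1 + 0 * 0) + 0 * (b * 1 + 0 * c) + 0 * (b * 0 + 1 * c) != 0 :> F.
  by have -> : 1 * (1 * 1 + 0 * 0) + 0 * (b * 1 + 0 * c) + 0 * (b * 0 + 1 * c) = 1;
    [ringF | apply: oner_neq0].
have := congr_mx3I (mx3 1 b c b x y c z t) nz.
rewrite /= !bf_mx3; set K' := (X in congr_mx _ X) => Mc'.
exists (mx2 (x + b * b) (y + b * c) (z + b * c) (t + c * c)).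
apply: (congr_mx_trans Mc); suff <- : K' = dsum 1 (mx2 (x + b * b) (y + b * c)
  (z + b * c) (t + c * c)) by [].
by rewrite /K' /dsum !mxE /=; congr mx3; ringF.
Qed.

(** * Normal forms of ternary forms *)

Definition mx3N b g := mx3 0 0 1 0 b 1 1 0 g.

Lemma sym_dsum a N : sym_form (dsum a N) <-> sym_form N.
Proof.
split=> sN u v; last by rewrite (vec3P u) (vec3P v) !bf_dsum sN; ringF.
have := sN (vec3 0 (u 0 0) (u 0 1)) (vec3 0 (v 0 0) (v 0 1)).
by rewrite !bf_dsum -!vec2P !(mulr0, add0r).
Qed.

Lemma alt_dsum N : alt_form (dsum 0 N) <-> alt_form N.
Proof.
split=> aN u; last by rewrite (vec3P u) !bf_dsum aN; ringF.
have := aN (vec3 0 (u 0 0) (u 0 1)).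
by rewrite !bf_dsum -!vec2P !(mulr0, add0r).
Qed.

Lemma dsum0_eq0 : dsum 0 0 = 0.
Proof. by rewrite mx30 /dsum !mxE. Qed.

Lemma scong_trans M K K' : congr_mx M K -> scong K K' -> scong M K'.
Proof.
case=> P Pu <- [Q Qu [c c0 e]]; exists (Q *m P); first by rewrite unitmx_mul Qu.
by exists c => //; rewrite trmx_mul -e !mulmxA.
Qed.

Lemma form_rad_sym_alt M : M != 0 -> has_rad M -> sym_form M -> alt_form M ->
  scong M (dsum 0 mxJ).
Proof.
move=> M0 /has_rad_dsum[N MN] sM aM; have := congr_scong MN => MsN.
have /sym_dsum sN := sym_form_scong MsN sM; have /alt_dsum aN := alt_form_scong MsN aM.
have N0 : N != 0.
  apply: contraNneq M0 => N0; case: MN => P Pu; rewrite N0 dsum0_eq0 => e.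
  by rewrite -[M](congrmxK _ Pu) e mulmx0 mul0mx.
apply: (scong_trans MN); apply: congr_scong; apply: congr_dsum.
case: (mx2_normal N) => [[/eqP|]|||]; rewrite ?(negPf N0) //.
- case=> P Pu e; have /alt_mx2[/eqP] : alt_form mxE1.
    by rewrite /mxE1 -e => u; rewrite bf_congr aN.
  by rewrite oner_eq0.
- case=> P Pu e; have /alt_mx2[/eqP] : alt_form (mx2 1 0 0 1).
    by rewrite -e => u; rewrite bf_congr aN.
  by rewrite oner_eq0.
- by case=> t /congr_mx_sym/(_ sN)/sym_mxD.
Qed.

Lemma form_rad_sym M : M != 0 -> has_rad M -> sym_form M -> ~ alt_form M ->
  scong M (dsum 0 (mx2 1 0 0 1)) \/ scong M (dsum 0 mxE1).
Proof.
move=> M0 /has_rad_dsum[N MN] sM naM; have := congr_scong MN => MsN.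
have /sym_dsum sN := sym_form_scong MsN sM.
have naN : ~ alt_form N.
  by move/alt_dsum/(alt_form_scong (scong_sym MsN)).
case: (mx2_normal N) => [[N0|[P Pu e]]|NE|NE|[t]].
- by case: naN; rewrite N0 => u; rewrite bf0m.
- case: naN => u; have /alt_mx2 aJ : [/\ 0 = 0 :> F, 0 = 0 :> F & 1 = 1 :> F] by [].
  by rewrite -[N](congrmxK _ Pu) e bf_congr aJ.
- by right; apply/(scong_trans MN)/congr_scong/congr_dsum.
- by left; apply/(scong_trans MN)/congr_scong/congr_dsum.
- by move=> /congr_mx_sym/(_ sN)/sym_mxD.
Qed.

Lemma has_nondeg_plane_dsum0I : has_nondeg_plane (dsum 0 (mx2 1 0 0 1)).
Proof.
exists (vec3 0 1 0), (vec3 0 0 1); rewrite !bf_dsum !bf_mx2.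
by apply: contraTneq isT => /eqP; rewrite !(mulr0, mul0r, mulr1, add0r, addr0) oner_eq0.
Qed.

Lemma no_nondeg_plane_dsum0E : ~ has_nondeg_plane (dsum 0 mxE1).
Proof.
case=> x [y]; rewrite (vec3P x) (vec3P y) !bf_dsum !bf_mx2 => /eqP; apply.
by ringF.
Qed.

Lemma form_rad_nonsym M : has_rad M -> ~ sym_form M ->
  exists t, scong M (dsum 0 (mxD t)).
Proof.
move=> /has_rad_dsum[N MN] nsM.
have [|t Nt] := @congr_mx_nonsym N.
  by move/sym_dsum/(sym_form_scong (scong_sym (congr_scong MN))).
by exists t; apply/(scong_trans MN)/congr_scong/congr_dsum.
Qed.

Lemma form_aniso_nonsym M : has_comm_aniso M -> ~ sym_form M ->
  exists t, scong M (dsum 1 (mxD t)).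
Proof.
move=> /has_comm_aniso_dsum[N MN] nsM.
have [|t Nt] := @congr_mx_nonsym N.
  by move/sym_dsum/(sym_form_scong (scong_sym (congr_scong MN))).
by exists t; apply/(scong_trans MN)/congr_scong/congr_dsum.
Qed.

Lemma congr_mx3E (M : 'M[F]_3) (x y z x' y' z' x'' y'' z'' : F) K :
    x * (y' * z'' + z' * y'') + y * (x' * z'' + z' * x'') +
      z * (x' * y'' + y' * x'') != 0 ->
    let u := vec3 x y z in let v := vec3 x' y' z' in let w := vec3 x'' y'' z'' in
    mx3 (bf M u u) (bf M u v) (bf M u w) (bf M v u) (bf M v v) (bf M v w)
      (bf M w u) (bf M w v) (bf M w w) = K ->
  congr_mx M K.
Proof. by move=> nz u v w <-; apply: congr_mx3I. Qed.

Lemma eq_neq0 (x y : F) : x = y -> y != 0 -> x != 0.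
Proof. by move->. Qed.

(** The vector (g, c, b) of upper entries, in reverse order, annihilates an alternating 3 x 3
    matrix; if it is zero, so is the matrix. Consequently a symmetric form without radical has a
    vector u with M(u, u) <> 0. *)
Lemma alt_has_rad M : alt_form M -> has_rad M.
Proof.
rewrite (mx3P M) => altM.
have := (altM (vec3 1 0 0), altM (vec3 0 1 0), (altM (vec3 0 0 1))).
have := (altM (vec3 1 1 0), altM (vec3 1 0 1), (altM (vec3 0 1 1))).
rewrite !bf_mx3 !(mulr0, mul0r, mulr1, mul1r, addr0, add0r) {altM}.
move=> [[+ +] +] [[e1 e2] e3]; rewrite e1 e2 e3 !(addr0, add0r).
have addF_eq (a b : F) : a + b = 0 -> a = b by move/eqP; rewrite addF_eq0 => /eqP.
move: (M 0 1) (M 0 2%:R) (M 1 2%:R) => b c g /addF_eq <- /addF_eq <- /addF_eq <-.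
have [z|nz] := boolP [&& g == 0, c == 0 & b == 0].
  exists (vec3 1 0 0); first by rewrite vec3_eq0 oner_eq0.
  case/and3P: z => /eqP-> /eqP-> /eqP-> x; rewrite (vec3P x) !bf_mx3.
  by split; ringF.
exists (vec3 g c b); first by rewrite vec3_eq0.
by move=> x; rewrite (vec3P x) !bf_mx3; split; ringF.
Qed.

(** The vectors (1,1,0), (1,0,1), (1,1,1) are orthonormal for 1 + J: each has first coordinate 1,
    and any two of them pair to 1 under J, which cancels the 1 from the first coordinates. *)
Lemma congr_dsum1J : congr_mx (dsum 1 mxJ) (dsum 1 (mx2 1 0 0 1)).
Proof.
rewrite /dsum !mxE /=; apply: (@congr_mx3E _ 1 1 0 1 0 1 1 1 1).
  by apply: (@eq_neq0 _ 1); [ringF | exact: oner_neq0].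
by rewrite !bf_mx3; congr mx3; ringF.
Qed.

Lemma dsum1_rad N : N 1 0 = 0 -> N 0 1 = 0 -> N 1 1 = 0 -> has_rad (dsum 1 N).
Proof.
move=> e1 e2 e3; exists (vec3 0 0 1); first by rewrite vec3_eq0 oner_eq0 !andbF.
by move=> x; rewrite (vec3P x) /dsum e1 e2 e3 !bf_mx3; split; ringF.
Qed.

Lemma form_norad_sym M : ~ has_rad M -> sym_form M -> scong M (dsum 1 (mx2 1 0 0 1)).
Proof.
move=> nrM sM.
have /has_comm_aniso_dsum[N MN] : has_comm_aniso M.
  apply: NNPP => na; apply: nrM; apply: alt_has_rad => u.
  apply/eqP/negPn/negP => uu; apply: na; exists u => // z; exact: sM.
have MsN := congr_scong MN; have /sym_dsum sN := sym_form_scong MsN sM.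
have nrN : ~ has_rad (dsum 1 N) by move/(has_rad_scong (scong_sym MsN)).
case: (mx2_normal N) => [[N0|NJ]|NE|NI|[t /congr_mx_sym/(_ sN)/sym_mxD //]].
- by case: nrN; apply: dsum1_rad; rewrite N0 mxE.
- exact/(scong_trans MN)/(scong_trans (congr_dsum 1 NJ))/congr_scong/congr_dsum1J.
- have rE : has_rad (dsum 1 mxE1) by apply: dsum1_rad; rewrite mxE.
  by case: nrN; apply: has_rad_scong rE; apply/scong_sym/congr_scong/congr_dsum.
- exact/(scong_trans MN)/congr_scong/congr_dsum.
Qed.

(** In odd dimension the alternating form M(u, z) + M(z, u) is degenerate; its radical contains (g +
    k, c + h, b + d), and if this vector is zero then M is symmetric and any u will do. *)
Lemma ex_comm_vec M : exists2 u, u != 0 & comm_vec M u.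
Proof.
rewrite (mx3P M).
move: (M 0 0) (M 0 1) (M 0 2%:R) (M 1 0) (M 1 1) (M 1 2%:R)
  (M 2%:R 0) (M 2%:R 1) (M 2%:R 2%:R) => a b c d e g h k p.
have [z|nz] := boolP [&& g + k == 0, c + h == 0 & b + d == 0].
  exists (vec3 1 0 0); first by rewrite vec3_eq0 oner_eq0.
  case/and3P: z; rewrite !addF_eq0 => /eqP-> /eqP-> /eqP-> x.
  by rewrite (vec3P x) !bf_mx3; ringF.
exists (vec3 (g + k) (c + h) (b + d)); first by rewrite vec3_eq0.
by move=> x; rewrite (vec3P x) !bf_mx3; ringF.
Qed.

Lemma form_noaniso M : ~ has_rad M -> ~ sym_form M -> ~ has_comm_aniso M ->
  exists b g, congr_mx M (mx3N b g).
Proof.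
move=> nrM nsM naM; have [u u0 cu] := ex_comm_vec M.
have uu : bf M u u = 0.
  by apply/eqP/negPn/negP => uu; apply: naM; exists u.
have [v [w]] := congr_mx_lead M u0; rewrite uu -!cu.
move: (bf M u v) (bf M u w) (bf M v v) (bf M v w) (bf M w v) (bf M w w).
move=> b c x y z t Mc.
(* The commuting vector u is isotropic and not in the radical, so v and w can be chosen with M(u, v)
   = 0 and M(u, w) = 1. *)
have [x1 [y1 [z1 [t1 Mc1]]]] : exists x y z t, congr_mx M (mx3 0 0 1 0 x y 1 z t).
  have [c0|c0] := eqVneq c 0; last first.
    do 4!eexists; apply: (congr_mx_trans Mc).
    apply: (@congr_mx3E _ 1 0 0 0 1 (b / c) 0 0 c^-1).
      by apply: (@eq_neq0 _ c^-1); [fieldF | rewrite invr_eq0].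
    by rewrite !bf_mx3; congr mx3; try reflexivity; fieldF.
  have b0 : b != 0.
    apply/eqP => b0; apply: nrM; apply: (has_rad_scong (scong_sym (congr_scong Mc))).
    exists (vec3 1 0 0); first by rewrite vec3_eq0 oner_eq0.
    by move=> s; rewrite (vec3P s) b0 c0 !bf_mx3; split; ringF.
  do 4!eexists; apply: (congr_mx_trans Mc); rewrite c0.
  apply: (@congr_mx3E _ 1 0 0 0 0 1 0 b^-1 0).
    by apply: (@eq_neq0 _ b^-1); [fieldF | rewrite invr_eq0].
  by rewrite !bf_mx3; congr mx3; try reflexivity; fieldF.
have yz : y1 + z1 != 0.
  apply/eqP => yz; apply: nsM; apply: (sym_form_scong (scong_sym (congr_scong Mc1))).
  move/eqP: yz; rewrite addF_eq0 => /eqP-> s s'.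
  by rewrite (vec3P s) (vec3P s') !bf_mx3; ringF.
(* Adding z1 u to v turns the pair M(v, w), M(w, v) from (y1, z1) into (y1 + z1, 0), and y1 + z1 is
   then scaled to 1. *)
exists (x1 / (y1 + z1) ^+ 2), t1; apply: (congr_mx_trans Mc1).
apply: (@congr_mx3E _ 1 0 0 (z1 / (y1 + z1)) (y1 + z1)^-1 0 0 0 1).
  by apply: (@eq_neq0 _ (y1 + z1)^-1); [fieldF | rewrite invr_eq0].
by rewrite !bf_mx3 /mx3N; congr mx3; fieldF.
Qed.

Lemma singular_mx3N b g : singular (mx3N b g) <-> b = 0.
Proof.
split=> [[y]|->]; last first.
  exists (vec3 0 1 0); first by rewrite vec3_eq0 oner_eq0 andbF.
  by move=> x; rewrite (vec3P x) bf_mx3; ringF.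
rewrite (vec3P y) vec3_eq0; move: (y 0 0) (y 0 1) (y 0 2%:R) => {}y z t nz ker.
have := (ker (vec3 1 0 0), ker (vec3 0 1 0), ker (vec3 0 0 1)).
rewrite !bf_mx3 !(mulr0, mul0r, mulr1, mul1r, addr0, add0r) => -[[t0 +] +].
rewrite t0 !(mulr0, addr0) => bz y0; move: nz; rewrite y0 t0 eqxx andbT /= => z0.
by move/eqP: bz; rewrite mulf_eq0 (negPf z0) orbF => /eqP.
Qed.

Lemma form_singular M : ~ has_rad M -> ~ sym_form M -> ~ has_comm_aniso M ->
  singular M -> scong M (mx3N 0 0).
Proof.
move=> nrM nsM naM sM; have [b [g Mbg]] := form_noaniso nrM nsM naM.
have /singular_mx3N b0 := singular_scong (congr_scong Mbg) sM.
apply: (scong_trans Mbg); apply: congr_scong; rewrite b0.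
(* With M(v, v) = 0 and M(v, w) + M(w, v) = 1, adding g v to w cancels M(w, w) = g. *)
apply: (@congr_mx3E _ 1 0 0 0 1 0 0 g 1).
  by apply: (@eq_neq0 _ 1); [ringF | exact: oner_neq0].
by rewrite !bf_mx3 /mx3N; congr mx3; ringF.
Qed.

Lemma form_nonsingular M : ~ has_rad M -> ~ sym_form M -> ~ has_comm_aniso M ->
  ~ singular M -> exists g, congr_mx M (mx3N 1 g).
Proof.
move=> nrM nsM naM sM; have [b [g Mbg]] := form_noaniso nrM nsM naM.
have /sqrtF_neq0[e e0 be] : b != 0.
  apply/eqP => b0; apply: sM; apply: (singular_scong (scong_sym (congr_scong Mbg))).
  exact/singular_mx3N.
exists (e ^+ 2 * g); apply: (congr_mx_trans Mbg); rewrite be.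
apply: (@congr_mx3E _ e^-1 0 0 0 e^-1 0 0 0 e).
  by apply: (@eq_neq0 _ e^-1); [fieldF | rewrite invr_eq0].
by rewrite !bf_mx3 /mx3N; congr mx3; fieldF.
Qed.

Lemma congr_mx3N g c : congr_mx (mx3N 1 g) (mx3N 1 (g + wp c)).
Proof.
(* Replacing w by w + c v adds c^2 + c to M(w, w); replacing v by v + c u at the same time restores
   the other entries. *)
apply: (@congr_mx3E _ 1 0 0 c 1 0 0 c 1).
  by apply: (@eq_neq0 _ 1); [ringF | exact: oner_neq0].
by rewrite !bf_mx3 /mx3N /wp; congr mx3; ringF.
Qed.

Lemma comm_vec_mx3N b g (x y z : F) :
  comm_vec (mx3N b g) (vec3 x y z) <-> y = 0 /\ z = 0.
Proof.
split=> [cv|[-> ->] u]; last by rewrite (vec3P u) !bf_mx3; ringF.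
have := (cv (vec3 0 1 0), cv (vec3 0 0 1)); rewrite !bf_mx3.
rewrite !(mulr0, mul0r, mulr1, mul1r, addr0, add0r) => -[e1 e2].
have z0 : z = 0 by transitivity (y * b + (b * y + z)); [ringF | rewrite -e1 addFF].
split=> //; transitivity ((x + y + z * g) + (x + g * z)); first by ringF.
by rewrite e2 addFF.
Qed.

(** The value at (x, y, z) is y^2 + y z + g z^2, as x z occurs twice. A zero with z = 0 also has y =
    0 and is a commuting vector; any other gives g = c^2 + c with c = y / z. *)
Lemma has_noncomm_iso_mx3N g : has_noncomm_iso (mx3N 1 g) <-> is_wp g.
Proof.
split=> [[x + ncx]|/wpP[c ->]]; last first.
  exists (vec3 0 c 1); first by rewrite bf_mx3 /wp; ringF.
  by case/comm_vec_mx3N=> _ /eqP; rewrite oner_eq0.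
move: ncx; rewrite (vec3P x); move: (x 0 0) (x 0 1) (x 0 2%:R) => {}x y z ncx.
rewrite bf_mx3 => e; have [z0|z0] := eqVneq z 0.
  case: ncx; apply/comm_vec_mx3N; split=> //; apply/eqP.
  rewrite -[_ == _]orbb -mulf_eq0 -[X in _ == X]e z0; apply/eqP; ringF.
apply/wpP; exists (y / z); apply/eqP; rewrite -addF_eq0; apply/eqP.
rewrite -[RHS](mul0r (z ^+ 2)^-1) -e /wp; fieldF.
Qed.

Lemma form_wp M : ~ has_rad M -> ~ sym_form M -> ~ has_comm_aniso M ->
  ~ singular M -> has_noncomm_iso M -> scong M (mx3N 1 0).
Proof.
move=> nrM nsM naM sM iM; have [g Mg] := form_nonsingular nrM nsM naM sM.
have /has_noncomm_iso_mx3N/wpP[c gE] := has_noncomm_iso_scong (congr_scong Mg) iM.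
apply: (scong_trans Mg); have -> : 0 = g + wp c by rewrite gE addFF.
exact/congr_scong/congr_mx3N.
Qed.

Lemma form_nwp g M : ~~ is_wp g -> ~ has_rad M -> ~ sym_form M ->
  ~ has_comm_aniso M -> ~ singular M -> ~ has_noncomm_iso M -> scong M (mx3N 1 g).
Proof.
move=> ng nrM nsM naM sM iM; have [g' Mg] := form_nonsingular nrM nsM naM sM.
have ng' : ~~ is_wp g'.
  apply/negP => /has_noncomm_iso_mx3N h; apply: iM.
  exact: has_noncomm_iso_scong (scong_sym (congr_scong Mg)) h.
have /wpP[c gE] := wp_index2 ng' ng.
apply: (scong_trans Mg); have -> : g = g' + wp c by rewrite -gE; ringF.
exact/congr_scong/congr_mx3N.
Qed.

(** * Invariants of the representative ternary forms, and their count *)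

Lemma has_rad_dsum0 N : has_rad (dsum 0 N).
Proof.
exists (vec3 1 0 0); first by rewrite vec3_eq0 oner_eq0.
by move=> x; rewrite (vec3P x) !bf_mx3; split; ringF.
Qed.

Lemma dsum0_neq0 N : N != 0 -> dsum 0 N != 0.
Proof.
apply: contra_neq => N0; apply: bf_inj => u v.
have := congr1 (fun K => bf K (vec3 0 (u 0 0) (u 0 1)) (vec3 0 (v 0 0) (v 0 1))) N0.
by rewrite bf_dsum -!vec2P !bf0m !mulr0 add0r.
Qed.

Lemma no_rad_neq0 M : ~ has_rad M -> M != 0.
Proof.
apply: contra_notN => /eqP->; exists (vec3 1 0 0); first by rewrite vec3_eq0 oner_eq0.
by move=> x; rewrite !bf0m.
Qed.

Lemma no_rad_dsum1 N :
    (forall u, (forall x, bf N u x = 0 /\ bf N x u = 0) -> u = 0) ->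
  ~ has_rad (dsum 1 N).
Proof.
move=> nr [u]; rewrite (vec3P u); move: (u 0 0) (u 0 1) (u 0 2%:R) => x y z + ru.
have /eqP : vec2 y z = 0.
  apply: nr => v; have [] := ru (vec3 0 (v 0 0) (v 0 1)).
  by rewrite !bf_dsum -!vec2P !(mulr0, mul0r, add0r).
rewrite vec2_eq0 vec3_eq0 => yz; have [+ _] := ru (vec3 1 0 0).
rewrite bf_dsum; have -> : vec2 0 0 = 0 by apply/eqP; rewrite vec2_eq0 eqxx.
by rewrite /bf trmx0 mulmx0 mxE yz addr0 mul1r mulr1 => ->; rewrite eqxx.
Qed.

Lemma has_comm_aniso_dsum1 N : has_comm_aniso (dsum 1 N).
Proof.
exists (vec3 1 0 0); last by rewrite bf_mx3; apply: (@eq_neq0 _ 1);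
  [ringF | exact: oner_neq0].
by move=> x; rewrite (vec3P x) !bf_mx3; ringF.
Qed.

Lemma no_comm_aniso_mx3N b g : ~ has_comm_aniso (mx3N b g).
Proof.
case=> u; rewrite (vec3P u) => /comm_vec_mx3N[y0 z0]; rewrite bf_mx3 y0 z0 => /eqP.
by apply; ringF.
Qed.

Lemma no_rad_mx3N b g : ~ has_rad (mx3N b g).
Proof.
case=> u; rewrite (vec3P u); move: (u 0 0) (u 0 1) (u 0 2%:R) => x y z.
rewrite vec3_eq0 => nz ru; have [y0 z0] : y = 0 /\ z = 0.
  by apply/(comm_vec_mx3N b g x) => v; rewrite (ru v).1 (ru v).2.
have := (ru (vec3 0 0 1)).1; rewrite bf_mx3 y0 z0.
rewrite !(mulr0, mul0r, mulr1, addr0, add0r) => x0.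
by move: nz; rewrite x0 y0 z0 eqxx.
Qed.

Lemma not_sym_mx3N b g : ~ sym_form (mx3N b g).
Proof.
move/(_ (vec3 0 1 0) (vec3 0 0 1)); rewrite !bf_mx3.
rewrite !(mulr0, mul0r, mulr1, mul1r, addr0, add0r) => /eqP.
by rewrite oner_eq0.
Qed.

Lemma gram_ratio_dsum0 t t' :
  (forall x y, gram_ratio t (dsum 0 (mxD t')) x y) <-> t = t'.
Proof.
split=> [/(_ (vec3 0 1 0) (vec3 0 0 1))|<- x y]; rewrite /gram_ratio.
  by rewrite !bf_dsum !bf_mx2 !(mulr0, mul0r, mulr1, mul1r, addr0, add0r) expr1n mulr1.
by rewrite (vec3P x) (vec3P y) !bf_dsum !bf_mx2; ringF.
Qed.

Lemma has_comm_aniso_ratio_dsum1 t t' :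
  has_comm_aniso_ratio t (dsum 1 (mxD t')) <-> t = t'.
Proof.
split=> [[u]|<-]; last first.
  exists (vec3 1 0 0); split=> [x||x y].
  - by rewrite (vec3P x) !bf_mx3; ringF.
  - by rewrite bf_mx3; apply: (@eq_neq0 _ 1); [ringF | exact: oner_neq0].
  rewrite (vec3P x) (vec3P y) /gram_ratio.
  move: (x 0 0) (x 0 1) (x 0 2%:R) (y 0 0) (y 0 1) (y 0 2%:R) => a b c a' b' c'.
  rewrite !bf_dsum !bf_mx2 => e1 e2.
  have -> : a = 0 by rewrite -[RHS]e1; ringF.
  have -> : a' = 0 by rewrite -[RHS]e2; ringF.
  by ringF.
rewrite (vec3P u); move: (u 0 0) (u 0 1) (u 0 2%:R) => x y z [cu uu].
(* Commuting with e2 and e3 forces u onto the line of e1, because the difference of the off-diagonal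
   entries of D(t') is 1. *)
have := (cu (vec3 0 1 0), cu (vec3 0 0 1)); rewrite !bf_dsum !bf_mx2.
move=> -[e1 e2]; have z0 : z = 0.
  transitivity ((1 * x * 0 + (y * 1 * 1 + y * 1 * 0 + z * 0 * 1 + z * t' * 0)) +
   (1 * 0 * x + (1 * 1 * y + 1 * 1 * z + 0 * 0 * y + 0 * t' * z))); first by ringF.
  by rewrite e1 addFF.
have y0 : y = 0.
  transitivity ((1 * x * 0 + (y * 1 * 0 + y * 1 * 1 + z * 0 * 0 + z * t' * 1)) +
   (1 * 0 * x + (0 * 1 * y + 0 * 1 * z + 1 * 0 * y + 1 * t' * z))); first by ringF.
  by rewrite e2 addFF.
move/(_ (vec3 0 1 0) (vec3 0 0 1)); rewrite y0 z0 /gram_ratio !bf_dsum !bf_mx2.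
rewrite !(mulr0, mul0r, mulr1, mul1r, addr0, add0r) => /(_ erefl erefl).
by rewrite expr1n mulr1.
Qed.

Lemma classes_forms3 : classes (fun M : 'M[F]_3 => M != 0) scong (2 * #|F| + 7).
Proof.
have [g ng] := ex_not_wp.
(* With a radical: 0 + J, 0 + I, 0 + E11, and the family 0 + D(t). Without: 1 + I, the family 1 +
   D(t), and the three forms [mx3N]. *)
have -> : (2 * #|F| + 7 = ((1 + (1 + 1)) + #|F|) + (1 + (#|F| + (1 + (1 + 1)))))%N.
  by lia.
have ssym := scong_sym.
apply: (classes_split (Q := has_rad)) => //.
- by move=> M K _ _; apply: has_rad_scong.
- apply: (classes_split (Q := @sym_form 3)) => //.
  + by move=> M K _ _; apply: sym_form_scong.
  + apply: (classes_split (Q := @alt_form 3)) => //.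
    * by move=> M K _ _; apply: alt_form_scong.
    * apply: (classes1 (x0 := dsum 0 mxJ)).
        rewrite dsum0_neq0 ?mxJ_neq0 //; do !split=> //.
        - exact: has_rad_dsum0.
        - exact/sym_dsum/sym_mx2.
        - exact/alt_dsum/alt_mx2.
      by move=> M [[[]]]; apply: form_rad_sym_alt.
    have nalt N : N 0 0 != 0 -> ~ alt_form (dsum 0 N).
      by move=> /eqP N00 /alt_dsum; rewrite {1}(mx2P N) => /alt_mx2[].
    have I0 : mx2 1 0 0 1 != 0.
      by rewrite mx20; apply/eqP => /mx2_inj[/eqP]; rewrite oner_eq0.
    apply: (classes_split (Q := has_nondeg_plane)) => //.
    * by move=> M K _ _; apply: has_nondeg_plane_scong.
    * apply: (classes1 (x0 := dsum 0 (mx2 1 0 0 1))).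
        rewrite dsum0_neq0 //; do !split=> //.
        - exact: has_rad_dsum0.
        - exact/sym_dsum/sym_mx2.
        - by apply: nalt; rewrite mxE oner_neq0.
        - exact: has_nondeg_plane_dsum0I.
      move=> M [[[[M0 rM] sM] aM] pM].
      have [//|/scong_sym ME] := form_rad_sym M0 rM sM aM.
      by case: no_nondeg_plane_dsum0E; apply: has_nondeg_plane_scong pM; apply: scong_sym.
    * apply: (classes1 (x0 := dsum 0 mxE1)).
        rewrite dsum0_neq0 ?mxE1_neq0 //; do !split=> //.
        - exact: has_rad_dsum0.
        - exact/sym_dsum/sym_mx2.
        - by apply: nalt; rewrite mxE oner_neq0.
        - exact: no_nondeg_plane_dsum0E.
      move=> M [[[[M0 rM] sM] aM] pM].
      have [/scong_sym MI|//] := form_rad_sym M0 rM sM aM.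
      by case: pM; apply: has_nondeg_plane_scong MI _; apply: has_nondeg_plane_dsum0I.
  + apply: (classes_param (f := fun t => dsum 0 (mxD t))).
    * move=> t; rewrite dsum0_neq0; last first.
        by rewrite mx20; apply/eqP => /mx2_inj[/eqP]; rewrite oner_eq0.
      by do !split=> //; [exact: has_rad_dsum0 | move/sym_dsum/sym_mxD].
    * move=> t t' /gram_ratio_scong h; apply/gram_ratio_dsum0/h.
      exact/gram_ratio_dsum0.
    * by move=> M [[M0 rM] sM]; apply: form_rad_nonsym.
apply: (classes_split (Q := @sym_form 3)) => //.
- by move=> M K _ _; apply: sym_form_scong.
- have nrI : ~ has_rad (dsum 1 (mx2 1 0 0 1)).
    apply: no_rad_dsum1 => u; rewrite (vec2P u) => ru; apply/eqP; rewrite vec2_eq0.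
    have := ((ru (vec2 1 0)).1, (ru (vec2 0 1)).1); rewrite !bf_mx2.
    rewrite !(mulr0, mul0r, mulr1, mul1r, addr0, add0r) => -[-> ->].
    by rewrite eqxx.
  apply: (classes1 (x0 := dsum 1 (mx2 1 0 0 1))).
    by rewrite no_rad_neq0 //; do !split=> //; apply/sym_dsum/sym_mx2.
  by move=> M [[M0 nrM] sM]; apply: form_norad_sym.
apply: (classes_split (Q := has_comm_aniso)) => //.
- by move=> M K _ _; apply: has_comm_aniso_scong.
- have nrD t : ~ has_rad (dsum 1 (mxD t)).
    apply: no_rad_dsum1 => u; rewrite (vec2P u) => ru; apply/eqP; rewrite vec2_eq0.
    have := ((ru (vec2 1 0)).1, (ru (vec2 1 0)).2); rewrite !bf_mx2.
    rewrite !(mulr0, mul0r, mulr1, mul1r, addr0, add0r) => -[->].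
    by rewrite add0r => ->; rewrite eqxx.
  apply: (classes_param (f := fun t => dsum 1 (mxD t))).
  + move=> t; rewrite no_rad_neq0 //; do !split=> //.
      by move/sym_dsum/sym_mxD.
    exact: has_comm_aniso_dsum1.
  + move=> t t' /has_comm_aniso_ratio_scong h.
    by apply/has_comm_aniso_ratio_dsum1/h/has_comm_aniso_ratio_dsum1.
  + by move=> M [[[M0 rM] sM] aM]; apply: form_aniso_nonsym.
have rep b c : ((mx3N b c != 0 /\ ~ has_rad (mx3N b c)) /\ ~ sym_form (mx3N b c)) /\
    ~ has_comm_aniso (mx3N b c).
  rewrite no_rad_neq0; last exact: no_rad_mx3N.
  do !split=> //; [exact: no_rad_mx3N | exact: not_sym_mx3N | exact: no_comm_aniso_mx3N].
apply: (classes_split (Q := @singular 3)) => //.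
- by move=> M K _ _; apply: singular_scong.
- apply: (classes1 (x0 := mx3N 0 0)).
    by split; [exact: rep | exact/singular_mx3N].
  by move=> M [[[[M0 rM] sM] aM] sgM]; apply: form_singular.
have nsing c : ~ singular (mx3N 1 c).
  by move/singular_mx3N/eqP; rewrite oner_eq0.
apply: (classes_split (Q := has_noncomm_iso)) => //.
- by move=> M K _ _; apply: has_noncomm_iso_scong.
- apply: (classes1 (x0 := mx3N 1 0)).
    by split; [split; [exact: rep | exact: nsing] | exact/has_noncomm_iso_mx3N/is_wp0].
  by move=> M [[[[[M0 rM] sM] aM] sgM] iM]; apply: form_wp.
apply: (classes1 (x0 := mx3N 1 g)).
  split; [by split; [exact: rep | exact: nsing] |].
  by move/has_noncomm_iso_mx3N; apply/negP.
by move=> M [[[[[M0 rM] sM] aM] sgM] iM]; apply: form_nwp.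
Qed.
End Forms3.

(** * Nilpotent algebras with a nonzero cube *)

Section Nilpotent.
Variable A : assocAlg F.
Hypothesis nilA : nilpotent_alg A.
Implicit Types (x y z u v : A) (U V : {vspace A}) (c : F).

Local Notation mulv := (@mulv F A).
Local Notation "x ** y" := (amul A x y) (at level 40, left associativity).

(** Modulo U, right multiplication by y acts on v as the scalar c, so multiplying v by y repeatedly
    gives c^k v; nilpotency makes this 0 for large k. Thus a nonzero eigenvalue modulo an invariant
    subspace forces v into that subspace. *)
Lemma nil_eigenr U v y c : (forall u, u \in U -> u ** y \in U) ->
  v ** y - c *: v \in U -> c != 0 -> v \in U.
Proof.
move=> Uy vy c0; have [n nil_n] := nilA.
suff H k : foldl (amul A) v (nseq k y) - c ^+ k *: v \in U.
  have := H n; rewrite (nil_n v (nseq_tuple n y)) sub0r memvN.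
  by rewrite rpredZeq expf_eq0 (negPf c0) andbF.
elim: k => [|k IHk]; first by rewrite expr0 scale1r subrr mem0v.
rewrite -addn1 nseqD foldl_cat /= addn1.
have -> : foldl (amul A) v (nseq k y) ** y - c ^+ k.+1 *: v =
   (foldl (amul A) v (nseq k y) - c ^+ k *: v) ** y + c ^+ k *: (v ** y - c *: v).
  by rewrite linearBl amulZl scalerBr scalerA exprSr addrA subrK.
by rewrite memvD ?Uy ?memvZ.
Qed.

Lemma nil_eigenl U v y c : (forall u, u \in U -> y ** u \in U) ->
  y ** v - c *: v \in U -> c != 0 -> v \in U.
Proof.
move=> Uy vy c0; have [n nil_n] := nilA; pose p k := foldl (amul A) y (nseq k y).
(* Nilpotency is stated for left-bracketed products, so the power p k = y^(k+1) is formed first and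
   then multiplied by v. *)
have pU k u : u \in U -> p k ** u \in U.
  elim: k u => [|k IHk] u uU; first exact: Uy.
  by rewrite /p -addn1 nseqD foldl_cat /= -amulA IHk ?Uy.
suff H k : p k ** v - c ^+ k.+1 *: v \in U.
  have := H n; rewrite /p (nil_n y (nseq_tuple n y)) amul0l sub0r memvN.
  by rewrite rpredZeq expf_eq0 (negPf c0) andbF.
elim: k => [|k IHk]; first by rewrite expr1.
rewrite {1}/p -addn1 nseqD foldl_cat /= -amulA addn1 -/(p k).
have -> : p k ** (y ** v) - c ^+ k.+2 *: v =
   p k ** (y ** v - c *: v) + c *: (p k ** v - c ^+ k.+1 *: v).
  by rewrite linearBr amulZr scalerBr scalerA -exprS addrA subrK.
by rewrite memvD ?pU ?memvZ.
Qed.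

Lemma nil_fix v y : v ** y = v -> v = 0.
Proof.
move=> vy; apply/eqP; rewrite -memv0; apply: (@nil_eigenr 0%VS v y 1).
- by move=> u; rewrite !memv0 => /eqP->; rewrite amul0l.
- by rewrite vy scale1r subrr mem0v.
- exact: oner_neq0.
Qed.

Lemma foldl_amul_lin (s : seq A) : linear (fun u => foldl (amul A) u s).
Proof.
elim: s => [|y s IHs] c u v //=.
by rewrite amulDl amulZl; apply: IHs.
Qed.

(** Nakayama's lemma for nilpotent algebras: U lies in U A, hence in U A^n, which vanishes. *)
Lemma nil_mulv U : (U <= mulv U)%VS -> U = 0%VS.
Proof.
move=> UU; have [n nil_n] := nilA; apply/eqP; rewrite -subv0.
have UP k : (U <= iter k mulv U)%VS.
  by elim: k => [|k IHk] //=; apply: (subv_trans UU); apply: mulvS.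
(* Of the n right factors, k are already absorbed in u and the others are listed in s; the induction
   moves factors from s into u. *)
suff H k (s : seq A) u : (size s + k)%N = n -> u \in iter k mulv U ->
    foldl (amul A) u s = 0.
  apply/subvP => u uU; rewrite memv0; apply/eqP.
  exact: (H n [::] u erefl (subvP (UP n) u uU)).
elim: k s u => [|k IHk] s u.
  by rewrite addn0 => sn _; move: nil_n; rewrite -sn => /(_ u (in_tuple s)).
move=> sk; pose f : {linear A -> A} := HB.pack (fun u => foldl (amul A) u s)
  (GRing.isLinear.Build F _ _ _ _ (foldl_amul_lin s)).
have : (iter k.+1 mulv U <= lker (linfun f))%VS.
  apply: mulv_subv => x y xU; rewrite memv_ker lfunE /=.
  by apply/eqP; apply: (IHk (y :: s)); rewrite //= addSnnS.
by move=> /subvP H /H; rewrite memv_ker lfunE => /eqP.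
Qed.

Section Cube.
Hypothesis cube0 : forall x, x ** x ** x = 0.

(* With A^2 of codimension 1, A is spanned by x and A^2, and then A^3 = A^4. *)
Lemma dim_sqalg_neq3 : \dim {:A}%VS = 4%N -> \dim (sqalg A) != 3%N.
Proof.
move=> dA; apply/eqP => dS; pose S := sqalg A; pose T := mulv S; pose R := mulv T.
have /subvPn[x _ xS] : ~~ (fullv <= S)%VS.
  by apply/negP => /dimvS; rewrite dA dS.
have x0 : x != 0 by apply: contraNneq xS => ->; rewrite mem0v.
have AE a : exists c s, s \in S /\ a = c *: x + s.
  have fE : (<[x]> + S)%VS = fullv.
    apply/eqP; rewrite eqEdim subvf dA dimv_disjoint_sum ?dS ?dim_vline ?x0 //.
    apply/eqP; rewrite -subv0; apply/subvP => u; rewrite memv_cap memv0.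
    case/andP=> /vlineP[c ->]; rewrite rpredZeq (negPf xS) orbF => /eqP->.
    by rewrite scale0r.
  have := memvf a; rewrite -fE => /memv_addP[_ /vlineP[c ->] [s sS ->]].
  by exists c, s.
have AS a s : s \in S -> a ** s \in T := @mul_mem_sqalg _ A a s.
have SS s s' : s \in S -> s' \in S -> s ** s' \in R.
  move=> sS; have /subvP H : (S <= linfun (amul A s) @^-1: R)%VS.
    apply: mulv_subv => y z _; rewrite -memv_preim lfunE /= amulA.
    by rewrite mem_mulv // mem_mulv.
  by move=> /H; rewrite -memv_preim lfunE.
have Sle : (S <= <[x ** x]> + T)%VS.
  apply: mulv_subv => a b _; have [[c [s [sS ->]]] [d [t [tS ->]]]] := (AE a, AE b).
  rewrite amulDl !amulDr !amulZl !amulZr -addrA; apply: memv_add.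
    by rewrite !memvZ ?memv_line.
  by rewrite !memvD ?memvZ ?(AS x t tS) // mem_mulv.
have T0 : T = 0%VS.
  apply: nil_mulv; apply: mulv_subv => a b /(subvP Sle).
  case/memv_addP=> _ /vlineP[c ->] [t tT ->].
  have [d [s [sS ->]]] := AE b.
  rewrite amulDl amulZl amulDr amulZr cube0 scaler0 add0r.
  apply: memvD; last exact: mem_mulv.
  by apply/memvZ/SS; rewrite ?mem_sqalg.
by have := dimvS Sle; rewrite T0 addv0 dS dim_vline; case: (_ != _).
Qed.

Lemma dim_sqalg_neq4 : \dim {:A}%VS = 4%N -> \dim (sqalg A) != 4%N.
Proof.
move=> dA; apply/eqP => dS.
have SA : sqalg A = fullv by apply/eqP; rewrite eqEdim subvf dS dA.
have A0 : fullv = 0%VS :> {vspace A} by apply: nil_mulv; rewrite -/(sqalg A) SA.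
by move: dA; rewrite A0 dimv0.
Qed.

(* If A^2 has dimension 2 and x y u <> 0, then A^4 = 0, A^2 is spanned by z = x y
   and w = x y u, and a b = beta(a, b) z modulo w, where evaluating a b c in two
   ways shows that beta is a multiple of l (x) l for the linear form l with
   a z = l(a) w. *)
Lemma cube0_nil3 : (\dim (sqalg A) <= 2)%N -> nil3 A.
Proof.
move=> dS x y u; pose S := sqalg A; pose T := mulv S; pose R := mulv T.
apply/eqP/negPn/negP; set z := x ** y; set w := z ** u => w0.
have AS a s : s \in S -> a ** s \in T := @mul_mem_sqalg _ A a s.
have zS : z \in S by apply: mem_sqalg.
have wT : w \in T by apply: mem_mulv.
have TS : (T <= S)%VS by apply: mulv_subv => a b _; apply: mem_sqalg.
have RT : (R <= T)%VS by apply: mulv_subv => a b /(subvP TS); apply: mem_mulv.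
have neq0 U V : (V <= U)%VS -> V = mulv U -> U != 0%VS -> (\dim V < \dim U)%N.
  move=> VU VE; rewrite ltn_neqAle dimvS // andbT; apply: contra => /eqP eVU.
  have /eqP VU' : V == U by rewrite eqEdim VU eVU leqnn.
  by apply/eqP/nil_mulv; rewrite -VE VU' subvv.
have T0 : T != 0%VS by apply: contraNneq w0 => T0; rewrite -memv0 -T0.
have S0 : S != 0%VS.
  by apply: contraNneq T0 => S0; rewrite -subv0 -S0.
have dTS := neq0 _ _ TS erefl S0; have dRT := neq0 _ _ RT erefl T0.
have dT : \dim T = 1%N.
  by apply/eqP; rewrite eqn_leq -ltnS (leq_trans dTS dS) lt0n dimv_eq0.
have dS2 : \dim S = 2%N by apply/eqP; rewrite eqn_leq dS -dT.
have R0 : R = 0%VS by apply/eqP; rewrite -dimv_eq0 -leqn0 -ltnS -dT.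
have Tw : T = <[w]>%VS.
  by apply/esym/eqP; rewrite eqEdim dT dim_vline w0 -memvE wT.
have TA t b : t \in T -> t ** b = 0.
  by move=> tT; apply/eqP; rewrite -memv0 -R0 mem_mulv.
have AT t b : t \in T -> b ** t = 0.
  move=> tT; apply/eqP; rewrite -memv0 -R0.
  have /subvP H : (T <= linfun (amul A b) @^-1: R)%VS.
    apply: mulv_subv => s c sS; rewrite -memv_preim lfunE /= amulA.
    by rewrite mem_mulv // AS.
  by move: tT => /H; rewrite -memv_preim lfunE.
have zT : z \notin T by apply: contraNN w0 => zT; rewrite /w TA.
have SE a b : exists p q, a ** b = p *: z + q *: w.
  have : a ** b \in (<[z]> + <[w]>)%VS.
    suff -> : (<[z]> + <[w]>)%VS = S by apply: mem_sqalg.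
    apply/eqP; rewrite eqEdim dS2 subv_add -!memvE zS (subvP TS) //=.
    rewrite dimv_disjoint_sum ?dim_vline ?w0.
      by case: eqP zT => // ->; rewrite mem0v.
    apply/eqP; rewrite -subv0; apply/subvP => v; rewrite memv_cap memv0 -Tw.
    case/andP=> /vlineP[c ->]; rewrite rpredZeq (negPf zT) orbF => /eqP->.
    by rewrite scale0r.
  by case/memv_addP=> _ /vlineP[p ->] [_ /vlineP[q ->] ->]; exists p, q.
have wl a b : a ** w = 0 /\ w ** b = 0 by rewrite AT ?TA.
have zl a : exists c, a ** z = c *: w.
  by apply/vlineP; rewrite -Tw AS.
have [l xz] := zl x; have [l' yz] := zl y.
have [m [m' yu]] := SE y u; have [n [n' uu]] := SE u u.
have [p [p' xx]] := SE x x; have [q [q' xu]] := SE x u.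
have inj c d : c *: w = d *: w -> c = d.
  by move/eqP; rewrite -subr_eq0 -scalerBl scaler_eq0 (negPf w0) orbF subr_eq0 => /eqP.
have wz (a b c : F) : (a *: z + b *: w) ** u = a *: w.
  by rewrite amulDl !amulZl (wl x u).2 scaler0 addr0.
have zw (e a b c : F) v : v ** z = e *: w -> v ** (a *: z + b *: w) = (a * e) *: w.
  by move=> vz; rewrite amulDr !amulZr (wl v u).1 scaler0 addr0 vz scalerA.
have ml : 1 = m * l.
  by apply: inj; rewrite scale1r -(zw _ _ m' 0 _ xz) -yu amulA.
have mn : m = n * l'.
  by apply: inj; rewrite -(zw _ _ n' 0 _ yz) -uu amulA yu wz.
have pq : p = q * l.
  by apply: inj; rewrite -(zw _ _ q' 0 _ xz) -xu amulA xx wz.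
have qn : q = n * l.
  by apply: inj; rewrite -(zw _ _ n' 0 _ xz) -uu amulA xu wz.
have /eqP : (p * l) *: w = 0.
  by rewrite -(zw _ _ p' 0 _ xz) -xx amulA cube0.
rewrite scaler_eq0 (negPf w0) orbF pq qn => /eqP e.
have /eqP : 1 = 0 :> F.
  transitivity (m ^+ 3 * (l ^+ 3)); first by rewrite -exprMn -ml expr1n.
  have [n0|n0] := eqVneq n 0; first by rewrite mn n0 mul0r expr0n mul0r.
  have l0 : l ^+ 3 = 0 by apply: (mulfI n0); rewrite mulr0 -e; ringF.
  by rewrite l0 mulr0.
by rewrite oner_eq0.
Qed.
End Cube.

(** * Normal forms of algebras with an element of nonzero cube *)

Definition F4 : vectType F := ((F^o * F^o) * F^o * F^o)%type.

Definition comb4 (e0 e1 e2 e3 : A) (a : F4) : A :=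
  a.1.1.1 *: e0 + a.1.1.2 *: e1 + a.1.2 *: e2 + a.2 *: e3.

Lemma comb4_linear e0 e1 e2 e3 : linear (comb4 e0 e1 e2 e3).
Proof.
move=> c [[[a0 a1] a2] a3] [[[b0 b1] b2] b3]; rewrite /comb4.
change ((c * a0 + b0) *: e0 + (c * a1 + b1) *: e1 + (c * a2 + b2) *: e2 +
  (c * a3 + b3) *: e3 = c *: (a0 *: e0 + a1 *: e1 + a2 *: e2 + a3 *: e3) +
  (b0 *: e0 + b1 *: e1 + b2 *: e2 + b3 *: e3)).
rewrite !scalerDl !scalerDr !scalerA.
by rewrite [X in X + _ + _]addrACA [X in X + _]addrACA [LHS]addrACA.
Qed.
HB.instance Definition _ e0 e1 e2 e3 :=
  GRing.isLinear.Build F _ _ _ _ (comb4_linear e0 e1 e2 e3).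

Lemma dim_F4 : \dim {:F4}%VS = 4%N.
Proof. by rewrite dimvf /dim /= /dim /= /dim /= /dim. Qed.

Hypothesis dA : \dim {:A}%VS = 4%N.

Lemma comb4_surj e0 e1 e2 e3 :
    (forall a b c d : F, a *: e0 + b *: e1 + c *: e2 + d *: e3 = 0 ->
      [/\ a = 0, b = 0, c = 0 & d = 0]) ->
  forall v, exists a b c d : F, v = a *: e0 + b *: e1 + c *: e2 + d *: e3.
Proof.
move=> ind v; have [g _ gK] : bijective (comb4 e0 e1 e2 e3).
  apply: inj_linear_bij; first by rewrite dim_F4 dA.
  apply/raddf_inj => -[[[a b] c] d] /ind[/= -> -> -> ->]; reflexivity.
by have := gK v; case: (g v) => [[[a b] c] d] <-; exists a, b, c, d.
Qed.

(* A relation with leading coefficient a_i would give x^(i+1) = x^(i+1) u. *)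
Lemma pow_indep x (a0 a1 a2 a3 a4 : F) :
    let x2 := x ** x in let x3 := x2 ** x in let x4 := x3 ** x in
    x4 != 0 ->
    a0 *: x + a1 *: x2 + a2 *: x3 + a3 *: x4 + a4 *: (x4 ** x) = 0 ->
  [/\ a0 = 0, a1 = 0, a2 = 0 & a3 = 0].
Proof.
move=> x2 x3 x4 x40.
have xx2 : x ** x2 = x3 by rewrite amulA.
have xx3 : x ** x3 = x4 by rewrite amulA xx2.
have xx4 : x ** x4 = x4 ** x by rewrite amulA xx3.
have x30 : x3 != 0 by apply: contraNneq x40 => e; rewrite /x4 e amul0l.
have x20 : x2 != 0 by apply: contraNneq x30 => e; rewrite /x3 e amul0l.
have x0 : x != 0 by apply: contraNneq x20 => e; rewrite /x2 e amul0l.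
have fix0 (a : F) v u : v != 0 -> a *: v + v ** u = 0 -> a = 0.
  move=> v0 e; apply: contraNeq v0 => a'0; apply/eqP.
  apply: (@nil_fix v (- a^-1 *: u)); rewrite amulZr.
  apply: (scalerI a'0); rewrite scalerA mulrN divff // scaleN1r.
  by apply/eqP; rewrite eq_sym -addr_eq0 e.
move=> e.
have a00 : a0 = 0.
  apply: (@fix0 _ x (a1 *: x + a2 *: x2 + a3 *: x3 + a4 *: x4)) => //.
  by rewrite !amulDr !amulZr -/x2 xx2 xx3 xx4 !addrA.
rewrite a00 scale0r add0r in e.
have x2x2 : x2 ** x2 = x4 by rewrite amulA.
have x2x3 : x2 ** x3 = x4 ** x by rewrite amulA x2x2.
have a10 : a1 = 0.
  apply: (@fix0 _ x2 (a2 *: x + a3 *: x2 + a4 *: x3)) => //.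
  by rewrite !amulDr !amulZr -/x3 x2x2 x2x3 !addrA.
rewrite a10 scale0r add0r in e.
have a20 : a2 = 0.
  apply: (@fix0 _ x3 (a3 *: x + a4 *: x2)) => //.
  by rewrite !amulDr !amulZr -/x4 [x3 ** x2]amulA !addrA.
rewrite a20 scale0r add0r in e; split=> //.
apply: (@fix0 _ x4 (a4 *: x)) => //.
by rewrite !amulZr.
Qed.

(** The powers x, .., x^4 form a basis, so x^5 is a combination of them; [pow_indep] admits an x^5
    term and makes all the coefficients vanish. *)
Lemma fifth_pow0 x : x ** x ** x ** x != 0 -> x ** x ** x ** x ** x = 0.
Proof.
move=> x40; have [|a [b [c [d e]]]] := @comb4_surj x (x ** x) (x ** x ** x)
    (x ** x ** x ** x) _ (x ** x ** x ** x ** x).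
  move=> a b c d e; apply: (@pow_indep x a b c d 0) => //.
  by rewrite scale0r addr0.
have [|a0 b0 c0 d0] := @pow_indep x a b c d (- 1) x40.
  by rewrite -e scaleN1r subrr.
by rewrite e a0 b0 c0 d0 !scale0r !addr0.
Qed.

(** Start with y0 outside C = <x, x^2, x^3>. The coefficient of y0 in x y0 is an eigenvalue modulo
    C, hence 0, and subtracting a combination of x and x^2 leaves x y = a x, where a = 0 by
    nilpotency. Then x (y x) = x (y y) = 0 removes x and x^2 from y x and y y, and the eigenvalue
    argument removes y. *)
Lemma ex_tri x : x ** x ** x != 0 -> x ** x ** x ** x = 0 ->
  exists y (d b : F), [/\ forall v, exists a b c d : F,
      v = a *: x + b *: (x ** x) + c *: (x ** x ** x) + d *: y,
    forall a b c d : F, a *: x + b *: (x ** x) + c *: (x ** x ** x) + d *: y = 0 ->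
      [/\ a = 0, b = 0, c = 0 & d = 0],
    x ** y = 0, y ** x = d *: (x ** x ** x) & y ** y = b *: (x ** x ** x)].
Proof.
set x2 := x ** x; set x3 := x2 ** x => x30 x40.
have xx2 : x ** x2 = x3 by rewrite amulA.
have xx3 : x ** x3 = 0 by rewrite amulA xx2.
have x0 : x != 0 by apply: contraNneq x30 => e; rewrite /x3 /x2 e !amul0l.
pose C := (<[x]> + <[x2]> + <[x3]>)%VS.
have memC (a b c : F) : a *: x + b *: x2 + c *: x3 \in C.
  by rewrite !memv_add ?memvZ ?memv_line.
have CP v : v \in C -> exists a b c, v = a *: x + b *: x2 + c *: x3.
  case/memv_addP=> _ /memv_addP[_ /vlineP[a ->] [_ /vlineP[b ->] ->]].
  by case=> _ /vlineP[c ->] ->; exists a, b, c.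
have xC u : u \in C -> x ** u \in C.
  case/CP=> a [b [c ->]]; rewrite !amulDr !amulZr xx2 xx3 scaler0 addr0.
  by have := memC 0 a b; rewrite scale0r add0r.
have Cx u : u \in C -> u ** x \in C.
  case/CP=> a [b [c ->]]; rewrite !amulDl !amulZl x40 scaler0 addr0.
  by have := memC 0 a b; rewrite scale0r add0r.
have /subvPn[y0 _ y0C] : ~~ (fullv <= C)%VS.
  apply/negP => /dimvS; rewrite dA /C.
  have le1 (v : A) : (\dim <[v]> <= 1)%N by rewrite dim_vline leq_b1.
  have := leq_trans (dimv_add_leqif (<[x]> + <[x2]>) <[x3]>)
    (leq_add (leq_trans (dimv_add_leqif <[x]> <[x2]>)
      (leq_add (le1 x) (le1 x2))) (le1 x3)).
  by move=> h1 h2; have := leq_trans h2 h1.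
have indC y : y \notin C -> forall a b c d : F,
    a *: x + b *: x2 + c *: x3 + d *: y = 0 -> [/\ a = 0, b = 0, c = 0 & d = 0].
  move=> yC a b c d e; have d0 : d = 0.
    apply: contraNeq yC => d0; suff : d *: y \in C by rewrite rpredZeq (negPf d0).
    have -> : d *: y = - (a *: x + b *: x2 + c *: x3).
      by apply/eqP; rewrite -addr_eq0 addrC e.
    by rewrite memvN.
  rewrite d0 scale0r addr0 in e.
  have e1 : a *: x2 + b *: x3 = 0.
    by have := congr1 (amul A x) e; rewrite !amulDr !amulZr xx2 xx3 amul0r scaler0 addr0.
  have a0 : a = 0.
    have := congr1 (amul A x) e1; rewrite amulDr !amulZr xx2 xx3 amul0r scaler0 addr0.
    by move/eqP; rewrite scaler_eq0 (negPf x30) orbF => /eqP.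
  have b0 : b = 0.
    by move/eqP: e1; rewrite a0 scale0r add0r scaler_eq0 (negPf x30) orbF => /eqP.
  rewrite a0 b0 !scale0r !add0r in e.
  by move/eqP: e; rewrite scaler_eq0 (negPf x30) orbF => /eqP.
have [a [b [c [d xy0]]]] := comb4_surj (indC _ y0C) (x ** y0).
have d0 : d = 0.
  apply: contraNeq y0C => d0; apply: (nil_eigenl xC _ d0).
  by rewrite xy0 addrK.
rewrite d0 scale0r addr0 in xy0.
pose y := y0 - (b *: x + c *: x2).
have yC : y \notin C.
  apply: contra y0C => yC; rewrite -[y0](subrK (b *: x + c *: x2)) memvD //.
  by have := memC b c 0; rewrite scale0r addr0.
have xy : x ** y = 0.
  have xy : x ** y = a *: x.
    by rewrite /y linearBr xy0 amulDr !amulZr xx2 -/x2 -[_ + b *: x2 + _]addrA addrK.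
  rewrite xy; have [->|a0] := eqVneq a 0; first by rewrite scale0r.
  suff x_0 : x = 0 by rewrite x_0 eqxx in x0.
  by apply: (@nil_fix x (a^-1 *: y)); rewrite amulZr xy scalerA mulVf // scale1r.
have indy := indC _ yC; have yS := comb4_surj indy.
have xE (a' b' c' d' : F) : x ** (a' *: x + b' *: x2 + c' *: x3 + d' *: y) = 0 ->
    a' = 0 /\ b' = 0.
  rewrite !amulDr !amulZr xx2 xx3 xy !scaler0 !addr0 => e.
  have := indy 0 a' b' 0; rewrite !scale0r add0r addr0.
  by case/(_ e) => _ -> ->.
have [a1 [b1 [de [d1 yx]]]] := yS (y ** x).
have [a10 b10] : a1 = 0 /\ b1 = 0.
  by apply: (xE _ _ de d1); rewrite -yx amulA xy amul0l.
rewrite a10 b10 !scale0r !add0r in yx.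
have d10 : d1 = 0.
  apply: contraNeq yC => d10; apply: (nil_eigenr Cx _ d10).
  by rewrite yx addrK; have := memC 0 0 de; rewrite !scale0r !add0r.
have [a2 [b2 [be [d2 yy]]]] := yS (y ** y).
have [a20 b20] : a2 = 0 /\ b2 = 0.
  by apply: (xE _ _ be d2); rewrite -yy amulA xy amul0l.
rewrite a20 b20 !scale0r !add0r in yy.
have d20 : d2 = 0.
  apply: contraNeq yC => d20.
  have /subvP H : (<[x3]> <= C)%VS by rewrite addvSr.
  apply: H; apply: (@nil_eigenr <[x3]>%VS y y d2) => //; last first.
    by rewrite yy addrK memvZ ?memv_line.
  by move=> _ /vlineP[k ->]; rewrite amulZl /x3 -amulA xy amul0r scaler0 mem0v.
exists y, de, be; split=> //.
  by rewrite yx d10 scale0r addr0.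
by rewrite yy d20 scale0r addr0.
Qed.
End Nilpotent.

(** Structure constants in the basis x, x^2, x^3, y, in this order. *)
Definition tri_mul (d b : F) (x y : F4) : F4 :=
  let: (x0, x1, x2, x3) := x in let: (y0, y1, y2, y3) := y in
  (0, x0 * y0, x0 * y1 + x1 * y0 + d * x3 * y0 + b * x3 * y3, 0).

Lemma tri_mul_bilinear d b : bilinear_for
  (GRing.Scale.Law.clone _ _ *:%R _) (GRing.Scale.Law.clone _ _ *:%R _)
  (tri_mul d b).
Proof.
by split=> [[[[u0 u1] u2] u3]|[[[u0 u1] u2] u3]] c [[[x0 x1] x2] x3]
  [[[y0 y1] y2] y3]; congr (_, _, _, _); rewrite /= /GRing.scale /=; ringF.
Qed.
HB.instance Definition _ d b := bilinear_isBilinear.Build F F4 F4 F4 _ _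
  (tri_mul d b) (tri_mul_bilinear d b).

Lemma tri_mulA d b : associative (tri_mul d b).
Proof.
move=> [[[x0 x1] x2] x3] [[[y0 y1] y2] y3] [[[z0 z1] z2] z3].
by congr (_, _, _, _); rewrite /=; ringF.
Qed.

Definition tri d b : assocAlg F := AssocAlg (tri_mulA d b).

(** Multiplication of polynomials without constant term modulo the fifth power of the variable. *)
Definition cyc_mul (x y : F4) : F4 :=
  let: (x0, x1, x2, x3) := x in let: (y0, y1, y2, y3) := y in
  (0, x0 * y0, x0 * y1 + x1 * y0, x0 * y2 + x1 * y1 + x2 * y0).

Lemma cyc_mul_bilinear : bilinear_for
  (GRing.Scale.Law.clone _ _ *:%R _) (GRing.Scale.Law.clone _ _ *:%R _) cyc_mul.
Proof.
by split=> [[[[u0 u1] u2] u3]|[[[u0 u1] u2] u3]] c [[[x0 x1] x2] x3]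
  [[[y0 y1] y2] y3]; congr (_, _, _, _); rewrite /= /GRing.scale /=; ringF.
Qed.
HB.instance Definition _ := bilinear_isBilinear.Build F F4 F4 F4 _ _
  cyc_mul cyc_mul_bilinear.

Lemma cyc_mulA : associative cyc_mul.
Proof.
move=> [[[x0 x1] x2] x3] [[[y0 y1] y2] y3] [[[z0 z1] z2] z3].
by congr (_, _, _, _); rewrite /=; ringF.
Qed.

Definition cyc : assocAlg F := AssocAlg cyc_mulA.

Lemma cyc_iso (A : assocAlg F) x : nilpotent_alg A -> \dim {:A}%VS = 4%N ->
  amul A (amul A (amul A x x) x) x != 0 -> iso_alg A cyc.
Proof.
move=> nA dA x40; apply: iso_alg_sym.
set x2 := amul A x x in x40 *; set x3 := amul A x2 x in x40 *.
set x4 := amul A x3 x in x40 *.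
have x50 : amul A x4 x = 0 by apply: fifth_pow0.
have xx2 : amul A x x2 = x3 by rewrite amulA.
have xx3 : amul A x x3 = x4 by rewrite amulA xx2.
have xx4 : amul A x x4 = 0 by rewrite amulA xx3.
have x2x2 : amul A x2 x2 = x4 by rewrite amulA.
have x2x3 : amul A x2 x3 = 0 by rewrite amulA x2x2.
have x2x4 : amul A x2 x4 = 0 by rewrite -amulA xx4 amul0r.
have x3x2 : amul A x3 x2 = 0 by rewrite amulA.
have x3x3 : amul A x3 x3 = 0 by rewrite amulA x3x2 amul0l.
have x3x4 : amul A x3 x4 = 0 by rewrite amulA x3x3 amul0l.
have x4x a : amul A x4 a = 0.
  have [|p [q [r [s ->]]]] := comb4_surj dA (e0 := x) (e1 := x2)
      (e2 := x3) (e3 := x4) _ a.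
    by move=> p q r s e; apply: (@pow_indep _ nA x p q r s 0); rewrite // scale0r addr0.
  rewrite !amulDr !amulZr x50 /x2 /x3 /x4.
  by rewrite !amulA !x50 !amul0l !scaler0 !addr0.
apply: (@iso_algI _ cyc A (comb4 x x2 x3 x4)).
- by rewrite dim_F4 dA.
- move=> [[[a b] c] d] /= e.
  have [|-> -> -> -> //] := @pow_indep _ nA x a b c d 0 x40.
  by rewrite scale0r addr0.
move=> [[[a0 a1] a2] a3] [[[b0 b1] b2] b3].
change ((0 : F) *: x + (a0 * b0) *: x2 + (a0 * b1 + a1 * b0) *: x3 +
    (a0 * b2 + a1 * b1 + a2 * b0) *: x4 =
  amul A (a0 *: x + a1 *: x2 + a2 *: x3 + a3 *: x4)
    (b0 *: x + b1 *: x2 + b2 *: x3 + b3 *: x4)).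
rewrite !amulDl !amulDr !amulZl !amulZr !x4x.
rewrite -/x2 -/x3 -/x4 xx2 xx3 xx4 x2x2 x2x3 x2x4 x3x2 x3x3 x3x4.
rewrite scale0r add0r !scaler0 !addr0 !scalerA !scalerDl.
by rewrite [X in _ = X + _]addrACA !addrA.
Qed.

Lemma tri_iso (A : assocAlg F) x : nilpotent_alg A -> \dim {:A}%VS = 4%N ->
    amul A (amul A x x) x != 0 -> amul A (amul A (amul A x x) x) x = 0 ->
  exists d b, iso_alg A (tri d b).
Proof.
move=> nA dA x30 x40; have [y [d [b [_ ind xy yx yy]]]] := ex_tri nA dA x30 x40.
exists d, b; apply: iso_alg_sym.
set x2 := amul A x x in x30 x40 ind yx yy *.
set x3 := amul A x2 x in x30 x40 ind yx yy *.
have xx2 : amul A x x2 = x3 by rewrite amulA.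
have xx3 : amul A x x3 = 0 by rewrite amulA xx2.
have x2x2 : amul A x2 x2 = 0 by rewrite amulA.
have x2x3 : amul A x2 x3 = 0 by rewrite -amulA xx3 amul0r.
have x3x2 : amul A x3 x2 = 0 by rewrite amulA x40 amul0l.
have x3x3 : amul A x3 x3 = 0 by rewrite amulA x3x2 amul0l.
have x2y : amul A x2 y = 0 by rewrite -amulA xy amul0r.
have x3y : amul A x3 y = 0 by rewrite -amulA xy amul0r.
have yx2 : amul A y x2 = 0 by rewrite amulA yx amulZl x40 scaler0.
have yx3 : amul A y x3 = 0 by rewrite amulA yx2 amul0l.
apply: (@iso_algI _ (tri d b) A (comb4 x x2 x3 y)).
- by rewrite dim_F4 dA.
- by move=> [[[a0 a1] a2] a3] /ind[/= -> -> -> ->].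
move=> [[[a0 a1] a2] a3] [[[b0 b1] b2] b3].
change ((0 : F) *: x + (a0 * b0) *: x2 +
    (a0 * b1 + a1 * b0 + d * a3 * b0 + b * a3 * b3) *: x3 + (0 : F) *: y =
  amul A (a0 *: x + a1 *: x2 + a2 *: x3 + a3 *: y)
    (b0 *: x + b1 *: x2 + b2 *: x3 + b3 *: y)).
rewrite !amulDl !amulDr !amulZl !amulZr.
rewrite -/x2 -/x3 x40 xx2 xx3 x2x2 x2x3 x3x2 x3x3 xy x2y x3y yx2 yx3 yx yy.
rewrite !scale0r !scaler0 !addr0 !add0r !scalerA !scalerDl !addrA.
have -> : d * a3 * b0 = a3 * b0 * d by ringF.
by have -> : b * a3 * b3 = a3 * b3 * b by ringF.
Qed.

(** This is the substitution of c x for x and a y for y; the two equations compare the coefficients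
    of x^3 in y x and y y. *)
Lemma tri_scale (c a d b d' b' : F) : c != 0 -> a != 0 ->
    d * a = c ^+ 2 * d' -> b * a ^+ 2 = c ^+ 3 * b' ->
  iso_alg (tri d b) (tri d' b').
Proof.
move=> c0 a0 dd' bb'; apply: iso_alg_sym.
pose f (x : tri d' b') : tri d b :=
  let: (x0, x1, x2, x3) := x in (c * x0, c ^+ 2 * x1, c ^+ 3 * x2, a * x3).
have f_lin : linear f.
  move=> k [[[x0 x1] x2] x3] [[[y0 y1] y2] y3].
  by congr (_, _, _, _); rewrite /= /GRing.scale /=; ringF.
pose fl : {linear tri d' b' -> tri d b} := HB.pack f
  (GRing.isLinear.Build F _ _ _ f f_lin).
apply: (@iso_algI _ _ _ fl) => //.
  have div0 (k x : F) : k != 0 -> k * x = 0 -> x = 0.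
    by move=> k0 e; apply: (mulfI k0); rewrite e mulr0.
  move=> [[[x0 x1] x2] x3] [/(div0 _ _ c0) -> /(div0 _ _ (expf_neq0 _ c0)) ->].
  by move=> /(div0 _ _ (expf_neq0 _ c0)) -> /(div0 _ _ a0) ->.
move=> [[[x0 x1] x2] x3] [[[y0 y1] y2] y3].
congr (_, _, _, _); rewrite /= ?mulr0 //; first by ringF.
transitivity (c ^+ 3 * (x0 * y1 + x1 * y0) + (c ^+ 2 * d') * c * x3 * y0 +
  (c ^+ 3 * b') * x3 * y3); first by ringF.
by rewrite -dd' -bb'; ringF.
Qed.

Lemma tri_normal d b : iso_alg (tri d b) (tri (d != 0)%:R (b != 0)%:R).
Proof.
have [->|d0] := eqVneq d 0; have [->|b0] := eqVneq b 0; rewrite ?mulr0n ?mulr1n.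
- exact: iso_alg_refl.
- by apply: (@tri_scale b b) => //; ringF.
- by apply: (@tri_scale 1 d^-1); rewrite ?oner_neq0 ?invr_eq0 //; fieldF.
(* These values solve d a = c^2 and b a^2 = c^3. *)
- apply: (@tri_scale (d ^+ 2 / b) (d ^+ 3 / b ^+ 2)); try fieldF.
    by rewrite mulf_neq0 ?invr_eq0 ?expf_neq0.
  by rewrite mulf_neq0 ?invr_eq0 ?expf_neq0.
Qed.

(** * Isomorphism invariants and the final count *)

Definition comm_alg (A : assocAlg F) := forall x y, amul A x y = amul A y x.
(** Separates b = 0 from b <> 0 in [tri]: the elements x, x^2, x^3 annihilate y from the left, so A
    y = 0 iff y y = 0, while y is not a product of three elements. *)
Definition ann_cubes (A : assocAlg F) := forall a, (forall x, amul A x a = 0) ->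
  exists x y z, a = amul A (amul A x y) z.
Definition has_cube (A : assocAlg F) := exists x, amul A (amul A x x) x != 0.
Definition has_fourth (A : assocAlg F) :=
  exists x, amul A (amul A (amul A x x) x) x != 0.

Lemma iso_neq0 (A B : assocAlg F) (f : {linear A -> B}) x :
  bijective f -> x != 0 -> f x != 0.
Proof.
move=> /bij_inj f_inj; apply: contra_neq => fx.
by apply: f_inj; rewrite fx linear0.
Qed.

Lemma comm_alg_iso A B : iso_alg A B -> comm_alg A -> comm_alg B.
Proof.
case=> f [[g fK gK] fM] cA x y.
by rewrite -[x]gK -[y]gK -!fM cA.
Qed.

Lemma ann_cubes_iso A B : iso_alg A B -> ann_cubes A -> ann_cubes B.
Proof.
case=> f [[g fK gK] fM] cA a aB; have [x|x [y [z az]]] := cA (g a).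
  by apply: (can_inj fK); rewrite fM gK aB linear0.
by exists (f x), (f y), (f z); rewrite -!fM -az gK.
Qed.

Lemma has_cube_iso A B : iso_alg A B -> has_cube A -> has_cube B.
Proof.
case=> f [f_bij fM] [x x3]; exists (f x).
by rewrite -!fM; apply: iso_neq0.
Qed.

Lemma has_fourth_iso A B : iso_alg A B -> has_fourth A -> has_fourth B.
Proof.
case=> f [f_bij fM] [x x4]; exists (f x).
by rewrite -!fM; apply: iso_neq0.
Qed.

Lemma tri4 d b (x y z t : F4) : tri_mul d b (tri_mul d b (tri_mul d b x y) z) t = 0.
Proof.
case: x y z t => [[[x0 x1] x2] x3] [[[y0 y1] y2] y3] [[[z0 z1] z2] z3] [[[t0 t1] t2] t3].
by congr (_, _, _, _); rewrite /=; ringF.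
Qed.

Lemma cyc5 (x y z t u : F4) :
  cyc_mul (cyc_mul (cyc_mul (cyc_mul x y) z) t) u = 0.
Proof.
case: x y z t u => [[[x0 x1] x2] x3] [[[y0 y1] y2] y3] [[[z0 z1] z2] z3]
  [[[t0 t1] t2] t3] [[[u0 u1] u2] u3].
by congr (_, _, _, _); rewrite /=; ringF.
Qed.

Lemma tri_nil d b : nilpotent_alg (tri d b).
Proof.
exists 3%N => x s; case/tupleP: s => y s; case/tupleP: s => z s.
by case/tupleP: s => t s; rewrite tuple0; apply: tri4.
Qed.

Lemma cyc_nil : nilpotent_alg cyc.
Proof.
exists 4%N => x s; case/tupleP: s => y s; case/tupleP: s => z s.
by case/tupleP: s => t s; case/tupleP: s => u s; rewrite tuple0; apply: cyc5.
Qed.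

Lemma neq0_pair (U V : zmodType) (x : U * V) : x.1 != 0 \/ x.2 != 0 -> x != 0.
Proof. by case=> x0; apply: contra_neq x0 => ->. Qed.

Lemma tri_has_cube d b : has_cube (tri d b).
Proof.
exists ((1, 0, 0, 0) : F4); apply: neq0_pair; left; apply: neq0_pair; right.
by rewrite /= !(mulr0, mul0r, mulr1, add0r, addr0) oner_eq0.
Qed.

Lemma cyc_has_fourth : has_fourth cyc.
Proof.
exists ((1, 0, 0, 0) : F4); apply: neq0_pair; right.
by rewrite /= !(mulr0, mul0r, mulr1, add0r, addr0) oner_eq0.
Qed.

Lemma comm_tri d b : comm_alg (tri d b) <-> d = 0.
Proof.
split=> [/(_ ((1, 0, 0, 0) : F4) ((0, 0, 0, 1) : F4))|-> x y].
  move/(congr1 (fun v : F4 => v.1.2)).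
  by rewrite /= !(mulr0, mul0r, mulr1, add0r, addr0).
case: x y => [[[x0 x1] x2] x3] [[[y0 y1] y2] y3].
by congr (_, _, _, _); rewrite /=; ringF.
Qed.

Lemma ann_cubes_tri d b : ann_cubes (tri d b) <-> b != 0.
Proof.
split=> [ann|b0 [[[a0 a1] a2] a3] ann].
  apply/eqP => b0; have [[[[x0 x1] x2] x3]|x [y [z]]] := ann ((0, 0, 0, 1) : F4).
    by congr (_, _, _, _); rewrite /= ?b0; ringF.
  case: x y z => [[[x0 x1] x2] x3] [[[y0 y1] y2] y3] [[[z0 z1] z2] z3].
  by move/(congr1 (fun v : F4 => v.2))/eqP; rewrite /= oner_eq0.
have := congr1 (fun v : F4 => v.1.1.2) (ann ((1, 0, 0, 0) : F4)).
have := congr1 (fun v : F4 => v.1.2) (ann ((1, 0, 0, 0) : F4)).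
rewrite /= !(mulr0, mul0r, mul1r, add0r, addr0) => a10 a00.
have := congr1 (fun v : F4 => v.1.2) (ann ((0, 0, 0, 1) : F4)).
rewrite /= a00 a10 !(mulr0, mul0r, mulr1, add0r, addr0) => /eqP.
rewrite mulf_eq0 (negPf b0) /= => /eqP a30.
exists ((a2, 0, 0, 0) : F4), ((1, 0, 0, 0) : F4), ((1, 0, 0, 0) : F4).
by rewrite a30; congr (_, _, _, _); rewrite /=; ringF.
Qed.

Lemma classes_cube :
  classes (fun A : assocAlg F => (\dim {:A}%VS = 4%N /\ nilpotent_alg A) /\ has_cube A)
    (@iso_alg F) 5.
Proof.
(* One class with x^4 <> 0, and four for d, b in {0, 1}. *)
have -> : 5%N = (1 + #|{: bool * bool}|)%N by rewrite card_prod card_bool.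
apply: (classes_split (Q := has_fourth)).
- exact: iso_alg_sym.
- by move=> A B _ _; apply: has_fourth_iso.
- apply: (classes1 (x0 := cyc)).
    split; last exact: cyc_has_fourth.
    split; first by split; [exact: dim_F4 | exact: cyc_nil].
    have [x x4] := cyc_has_fourth; exists x.
    by apply: contraNneq x4 => ->; rewrite amul0l.
  by move=> A [[[dA nA] _] [x x4]]; apply: cyc_iso nA dA x4.
apply: (classes_param (f := fun db : bool * bool => tri db.1%:R db.2%:R)).
- move=> [d b]; split; last by case=> x; rewrite [X in X != 0]tri4 eqxx.
  split; last exact: tri_has_cube.
  by split; [exact: dim_F4 | exact: tri_nil].
- move=> [d b] [d' b'] /= iso; have iso' := iso_alg_sym iso.
  have eqb (e e' : bool) : (e%:R = 0 :> F <-> e'%:R = 0 :> F) -> e = e'.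
    have one0 : (1 : F) = 0 -> False by move/eqP; rewrite oner_eq0.
    by case: e e' => [] [] // [h1 h2]; [case: (one0 (h2 erefl))|case: (one0 (h1 erefl))].
  congr (_, _); apply: eqb.
    split=> e; [apply/(comm_tri _ b'%:R)|apply/(comm_tri _ b%:R)].
      exact/(comm_alg_iso iso)/comm_tri.
    exact/(comm_alg_iso iso')/comm_tri.
  have nz (e : bool) : (e%:R = 0 :> F) <-> ~ (e%:R != 0 :> F).
    by split=> [->|/negP/negPn/eqP]; rewrite ?eqxx.
  split=> /nz h; apply/nz => h'; apply: h.
    exact/(ann_cubes_tri d%:R)/(ann_cubes_iso iso')/ann_cubes_tri.
  exact/(ann_cubes_tri d'%:R)/(ann_cubes_iso iso)/ann_cubes_tri.
move=> A [[[dA nA] [x x3]] n4].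
have x40 : amul A (amul A (amul A x x) x) x = 0.
  by apply/eqP/negPn/negP => x4; apply: n4; exists x.
have [d [b Adb]] := tri_iso nA dA x3 x40; exists (d != 0, b != 0).
exact: iso_alg_trans Adb (tri_normal d b).
Qed.

Lemma classes_forms0 :
  classes (fun W : {vspace 'M[F]_4} => \dim W = 0%N) (@congr_forms F 4) 1.
Proof.
apply: (classes1 (x0 := 0%VS)); first exact: dimv0.
move=> W /eqP; rewrite dimv_eq0 => /eqP->; exists 1%:M; first exact: unitmx1.
by move=> M; rewrite mul1mx trmx1 mulmx1.
Qed.

Lemma nil3_nilpotent (A : assocAlg F) : nil3 A -> nilpotent_alg A.
Proof.
move=> nA; exists 2%N => x s; case/tupleP: s => y s.
by case/tupleP: s => z s; rewrite tuple0; apply: nA.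
Qed.

(** When all cubes vanish, A^2 can have neither dimension 3 nor 4, and a square of dimension at most
    2 then forces A^3 = 0. *)
Lemma nocubeP (A : assocAlg F) : \dim {:A}%VS = 4%N ->
  nilpotent_alg A /\ ~ has_cube A <-> nil3 A /\ (\dim (sqalg A) <= 2)%N.
Proof.
move=> dA; split=> [[nA ncA]|[nA _]]; last first.
  by split; [exact: nil3_nilpotent | case=> x; rewrite nA eqxx].
have cube0 x : amul A (amul A x x) x = 0.
  by apply/eqP/negPn/negP => x3; apply: ncA; exists x.
have le2 : (\dim (sqalg A) <= 2)%N.
  have := dimvS (subvf (sqalg A)); rewrite dA.
  have := dim_sqalg_neq3 nA cube0 dA; have := dim_sqalg_neq4 nA dA.
  by case: (\dim _) => [|[|[|[|[|]]]]].
by split=> //; apply: cube0_nil3.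
Qed.

Lemma classes_nil4 :
  classes (fun A : assocAlg F => \dim {:A}%VS = 4%N /\ nilpotent_alg A)
    (@iso_alg F) (5 * #|F| + 17).
Proof.
(* Five classes with a nonzero cube; the others are sorted by the dimension 0, 1 or 2 of A^2. *)
have -> : (5 * #|F| + 17 = 5 + (1 + ((2 * #|F| + 7) + (3 * #|F| + 4))))%N by lia.
have isym := @iso_alg_sym F.
apply: (classes_split (Q := has_cube)) => //.
- by move=> A B _ _; apply: has_cube_iso.
- exact: classes_cube.
have sq k (A B : assocAlg F) :
    iso_alg A B -> \dim (sqalg A) = k -> \dim (sqalg B) = k.
  by move=> /iso_alg_dim_sqalg ->.
apply: (classes_split (Q := fun A => \dim (sqalg A) = 0%N)) => //.
- by move=> A B _ _; apply: sq.
- apply: classes_ext (classes_forms classes_forms0) => A.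
  split=> [[dA nA dS]|[[[dA nA] ncA] dS]];
    last by have [] := (nocubeP dA).1 (conj nA ncA).
  by have [] : nilpotent_alg A /\ ~ has_cube A by apply/(nocubeP dA); rewrite dS.
apply: (classes_split (Q := fun A => \dim (sqalg A) = 1%N)) => //.
- by move=> A B _ _; apply: sq.
- apply: classes_ext (classes_forms (classes_line classes_forms3)) => A.
  split=> [[dA nA dS]|[[[[dA nA] ncA] _] dS]];
    last by have [] := (nocubeP dA).1 (conj nA ncA).
  have [] : nilpotent_alg A /\ ~ has_cube A by apply/(nocubeP dA); rewrite dS.
  by rewrite dS; do !split.
apply: classes_ext (classes_forms classes_pencils) => A.
split=> [[dA nA dS]|[[[[dA nA] ncA] d0] d1]].
  have [] : nilpotent_alg A /\ ~ has_cube A by apply/(nocubeP dA); rewrite dS.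
  by rewrite dS; do !split.
have [nA3 dS] := (nocubeP dA).1 (conj nA ncA).
by split=> //; move: dS d0 d1; case: (\dim _) => [|[|[|]]].
Qed.

End CharTwo.

End Development.

Theorem corollary7p7 (F : finFieldType) (charF2 : 2%N \in [pchar F]%R) :
  num_iso_classes
    (fun A : assocAlg F => \dim {:A}%VS = 4 /\ nilpotent_alg A)
    (5 * #|F| + 17).
Proof. exact: classes_nil4. Qed.
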